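(* Let $\omega:\mathbb{R}^+\to\mathbb{R}^+$ be a function such that $\omega(t)/t$ is concave and $\sum_{n\ge1}\frac{1}{\omega(n)}=\infty$. Then there exist a compact set $K\subset\mathbb{T}$ of Lebesgue measure zero and a trigonometric series $\sum_{n\in\mathbb{Z}}c(n)e^{int}$ with not all $c(n)$ zero, whose symmetric partial sums converge to $0$ at every $t\in\mathbb{T}\setminus K$, and such that $c(n)=O\big(e^{-\omega(\log|n|)}\big)$ for $n<0$.
   Context: $\mathbb{T}=\mathbb{R}/2\pi\mathbb{Z}$; symmetric partial sums are $\sum_{|n|\le N}c(n)e^{int}$. *)

(* Defs.v *)
From HB Require Import structures.
From mathcomp Require Import all_boot all_order all_algebra.
From mathcomp Require Import all_classical all_reals all_analysis.
From mathcomp Require Import complex.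
Set Implicit Arguments. Unset Strict Implicit. Unset Printing Implicit Defensive.
Import Order.TTheory GRing.Theory Num.Theory ComplexField.
Local Open Scope ring_scope.

Definition expi (R : realType) (x : R) : R[i] := @Complex R (cos x) (sin x).

Definition sym_partial_sum (R : realType) (c : int -> R[i]) (t : R) (N : nat)
  : R[i] :=
  \sum_(0 <= k < (2 * N).+1)
     c (k%:Z - N%:Z) * expi ((k%:Z - N%:Z)%:~R * t).

Definition concave_on_pos (R : realType) (f : R -> R) : Prop :=
  forall x y (l : R), 0 < x -> 0 < y -> 0 <= l <= 1 ->
    l * f x + (1 - l) * f y <= f (l * x + (1 - l) * y).

(* Main.v *)
Require Import Defs.
From HB Require Import structures.
From mathcomp Require Import all_boot all_order all_algebra.
From mathcomp Require Import all_classical all_reals all_analysis.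
From mathcomp Require Import complex ring lra zify.
Import Order.TTheory GRing.Theory Num.Theory ComplexField.
Import numFieldNormedType.Exports.
Local Open Scope classical_set_scope.
Local Open Scope ring_scope.
Set Implicit Arguments. Unset Strict Implicit. Unset Printing Implicit Defensive.

Local Notation nc := Normc.normc.
Local Notation Re := complex.Re.
Local Notation Im := complex.Im.

(** Write [omega t = t * g t].  Positivity and concavity make [g] nondecreasing
    and [g t / t] nonincreasing, so that with [f = g + 3] the weight
    [W n = expR (s * f s)], [s = ln (64 + n)], is submultiplicative.

    The series is the formal product of factors [P_j (N_j t)], where
    [N_(j+1) = N_j * Q_j].  Up to an error that is small in the norm weighted by
    [W], each [P_j] is a polynomial in [e^(it)] of degree less than [Q_j], with
    constant term 1 and other coefficients tiny; and [P_j] vanishes on a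
    proportion at least [c / f (ln N_j)] of the arcs of length [2 pi / Q_j].
    To get it, multiply many rotated copies of a power of the truncation of
    [(1 - z) / (1 - r z)], which is very small near [z = 1]: greedily chosen
    rotations keep the [l^4] norm of the coefficients small while the bad arcs
    cover enough of the circle.  Then set the values on these arcs to zero and
    multiply the discrete Fourier transform by a kernel which is the transform
    of a functional carried by a very short interval.

    Coefficients of negative index come only from the errors, hence are
    [O(1 / W n)].  A point in a zero arc of some factor is a point of
    convergence to 0, by Rajchman's theory of formal multiplication.  Since
    [ln N_j] is a geometric progression, Cauchy condensation turns the
    divergence of the sum of [1 / omega n] into that of the sum of
    [1 / f (ln N_j)], so the points in no zero arc form a null set. *)

(** * Norms on the complex numbers and symmetric sums *)

(** Where the proportion [c / f (ln N_j)] comes from: put [N_j = d = M ^ 16], [l = ln M]. On its arc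
    a notch is about [8 ^- p], which must beat the weight at frequency [N_j * Q_j]; this forces [p]
    of order [l * f (16 * l)]. A notch has an arc of length about [1 / d] and raises the sup norm by
    at most [(1 + 2 / d) ^ p], so a sup norm [M ^ 2] allows about [d * l / p] rotations, covering a
    proportion about [l / p], that is [1 / f (ln N_j)] up to a constant. Why fourth powers: Parseval
    bounds the sum of squares of the coefficients only by [M ^ 4], whereas one rotation adds to the
    sum of fourth powers, on average, at most about [M ^ 8 / d ^ 2] up to powers of [p] and [ln Q].
    About [d] rotations then add [M ^ 8 / d], which is tiny for [d = M ^ 16]. Why a kernel on a
    short interval can be afforded: concavity of [g] gives [omega t = O(t ^ 2)], so [W n] is at most
    [exp (C * ln n ^ 2)], and a kernel decaying like [exp (- c * sqrt n)] beats it. *)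

Section ComplexNorm.
Variable R : realType.
Implicit Types (x y z : R[i]) (a b t : R).

Lemma nc_ge0 z : 0 <= nc z.
Proof. by case: z => a b; exact: sqrtr_ge0. Qed.

Lemma ncD x y : nc (x + y) <= nc x + nc y.
Proof. exact: le_normcD. Qed.

Lemma ncN x : nc (- x) = nc x.
Proof. exact: normcN. Qed.

Lemma ncB x y : nc (x - y) = nc (y - x).
Proof. by rewrite -ncN opprB. Qed.

Lemma ncBD x y : nc (x - y) <= nc x + nc y.
Proof. by rewrite (le_trans (ncD _ _))// ncN. Qed.

Lemma nc_dist x y z : nc (x - z) <= nc (x - y) + nc (y - z).
Proof. by rewrite (le_trans _ (ncD _ _))// addrA subrK. Qed.

Lemma ncM x y : nc (x * y) = nc x * nc y.
Proof. exact: Normc.normcM. Qed.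

Lemma nc0 : nc (0 : R[i]) = 0. Proof. exact: Normc.normc0. Qed.
Lemma nc1 : nc (1 : R[i]) = 1. Proof. exact: Normc.normc1. Qed.

Lemma ncX x n : nc (x ^+ n) = nc x ^+ n.
Proof. by elim: n => [|n IH]; rewrite ?expr0 ?nc1// !exprS ncM IH. Qed.

Lemma nc_sqr x : nc x ^+ 2 = Re x ^+ 2 + Im x ^+ 2.
Proof. by case: x => a b /=; rewrite sqr_sqrtr// addr_ge0 ?sqr_ge0. Qed.

Lemma nc_realC a : nc (a%:C)%C = `|a|.
Proof. by rewrite /= expr0n /= addr0 sqrtr_sqr. Qed.

Lemma nc_natr n : nc (n%:R : R[i]) = n%:R.
Proof.
by rewrite -[n%:R](rmorph_nat (real_complex R)) nc_realC ger0_norm.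
Qed.

Lemma nc_Re x : `|Re x| <= nc x.
Proof.
rewrite -(@ler_pXn2r _ 2) ?nnegrE ?nc_ge0 ?normr_ge0// nc_sqr real_normK ?num_real//.
by rewrite lerDl sqr_ge0.
Qed.

Lemma nc_le_ReIm x : nc x <= `|Re x| + `|Im x|.
Proof.
rewrite -(@ler_pXn2r _ 2) ?nnegrE ?nc_ge0 ?addr_ge0 ?normr_ge0// nc_sqr.
rewrite sqrrD !real_normK ?num_real//.
by rewrite lerD2r lerDl mulrn_wge0// mulr_ge0.
Qed.

Lemma nc_sum (I : Type) (r : seq I) (P : pred I) (F : I -> R[i]) :
  nc (\sum_(i <- r | P i) F i) <= \sum_(i <- r | P i) nc (F i).
Proof.
elim/big_ind2 : _ => [|x1 x2 y1 y2 h1 h2|//]; first by rewrite nc0.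
by rewrite (le_trans (ncD _ _)) ?lerD.
Qed.

Lemma Re_add x y : Re (x + y) = Re x + Re y.
Proof. by case: x y => [? ?] [? ?]. Qed.
Lemma Im_add x y : Im (x + y) = Im x + Im y.
Proof. by case: x y => [? ?] [? ?]. Qed.
Lemma Re_opp x : Re (- x) = - Re x. Proof. by case: x. Qed.
Lemma Im_opp x : Im (- x) = - Im x. Proof. by case: x. Qed.
Lemma Re_mul x y : Re (x * y) = Re x * Re y - Im x * Im y.
Proof. by case: x y => [? ?] [? ?]. Qed.
Lemma Im_mul x y : Im (x * y) = Re x * Im y + Im x * Re y.
Proof. by case: x y => [? ?] [? ?]. Qed.

Lemma Re_sum (I : Type) (r : seq I) (P : pred I) (F : I -> R[i]) :
  Re (\sum_(i <- r | P i) F i) = \sum_(i <- r | P i) Re (F i).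
Proof. by elim/big_rec2: _ => // i a z _ <-; rewrite Re_add. Qed.

Lemma nc_expi t : nc (expi t) = 1.
Proof. by rewrite /expi /= cos2Dsin2 sqrtr1. Qed.

Lemma expiD a b : expi (a + b) = expi a * expi b.
Proof.
rewrite /expi cosD sinD; apply/eqP; rewrite eq_complex Re_mul Im_mul /=.
by rewrite eqxx /= addrC.
Qed.

Lemma expi0 : expi (0 : R) = 1.
Proof. by rewrite /expi cos0 sin0. Qed.

Lemma expi_neq0 t : expi t != 0.
Proof. by apply/eqP => h; have := nc_expi t; rewrite h nc0; lra. Qed.

Lemma expiN t : expi (- t) = (expi t)^-1.
Proof.
by apply: (mulfI (expi_neq0 t)); rewrite -expiD subrr expi0 divff// expi_neq0.
Qed.

Lemma expi_natM t n : expi (n%:R * t) = expi t ^+ n.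
Proof.
elim: n => [|n IH]; first by rewrite mul0r expr0 expi0.
by rewrite exprS -IH -expiD -natr1; congr expi; ring.
Qed.

Lemma expi_2pi : expi (2 * pi : R) = 1.
Proof. by rewrite /expi mulr_natl cos2pi sin2pi. Qed.

Lemma expi_2piM (k : int) : expi (k%:~R * (2 * pi) : R) = 1.
Proof.
case: k => n; first by rewrite expi_natM expi_2pi expr1n.
by rewrite NegzE mulrNz mulNr expiN expi_natM expi_2pi expr1n invr1.
Qed.

Lemma abs_sin_le t : `|sin t| <= `|t|.
Proof.
wlog t0 : t / 0 <= t => [th|].
  have [/th//|t0] := leP 0 t.
  by rewrite -normrN -sinN -[`|t|]normrN; apply: th; lra.
rewrite (ger0_norm t0).
have [->|tn0] := eqVneq t 0; first by rewrite sin0 normr0.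
have tp : 0 < t by lra.
have drv (x : R) : is_derive x 1 (@sin R) (cos x) by exact: is_derive_sin.
have [c _] : exists2 c, c \in `]0, t[%R & sin t - sin 0 = cos c * (t - 0).
  apply: MVT => //; apply: continuous_subspaceT => x.
  exact: continuous_sin.
rewrite sin0 !subr0 => ->; rewrite normrM (ger0_norm t0).
by rewrite ler_piMl// cos_max.
Qed.

Lemma nc_expi_sub1 t : nc (expi t - 1) = 2 * `|sin (t / 2)|.
Proof.
rewrite -[RHS]ger0_norm ?mulr_ge0//; apply/eqP.
rewrite -(@eqrXn2 _ 2)// ?nc_ge0 ?normr_ge0// nc_sqr real_normK ?num_real// exprMn.
rewrite real_normK ?num_real// Re_add Im_add Re_opp Im_opp /= oppr0 addr0; apply/eqP.
have {1 2}-> : t = (t / 2) *+ 2 by rewrite -mulr_natr divfK.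
rewrite cos_mulr2n sin_mulr2n.
have := cos2Dsin2 (t / 2); move: (cos _) (sin _) => c s cs.
have -> : c ^+ 2 = 1 - s ^+ 2 by lra.
transitivity ((2 * s ^+ 2) ^+ 2 + 4 * (c ^+ 2) * s ^+ 2); first by ring.
have -> : c ^+ 2 = 1 - s ^+ 2 by lra.
by ring.
Qed.

Lemma expi_lip a b : nc (expi a - expi b) <= `|a - b|.
Proof.
have -> : expi a - expi b = expi b * (expi (a - b) - 1).
  by rewrite mulrBr mulr1 -expiD [b + _]addrC subrK.
rewrite ncM nc_expi mul1r nc_expi_sub1; move: (a - b) => t.
have := abs_sin_le (t / 2); rewrite normrM [`|2^-1|]ger0_norm//.
by move: (`|_|) (`|_|) => x y; lra.
Qed.

End ComplexNorm.

Section SymmetricSum.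

(** The indexing copies that of [sym_partial_sum], so that the two are convertible. All series are
    handled through these finite sums, which avoids summability conditions. *)
Definition zs (V : nmodType) (L : nat) (f : int -> V) : V :=
  \sum_(0 <= i < (2 * L).+1) f (i%:Z - L%:Z).

Lemma zs_ext (V : nmodType) L (f g : int -> V) :
  (forall k, f k = g k) -> zs L f = zs L g.
Proof. by move=> fg; apply: eq_bigr => i _; rewrite fg. Qed.

Lemma zsD (V : nmodType) L (f g : int -> V) :
  zs L (fun k => f k + g k) = zs L f + zs L g.
Proof. exact: big_split. Qed.

Lemma zsMl (V : pzRingType) L (a : V) (f : int -> V) :
  zs L (fun k => a * f k) = a * zs L f.
Proof. by rewrite /zs big_distrr. Qed.

Lemma zsMr (V : pzRingType) L (a : V) (f : int -> V) :
  zs L (fun k => f k * a) = zs L f * a.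
Proof. by rewrite /zs big_distrl. Qed.

Lemma zsN (V : zmodType) L (f : int -> V) :
  zs L (fun k => - f k) = - zs L f.
Proof. by rewrite /zs sumrN. Qed.

Lemma zsB (V : zmodType) L (f g : int -> V) :
  zs L (fun k => f k - g k) = zs L f - zs L g.
Proof. by rewrite zsD zsN. Qed.

Lemma zs_const0 (V : nmodType) L : zs L (fun=> 0 : V) = 0.
Proof. exact: big1. Qed.

Lemma zs0E (V : nmodType) (f : int -> V) : zs 0 f = f 0.
Proof. by rewrite /zs muln0 big_nat1 subrr. Qed.

Lemma zsS (V : nmodType) L (f : int -> V) :
  zs L.+1 f = zs L f + (f L.+1%:Z + f (- L.+1%:Z)).
Proof.
rewrite /zs mulnS !addSn add0n big_nat_recr//= big_nat_recl//=.
rewrite sub0r [LHS]addrC.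
have -> : (2 * L).+2%:Z - L.+1%:Z = L.+1%:Z by lia.
rewrite addrA addrC; congr (_ + _).
by apply: eq_bigr => i _; congr f; lia.
Qed.

Lemma zs_exchange (V : nmodType) L (I : Type) (r : seq I) (P : pred I)
    (f : int -> I -> V) :
  zs L (fun k => \sum_(i <- r | P i) f k i) =
  \sum_(i <- r | P i) zs L (f ^~ i).
Proof. exact: exchange_big. Qed.

Lemma zs_zs (V : nmodType) L X (f : int -> int -> V) :
  zs L (fun k => zs X (f k)) = zs X (fun n => zs L (f ^~ n)).
Proof. exact: exchange_big. Qed.

Lemma zs_single (V : nmodType) L (f : int -> V) k0 :
  (forall k, k != k0 -> f k = 0) ->
  zs L f = if (`|k0| <= L)%N then f k0 else 0.
Proof.
move=> f0; elim: L => [|L IH].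
  rewrite zs0E leqn0 absz_eq0.
  by case: eqP => [->//|/eqP k00]; rewrite f0// eq_sym.
rewrite zsS IH; have [k0L|Lk0] := leqP `|k0| L.
  have -> : (`|k0| <= L.+1)%N by lia.
  by rewrite (f0 L.+1%:Z) 1?(f0 (- L.+1%:Z)) ?addr0//; lia.
rewrite add0r; case: leqP => h.
  have [h1|h1] := leP 0 k0.
    by have -> : k0 = L.+1%:Z by [lia]; rewrite (f0 (- _)) ?addr0//; lia.
  by have -> : k0 = - L.+1%:Z by [lia]; rewrite (f0 L.+1%:Z) ?add0r//; lia.
by rewrite (f0 L.+1%:Z) 1?(f0 (- L.+1%:Z)) ?addr0//; lia.
Qed.

Variable R : realType.

Lemma ler_zs L (f g : int -> R) :
  (forall k, (`|k| <= L)%N -> f k <= g k) -> zs L f <= zs L g.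
Proof.
move=> fg; rewrite /zs big_nat [leRHS]big_nat; apply: ler_sum => i hi.
by apply: fg; lia.
Qed.

Lemma nc_zs L (f : int -> R[i]) : nc (zs L f) <= zs L (fun k => nc (f k)).
Proof. exact: nc_sum. Qed.

Lemma nc_zs_single L (f : int -> R[i]) k0 :
  (forall k, k != k0 -> f k = 0) -> nc (zs L f) <= nc (f k0).
Proof.
by move=> /zs_single ->; case: ifP => // _; rewrite nc0 nc_ge0.
Qed.

Lemma zs_shift1 X (g : int -> R[i]) m :
  zs X (fun n => g (n - (m + 1))) - zs X (fun n => g (n - m)) =
  g (- X%:Z - m - 1) - g (X%:Z - m).
Proof.
elim: X => [|X IH].
  by rewrite !zs0E; congr (g _ - g _); lia.
rewrite (zsS _ (fun n => g (n - (m + 1)))) (zsS _ (fun n => g (n - m))).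
have -> : X.+1%:Z - (m + 1) = X%:Z - m by lia.
have -> : - X.+1%:Z - (m + 1) = - X.+1%:Z - m - 1 by lia.
move: IH; have -> : - X%:Z - m - 1 = - X.+1%:Z - m by lia.
by move=> /eqP; rewrite subr_eq => /eqP ->; ring.
Qed.

Lemma zs_opp (V : nmodType) X (g : int -> V) :
  zs X (fun n => g (- n)) = zs X g.
Proof.
elim: X => [|X IH]; first by rewrite !zs0E oppr0.
by rewrite !zsS IH opprK [g (- _) + _]addrC.
Qed.

Lemma nc_zs_shift_nat X (g : int -> R[i]) (k : nat) B :
  (forall n, (`|n| + k >= X)%N -> nc (g n) <= B) ->
  nc (zs X (fun n => g (n - k%:Z)) - zs X g) <= (2 * k)%:R * B.
Proof.
elim: k => [|k IH] hB.
  rewrite muln0 mul0r (zs_ext _ (g := g)) ?subrr ?nc0// => n.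
  by rewrite subr0.
apply: (le_trans (nc_dist _ (zs X (fun n => g (n - k%:Z))) _)).
have -> : k.+1%:Z = k%:Z + 1 by lia.
rewrite zs_shift1 (_ : (2 * k.+1)%:R * B = B + B + (2 * k)%:R * B).
  apply: lerD; last by apply: IH => n hn; apply: hB; lia.
  apply: (le_trans (ncBD _ _)).
  by apply: lerD; apply: hB; lia.
by rewrite mulnS natrD mulrDl; congr (_ + _); ring.
Qed.

Lemma nc_zs_shift X (g : int -> R[i]) (k : int) B :
  (forall n, (`|n| + `|k| >= X)%N -> nc (g n) <= B) ->
  nc (zs X (fun n => g (n - k)) - zs X g) <= (2 * `|k|)%:R * B.
Proof.
case: k => k hB; first exact: nc_zs_shift_nat.
have := @nc_zs_shift_nat X (fun n => g (- n)) k.+1 B.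
rewrite -(zs_opp _ g) -(zs_opp _ (fun n => g (n - Negz k))).
rewrite (_ : (fun n => g (- n - Negz k)) = fun n => g (- (n - k.+1%:Z))).
  by apply => n hn; apply: hB; lia.
by apply/funext => n; congr g; lia.
Qed.

End SymmetricSum.

(** * Formal multiplication of trigonometric series *)

Section UltraLimit.
Variable R : realType.

Lemma ultra_fmap (S U : Type) (f : S -> U) (F : set_system S) :
  UltraFilter F -> UltraFilter (f @ F).
Proof.
move=> UF; split; first by apply: fmap_proper_filter.
move=> G GF sFG; apply/seteqP; split=> A; last exact: sFG.
move=> GA; have [//|FnA] := in_ultra_setVsetC (f @^-1` A) UF.
have GnA : G (~` A) by exact: sFG.
by have [x []] := @filter_ex _ _ GF _ (filterI GA GnA).
Qed.

(** An ultrafilter finer than [\oo] gives the limits at all [n] at once, in place of a diagonal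
    extraction. What is kept of it: arbitrarily large [K] approximate [c] on any finite window. *)
Lemma bounded_frequent_limit (x : nat -> int -> R[i]) (B : R) :
  (forall K n, nc (x K n) <= B) ->
  exists c : int -> R[i], forall X (e : R) K0, 0 < e -> exists2 K, (K0 <= K)%N &
    forall n : int, (`|n| <= X)%N -> nc (x K n - c n) <= e.
Proof.
move=> xB.
have [F [UF ooF]] := @ultraFilterLemma nat \oo _.
have FF : ProperFilter F by exact: ultra_proper.
have lim1 (y : nat -> R) : (forall K, `|y K| <= B) -> exists l : R, y @ F --> l.
  move=> yB.
  have : compact `[- B, B] by exact: segment_compact.
  rewrite compact_ultra => /(_ (y @ F) (ultra_fmap _ UF)) [].
    have : F (y @^-1` `[- B, B]) => //.
    by apply: filterS (@filterT _ F _) => K _ /=; rewrite in_itv /= -ler_norml.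
  by move=> l [_ h]; exists l.
have /choice [cr hcr] : forall n, exists l : R, (fun K => Re (x K n)) @ F --> l.
  move=> n; by apply: lim1 => K; exact: le_trans (nc_Re _) (xB _ _).
have /choice [ci hci] : forall n, exists l : R, (fun K => Im (x K n)) @ F --> l.
  move=> n; apply: lim1 => K; apply: le_trans (xB K n).
  rewrite -(@ler_pXn2r _ 2) ?nnegrE ?nc_ge0 ?normr_ge0//.
  by rewrite nc_sqr real_normK ?num_real// lerDr sqr_ge0.
exists (fun n => Complex (cr n) (ci n)) => X e K0 e0.
have near1 n : F [set K | nc (x K n - Complex (cr n) (ci n)) <= e].
  have /cvgrPdist_le/(_ (e / 2) ltac:(lra)) h1 := hcr n.
  have /cvgrPdist_le/(_ (e / 2) ltac:(lra)) h2 := hci n.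
  apply: filterS (filterI h1 h2) => K [/= k1 k2].
  apply: (le_trans (nc_le_ReIm _)); rewrite Re_add Im_add Re_opp Im_opp /=.
  by rewrite distrC [X in _ + X]distrC; lra.
have nearX : F [set K | forall n : int, (`|n| <= X)%N ->
    nc (x K n - Complex (cr n) (ci n)) <= e].
  elim: X => [|X IH].
    apply: filterS (near1 0) => K /= h n.
    by rewrite leqn0 absz_eq0 => /eqP ->.
  apply: filterS (filterI IH (filterI (near1 X.+1%:Z) (near1 (- X.+1%:Z)))) => K /= [h1 [h2 h3]] n nX.
  have [/h1//|nX1] := leqP `|n|%N X.
  have [n0|n0] := leP 0 n.
    by have -> : n = X.+1%:Z by lia.
  by have -> : n = - X.+1%:Z by lia.
have K0F : F [set K | (K0 <= K)%N].
  by apply: ooF; exists K0.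
have [K [KX KK]] := @filter_ex _ _ FF _ (filterI nearX K0F).
by exists K.
Qed.

End UltraLimit.

(** * Infinite products of lacunary factors *)

Section Assembly.
Variables (R : realType) (W : nat -> R) (N : nat -> nat).
Variables (A Rm : nat -> int -> R[i]) (eps : nat -> R).

Let a j k := A j k + Rm j k.
Let tau j : R := 2^-1 ^+ (j + 3).
(** [T j] is the sum of [2 * tau i] over [i >= j]: the total influence of the errors from factor [j]
    on. *)
Let T j : R := 2^-1 ^+ j.+1.

Hypothesis W_ge1 : forall n, 1 <= W n.
Hypothesis W_mono : forall m n, (m <= n)%N -> W m <= W n.
Hypothesis W_submul : forall m n, W (m + n) <= W m * W n.
Hypothesis W_sqr : forall n, n%:R ^+ 2 <= W n.
Hypothesis N_gt0 : forall j, (0 < N j)%N.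
Hypothesis N_dvd : forall j, (N j %| N j.+1)%N.
Hypothesis A_supp : forall j k, A j k != 0 ->
  (0 <= k < (N j.+1)%:Z) && (N j %| k)%Z.
Hypothesis R_supp : forall j k, Rm j k != 0 -> (N j %| k)%Z.
Hypothesis A_0 : forall j, A j 0 = 1.
Hypothesis A_eps : forall j k, k != 0 -> nc (A j k) <= eps j.
Hypothesis eps_le1 : forall j, eps j <= 1.
Hypothesis eps_mono : forall j, eps j.+1 <= eps j.
Hypothesis eps_to0 : forall e : R, 0 < e -> exists J, eps J <= e.
Hypothesis R_weight : forall j L,
  zs L (fun k => nc (Rm j k) * W `|k|) <= tau j.

Let tau_gt0 j : 0 < tau j. Proof. by rewrite exprn_gt0. Qed.
Let T_gt0 j : 0 < T j. Proof. by rewrite exprn_gt0. Qed.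
Let T_step j : T j = T j.+1 + 2 * tau j.
Proof. by rewrite /T /tau addn3 !exprS; move: (_ ^+ j) => x; lra. Qed.
Let T_le j : T j <= 2^-1.
Proof. by rewrite /T exprS ler_piMr// exprn_ile1//; lra. Qed.
Let A_le1 j k : nc (A j k) <= 1.
Proof.
have [->|k0] := eqVneq k 0; first by rewrite A_0 nc1.
exact: le_trans (A_eps _ k0) (eps_le1 _).
Qed.
Let W_gt0 n : 0 < W n. Proof. exact: lt_le_trans (W_ge1 n). Qed.

(** Coefficient at [n] of the product of the factors [j], ..., [j + m - 1], each cut to frequencies
    [|k| <= L] to make the convolutions finite. The estimates are uniform in [L] and [m]. *)
Fixpoint tailc (L j m : nat) (n : int) : R[i] :=
  if m is m'.+1 then zs L (fun k => a j k * tailc L j.+1 m' (n - k))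
  else (n == 0)%:R.

Lemma tailc_supp L j m n : ~~ (N j %| n)%Z -> tailc L j m n = 0.
Proof.
elim: m j n => [|m IH] j n /=; first by case: eqP => // ->; rewrite dvdz0.
move=> ndv; rewrite -[RHS](zs_const0 _ L); apply: zs_ext => k.
have [dk|ndk] := boolP (N j %| k)%Z; last first.
  have [ak|/R_supp dk] := eqVneq (Rm j k) 0; last by rewrite dk in ndk.
  have [ak2|/A_supp/andP[_ dk]] := eqVneq (A j k) 0; last by rewrite dk in ndk.
  by rewrite /a ak ak2 addr0 mul0r.
rewrite IH ?mulr0//; apply: contra ndv => dnk.
rewrite -[n](subrK k) rpredD//; apply: dvdz_trans dnk.
exact: N_dvd.
Qed.

(** [A j] lives on [[0, N j.+1)] and [u] on multiples of [N j.+1], so the main part of the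
    convolution has a single term, the one given by the residue of [n]. Main terms thus never
    accumulate; only the errors do. *)
Lemma conv_bound L j (u : int -> R[i]) n :
  (forall l, ~~ (N j.+1 %| l)%Z -> u l = 0) ->
  nc (zs L (fun k => a j k * u (n - k))) <=
  nc (A j (n %% (N j.+1)%:Z)%Z) * nc (u (n - (n %% (N j.+1)%:Z)%Z)) +
  zs L (fun k => nc (Rm j k) * nc (u (n - k))).
Proof.
move=> us; set k0 := (n %% _)%Z.
have N1 : (N j.+1)%:Z != 0 by have := N_gt0 j.+1; lia.
under zs_ext => k do rewrite /a mulrDl.
rewrite zsD (le_trans (ncD _ _))// lerD//.
  rewrite -ncM; apply: (@nc_zs_single _ L (fun k => A j k * u (n - k)) k0) => k kk.
  have [->|/A_supp/andP[/andP[k1 k2] _]] := eqVneq (A j k) 0; first by rewrite mul0r.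
  rewrite us ?mulr0//; apply: contra kk => dv.
  have h : (n %% (N j.+1)%:Z = k %% (N j.+1)%:Z)%Z by apply/eqP; rewrite eqz_mod_dvd.
  by rewrite /k0 h modz_small//; lia.
rewrite (le_trans (nc_zs _ _))// ler_zs// => k _.
by rewrite ncM.
Qed.

Lemma resid_bound L j (f : int -> R) B : 0 <= B ->
  (forall k, f k <= B * W `|k|) ->
  zs L (fun k => nc (Rm j k) * f k) <= B * tau j.
Proof.
move=> B0 fB; apply: (@le_trans _ _ (B * zs L (fun k => nc (Rm j k) * W `|k|))).
  rewrite -zsMl; apply: ler_zs => k _.
  by rewrite mulrCA ler_wpM2l ?nc_ge0.
by rewrite ler_wpM2l.
Qed.

Lemma tailc_bound L j m n : nc (tailc L j m n) <= 1 + T j.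
Proof.
elim: m j n => [|m IH] j n /=.
  by case: (_ == _); rewrite ?nc1 ?nc0; have := T_gt0 j; lra.
rewrite (le_trans (conv_bound L n (tailc_supp L m)))// T_step addrA lerD//.
  by rewrite -[leRHS]mul1r ler_pM ?nc_ge0.
apply: resid_bound => // k; apply: (le_trans (IH _ _)).
by have := W_ge1 `|k|; have := T_le j.+1; lra.
Qed.

Lemma tailc_le2 L j m n : nc (tailc L j m n) <= 2.
Proof. by apply: (le_trans (tailc_bound _ _ _ _)); have := T_le j; lra. Qed.

Let resid2 L j m n :
  zs L (fun k => nc (Rm j k) * nc (tailc L j.+1 m (n - k))) <= 2 * tau j.
Proof.
apply: resid_bound => // k; apply: (le_trans (tailc_le2 _ _ _ _)).
by have := W_ge1 `|k|; lra.
Qed.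

(** In the single main term either the index left for the tail is 0, and then [A j] is taken at
    [n != 0] and is small, or it is nonzero and the induction hypothesis applies. *)
Lemma tailc_offdiag L j m n : n != 0 -> nc (tailc L j m n) <= 2 * eps j + T j.
Proof.
have eps_ge0 i : 0 <= eps i by apply: le_trans (nc_ge0 (A i 1)) (A_eps i _).
elim: m j n => [|m IH] j n n0 /=.
  rewrite (negPf n0) nc0; have := T_gt0 j; have := eps_ge0 j; lra.
rewrite (le_trans (conv_bound L n (tailc_supp L m)))// T_step addrA lerD//.
set k0 := (n %% _)%Z.
have [nk|nk] := eqVneq (n - k0) 0.
  have k00 : k0 != 0 by lia.
  have := A_eps j k00; have := tailc_le2 L j.+1 m (n - k0).
  have := nc_ge0 (A j k0); have := nc_ge0 (tailc L j.+1 m (n - k0)).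
  have := T_gt0 j.+1; have := eps_ge0 j.
  by move: (nc _) (nc _) (eps j) (T _) => x y e t; nra.
have := IH j.+1 _ nk; have := A_le1 j k0; have := nc_ge0 (A j k0).
have := nc_ge0 (tailc L j.+1 m (n - k0)); have := eps_mono j.
by move: (nc _) (nc _) (eps j) (eps j.+1) (T _) => x y e e' t; nra.
Qed.

(** The main term subtracts a residue [k0 >= 0], which moves a negative index further from 0, and
    [W] is monotone. In an error term either the jump [k] alone has size at least [n], or [W_submul]
    shares the weight between [k] and the remaining negative index. *)
Lemma tailc_negative L j m (n : nat) :
  (0 < n)%N -> nc (tailc L j m (- n%:Z)) * W n <= T j.
Proof.
elim: m j n => [|m IH] j n n0 /=.
  by rewrite (_ : (_ == 0) = false) ?nc0 ?mul0r ?ltW//; lia.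
have Wn0 := W_gt0 n.
apply: (@le_trans _ _ ((nc (A j (- n%:Z %% (N j.+1)%:Z)%Z) *
   nc (tailc L j.+1 m (- n%:Z - (- n%:Z %% (N j.+1)%:Z)%Z)) +
   zs L (fun k => nc (Rm j k) * nc (tailc L j.+1 m (- n%:Z - k)))) * W n)).
  by rewrite ler_pM2r// (conv_bound L (- n%:Z) (tailc_supp L m)).
set k0 := (_ %% _)%Z; rewrite mulrDl T_step lerD//.
  have k00 : 0 <= k0 by apply: modz_ge0; have := N_gt0 j.+1; lia.
  set l := `|- n%:Z - k0|%N.
  have El : - n%:Z - k0 = - l%:Z by rewrite /l; lia.
  have ln : (n <= l)%N by rewrite /l; lia.
  have := IH j.+1 l (leq_trans n0 ln); rewrite -El; apply: le_trans.
  apply: (@le_trans _ _ (nc (tailc L j.+1 m (- n%:Z - k0)) * W n)).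
    by rewrite ler_pM2r// -[leRHS]mul1r ler_wpM2r ?nc_ge0.
  by rewrite ler_wpM2l ?nc_ge0// W_mono.
rewrite -zsMr; under zs_ext => k do rewrite -mulrA.
apply: resid_bound => // k.
have [kn|kn] := leP 0 (- n%:Z - k).
  have := tailc_le2 L j.+1 m (- n%:Z - k).
  have : W n <= W `|k| by apply: W_mono; lia.
  by move: (nc_ge0 (tailc L j.+1 m (- n%:Z - k))); move: (nc _) => x; nra.
set l := `|- n%:Z - k|%N.
have El : - n%:Z - k = - l%:Z by rewrite /l; lia.
have l0 : (0 < l)%N by rewrite /l; lia.
have := IH j.+1 l l0; rewrite -El => IHl.
have Wle : W n <= W l * W `|k|.
  by apply: le_trans (W_submul _ _); apply: W_mono; rewrite /l; lia.
apply: (@le_trans _ _ (nc (tailc L j.+1 m (- n%:Z - k)) * (W l * W `|k|))).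
  by rewrite ler_wpM2l ?nc_ge0.
apply: (@le_trans _ _ (T j.+1 * W `|k|)).
  by rewrite mulrA ler_pM2r.
by rewrite ler_pM2r//; have := T_le j.+1; lra.
Qed.

Lemma tailc_at0 L j m : nc (tailc L j m 0 - 1) <= T j.
Proof.
elim: m j => [|m IH] j.
  by rewrite (_ : tailc L j 0 0 = 1)// subrr nc0 ltW.
rewrite /=.
have -> : zs L (fun k => a j k * tailc L j.+1 m (0 - k)) - 1 =
    (tailc L j.+1 m 0 - 1) + zs L (fun k => Rm j k * tailc L j.+1 m (0 - k)).
  under zs_ext => k do rewrite /a mulrDl.
  rewrite zsD (@zs_single _ L (fun k => A j k * tailc L j.+1 m (0 - k)) 0).
    by rewrite leq0n A_0 mul1r subr0 addrAC.
  move=> k k0.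
  have [->|/A_supp/andP[/andP[k1 k2] _]] := eqVneq (A j k) 0; first by rewrite mul0r.
  rewrite tailc_supp ?mulr0// sub0r rpredN; apply: contra k0.
  by move=> /dvdz_mod0P; rewrite modz_small; [move=> ->|lia].
rewrite (le_trans (ncD _ _))// T_step lerD//.
rewrite (le_trans (nc_zs _ _))//; apply: le_trans (resid2 L j m 0).
by apply: ler_zs => k _; rewrite ncM.
Qed.

(** Coefficients tending to 0, uniformly in [L] and [m], are what Rajchman multiplication requires
    of the tail. The proof goes backwards: far out, [tailc_offdiag] is already small for all
    [n != 0], and each step down costs a factor [1 + tau j]. *)
Let udecay j (e : R) := exists X, forall L m n, (X <= `|n|)%N ->
  nc (tailc L j m n) <= e.

Let udecay_step j e : 0 < e -> udecay j.+1 e -> udecay j ((1 + tau j) * e).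
Proof.
move=> e0 [X hX].
have [Y hY] : exists Y : nat, 2 / e <= Y%:R.
  by exists (Num.truncn (2 / e)).+1; rewrite ltW// truncnS_gt.
exists (X + Y + N j.+1)%N => L [|m] n hn.
  rewrite /= (_ : (_ == 0) = false) ?nc0.
    by rewrite mulr_ge0 ?ltW// addr_gt0.
  by have := N_gt0 j.+1; lia.
rewrite /= (le_trans (conv_bound L n (tailc_supp L m)))// mulrDl mul1r lerD//.
  have N1 : (N j.+1)%:Z != 0 by have := N_gt0 j.+1; lia.
  have h1 := modz_ge0 n N1; have h2 := ltz_pmod n (_ : 0 < (N j.+1)%:Z).
  have {}h2 := h2 ltac:(by have := N_gt0 j.+1; lia).
  rewrite -[leRHS]mul1r ler_pM ?nc_ge0//; apply: hX.
  by move: (_ %% _)%Z h1 h2 => k; lia.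
rewrite mulrC; apply: resid_bound; first exact: ltW.
move=> k; have [kY|kY] := leqP `|k| Y.
  apply: (@le_trans _ _ e); first by apply: hX; lia.
  by rewrite ler_peMr// ltW.
apply: (le_trans (tailc_le2 _ _ _ _)).
have : 2 <= e * Y%:R by rewrite mulrC -ler_pdivrMr.
move=> /le_trans -> //; rewrite ler_pM2l//.
apply: le_trans (W_sqr _); rewrite expr2.
have h : (Y%:R : R) <= `|k|%:R by rewrite ler_nat ltnW.
apply: (le_trans h); rewrite ler_peMl// ?ler1n.
by lia.
Qed.

Lemma tailc_udecay j (e : R) : 0 < e -> exists X, forall L m n, (X <= `|n|)%N ->
  nc (tailc L j m n) <= e.
Proof.
move=> e0.
have mono i x y : x <= y -> udecay i x -> udecay i y.
  by move=> xy [X hX]; exists X => L m n /hX /le_trans; apply.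
have e8 : 0 < e / 8 by lra.
have [J hJ] := eps_to0 e8.
have eps_anti i k : eps (i + k)%N <= eps i.
  elim: k => [|k IH]; first by rewrite addn0.
  by rewrite addnS (le_trans (eps_mono _)).
have [J1 hJ1] : exists J1, forall i, T (i + J1) <= e / 8.
  exists (Num.truncn (8 / e)) => i; set k := Num.truncn _.
  have h : 8 / e < k.+1%:R by rewrite truncnS_gt.
  rewrite /T exprVn -natrX -[e / 8]invrK lef_pV2 ?posrE ?invr_gt0//.
  rewrite invf_div (le_trans (ltW h))// ler_nat.
  by rewrite (leq_trans _ (ltnW (ltn_expl _ _)))// ltnS leq_addl.
have base : udecay (j + (J + J1)) (e / 2).
  exists 1%N => L m n n1.
  have n0 : n != 0 by lia.
  apply: (le_trans (tailc_offdiag L _ m n0)).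
  have := hJ1 (j + J)%N; rewrite addnA.
  have := eps_anti J (j + J1)%N; rewrite addnCA addnA.
  by move: hJ; move: (eps _) (eps _) (T _) => x y z; lra.
(* The factors [1 + tau] multiply to at most [1 + 2 * T i <= 2], which the initial [e / 2]
   absorbs. *)
have desc k i : udecay (i + k) (e / 2) -> udecay i ((1 + 2 * T i) * (e / 2)).
  elim: k i => [|k IH] i.
    rewrite addn0; apply: mono; have := T_gt0 i; move: (T i) => x; nra.
  rewrite addnS -addSn => /IH /udecay_step h.
  have pos : 0 < (1 + 2 * T i.+1) * (e / 2).
    by have := T_gt0 i.+1; move: (T _) => x; nra.
  have /mono := h pos.
  apply; rewrite mulrA ler_pM2r; last by lra.
  rewrite (T_step i).
  have := T_gt0 i.+1; have := T_le i.+1; have := tau_gt0 i.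
  by move: (T _) (tau _) => x y; nra.
apply: (@mono j ((1 + 2 * T j) * (e / 2))); last exact: desc base.
by have := T_le j; move: (T j) => x; nra.
Qed.

(** In [rajchman_step] one power of [|k|] counts the boundary terms of a shifted window; the second
    one makes the frequencies beyond half the window negligible. *)
Let a_moment j : exists M : R, 0 < M /\ forall L,
  zs L (fun k => nc (a j k) * (1 + `|k|%:R ^+ 2)) <= M.
Proof.
exists ((1 + (N j.+1)%:R ^+ 2) * (N j.+1).+1%:R + 2 * tau j + 1); split.
  by rewrite ltr_pwDr// addr_ge0 ?mulr_ge0 ?addr_ge0 ?sqr_ge0// ltW.
move=> L.
apply: (@le_trans _ _ (zs L (fun k => nc (A j k) * (1 + `|k|%:R ^+ 2)) +
   zs L (fun k => nc (Rm j k) * (1 + `|k|%:R ^+ 2)))).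
  rewrite -zsD; apply: ler_zs => k _; by rewrite -mulrDl ler_wpM2r ?ncD.
apply: (@le_trans _ _ ((1 + (N j.+1)%:R ^+ 2) * (N j.+1).+1%:R + 2 * tau j)).
  apply: lerD; last first.
    apply: resid_bound => // k.
    by have := W_ge1 `|k|; have := W_sqr `|k|; lra.
  apply: (@le_trans _ _ (zs L (fun k => (1 + (N j.+1)%:R ^+ 2) *
      \sum_(0 <= i < N j.+1) (k == i%:Z)%:R))).
    apply: ler_zs => k _.
    have [->|Ak] := eqVneq (A j k) 0.
      rewrite nc0 mul0r mulr_ge0 ?addr_ge0 ?sqr_ge0//.
      by apply: sumr_ge0 => i _; rewrite ler0n.
    have /andP[/andP[k0 kN] _] := A_supp Ak.
    have -> : \sum_(0 <= i < N j.+1) (k == i%:Z)%:R = 1 :> R.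
      rewrite (bigD1_seq `|k|%N) ?iota_uniq//=; last by rewrite mem_index_iota; lia.
      rewrite big1 ?addr0; last by move=> i ik; case: eqP => // ki; lia.
      by rewrite (_ : (k == _)) //; lia.
    rewrite mulr1 -[leRHS]mul1r ler_pM ?nc_ge0 ?addr_ge0 ?sqr_ge0//.
    by rewrite lerD2l lerXn2r ?nnegrE// ler_nat; lia.
  rewrite zsMl ler_wpM2l ?addr_ge0 ?sqr_ge0//.
  rewrite zs_exchange (@le_trans _ _ (\sum_(0 <= i < N j.+1) 1))//.
    apply: ler_sum => i _.
    rewrite (@zs_single _ L _ i%:Z); last by move=> k /negPf ->.
    by rewrite eqxx; case: ifP.
  by rewrite sumr_const_nat subn0 ler_nat.
by rewrite lerDl.
Qed.

(** Exchanging the sums, frequency [k] of factor [j] multiplies a partial sum of the tail over a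
    window shifted by [k]. Replacing it by the centred window costs [2 * |k|] boundary coefficients:
    they are small by [tailc_udecay] if [2 * |k| <= X], and otherwise the crude bound 2 is paid by
    [|k| ^ 2] in the moment. *)
Lemma rajchman_step j t (e : R) : 0 < e -> exists X0, forall X, (X0 <= X)%N ->
  forall L m,
  nc (sym_partial_sum (tailc L j m.+1) t X -
      zs L (fun k => a j k * expi (k%:~R * t)) *
      sym_partial_sum (tailc L j.+1 m) t X) <= e.
Proof.
move=> e0; have [M [M0 hM]] := a_moment j.
have eM : 0 < e / (2 * M) by rewrite divr_gt0// mulr_gt0.
have [X1 hX1] := tailc_udecay j.+1 eM.
have [Y hY] : exists Y : nat, 8 * M / e <= Y%:R.
  by exists (Num.truncn (8 * M / e)).+1; rewrite ltW// truncnS_gt.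
exists (2 * X1 + Y)%N => X hX L m.
pose g n := tailc L j.+1 m n * expi (n%:~R * t).
have -> : sym_partial_sum (tailc L j m.+1) t X =
   zs L (fun k => a j k * expi (k%:~R * t) * zs X (fun n => g (n - k))).
  transitivity (zs X (fun n => tailc L j m.+1 n * expi (n%:~R * t))) => //.
  under [RHS]zs_ext => k do rewrite -zsMl.
  rewrite zs_zs; apply: zs_ext => n /=; rewrite -zsMr; apply: zs_ext => k.
  rewrite /g -!mulrA; congr (_ * _); rewrite mulrCA; congr (_ * _).
  by rewrite -expiD -mulrDl -intrD addrC subrK.
rewrite -zsMr -zsB.
have -> : sym_partial_sum (tailc L j.+1 m) t X = zs X g by [].
apply: (le_trans (nc_zs _ _)).
apply: (@le_trans _ _ (zs L (fun k => e / M * (nc (a j k) * (1 + `|k|%:R ^+ 2))))).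
  apply: ler_zs => k _.
  rewrite -mulrBr !ncM nc_expi mulr1 mulrCA ler_wpM2l ?nc_ge0//.
  have gn n : nc (g n) = nc (tailc L j.+1 m n) by rewrite ncM nc_expi mulr1.
  have k2 : (`|k|%:R : R) <= `|k|%:R ^+ 2.
    by rewrite -natrX ler_nat; nia.
  have k0 : 0 <= (`|k|%:R : R) by [].
  have [kX|kX] := leqP (2 * `|k|)%N X.
    apply: (le_trans (@nc_zs_shift _ _ g k (e / (2 * M)) _)).
      by move=> n hn; rewrite gn; apply: hX1; lia.
    rewrite natrM.
    have -> : e / (2 * M) = e / M / 2 by rewrite invfM mulrA mulrAC.
    by have : 0 < e / M by [rewrite divr_gt0]; move: (e / M) => y; nra.
  apply: (le_trans (@nc_zs_shift _ _ g k 2 _)).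
    by move=> n _; rewrite gn; exact: tailc_le2.
  have YM : 8 <= e / M * Y%:R.
    by rewrite mulrAC ler_pdivlMr//; move: hY; rewrite ler_pdivrMr// [Y%:R * e]mulrC.
  have Yk : (Y%:R : R) <= 2 * `|k|%:R by rewrite -natrM ler_nat; lia.
  have eM' : 0 < e / M by rewrite divr_gt0.
  rewrite natrM; move: (e / M) YM eM' => y YM y0.
  have h4 : 4 <= y * `|k|%:R by nra.
  have : 4 * `|k|%:R <= y * `|k|%:R * `|k|%:R by rewrite ler_wpM2r.
  by move: (`|k|%:R : R) k0 k2 => x *; nra.
by rewrite zsMl mulrAC ler_pdivrMr// ler_pM2l.
Qed.

Theorem assembly : exists c : int -> R[i],
  [/\ c 0 != 0,
      forall n : nat, (0 < n)%N -> nc (c (- n%:Z)) <= 2 / W n &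
      forall (t : R) j,
        (forall e, 0 < e -> exists L0, forall L, (L0 <= L)%N ->
          nc (zs L (fun k => (A j k + Rm j k) * expi (k%:~R * t))) <= e) ->
        (fun X : nat => nc (sym_partial_sum c t X)) @ \oo --> (0 : R)].
Proof.
have [c hc] := @bounded_frequent_limit R (fun K => tailc K 0 K) 2
  (fun K n => tailc_le2 K 0 K n).
exists c; split.
- have e4 : 0 < 4^-1 :> R by [].
  (* [tailc K 0 K 0] is within [1/2] of 1, and [c 0] within [1/4] of it. *)
  have [K _ /(_ 0 isT) h] := hc 0%N 4^-1 0%N e4.
  apply/eqP => c0; rewrite c0 subr0 in h.
  have := tailc_at0 K 0 K; have := T_le 0.
  have : nc (1 : R[i]) <= nc (1 - tailc K 0 K 0) + nc (tailc K 0 K 0).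
    by apply: le_trans (ncD _ _); rewrite subrK.
  by rewrite nc1 ncB; lra.
- move=> n n0; rewrite ler_pdivlMr//.
  have e1 : 0 < (W n)^-1 by rewrite invr_gt0.
  have [K _ /(_ (- n%:Z)) h] := hc n (W n)^-1 0%N e1.
  have {}h := h ltac:(lia).
  have := tailc_negative K 0 K n0; have := T_le 0.
  have : nc (c (- n%:Z)) <= nc (c (- n%:Z) - tailc K 0 K (- n%:Z)) +
      nc (tailc K 0 K (- n%:Z)).
    by apply: le_trans (ncD _ _); rewrite subrK.
  rewrite ncB => h2 h3 h4; have := ler_wpM2r (ltW (W_gt0 n)) (le_trans h2 (lerD h (lexx _))).
  by rewrite mulrDl mulVf ?gt_eqF//; lra.
- move=> t j hj.
  (* Downward induction from [j] to 0. At [j] the value of the factor tends to 0 with [L], while the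
     partial sum of the tail is at most [2 * (2 * X + 1)]; this is why [L0] may depend on [X]. Below
     [j], each further factor multiplies by a bounded value. *)
  have main i : (i <= j)%N -> forall e, 0 < e -> exists X0, forall X, (X0 <= X)%N ->
      exists L0, forall L m, (L0 <= L)%N -> (j < i + m)%N ->
      nc (sym_partial_sum (tailc L i m) t X) <= e.
    move=> ij; rewrite -(subKn ij); move: (j - i)%N (leq_subr i j) => {ij}i ij.
    elim: i ij => [|i IH] ij e e0.
      rewrite subn0.
      have e2 : 0 < e / 2 by lra.
      have [X0 hX0] := rajchman_step j t e2.
      exists X0 => X XX.
      have d0 : 0 < e / 2 / (2 * (2 * X).+1%:R) by rewrite divr_gt0// mulr_gt0.
      have [L0 hL0] := hj _ d0.
      exists L0 => L [|m] LL; first by rewrite addn0 ltnn.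
      move=> _; apply: (le_trans (_ : _ <= e / 2 + e / 2)); last by lra.
      set u := sym_partial_sum _ _ _.
      have -> : u = (u - zs L (fun k => a j k * expi (k%:~R * t)) *
         sym_partial_sum (tailc L j.+1 m) t X) +
        zs L (fun k => a j k * expi (k%:~R * t)) *
         sym_partial_sum (tailc L j.+1 m) t X by rewrite subrK.
      apply: (le_trans (ncD _ _)); apply: lerD; first exact: hX0.
      rewrite ncM -[leRHS](@divfK _ (2 * (2 * X).+1%:R)); last by rewrite mulf_neq0.
      apply: ler_pM; rewrite ?nc_ge0//; first exact: hL0.
      apply: (le_trans (nc_sum _ _ _)).
      apply: (@le_trans _ _ (\sum_(0 <= k < (2 * X).+1) 2)).
        by apply: ler_sum => k _; rewrite ncM nc_expi mulr1 tailc_le2.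
      by rewrite sumr_const_nat subn0 mulr_natr.
    have IH' := IH (ltnW ij).
    have ji : (j - i)%N = (j - i.+1).+1 by lia.
    rewrite ji in IH'; move: (j - i.+1)%N (leq_subr i.+1 j) IH' => i' i'j IH'.
    have e2 : 0 < e / 2 by lra.
    have [X0 hX0] := rajchman_step i' t e2.
    have [M [M0 hM]] := a_moment i'.
    have eM : 0 < e / 2 / M by rewrite divr_gt0.
    have [X1 hX1] := IH' _ eM.
    exists (X0 + X1)%N => X XX.
    have [L0 hL0] := hX1 X (leq_trans (leq_addl _ _) XX).
    exists L0 => L [|m] LL; first by lia.
    move=> jm; apply: (le_trans (_ : _ <= e / 2 + e / 2)); last by lra.
    set u := sym_partial_sum _ _ _.
    have -> : u = (u - zs L (fun k => a i' k * expi (k%:~R * t)) *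
         sym_partial_sum (tailc L i'.+1 m) t X) +
        zs L (fun k => a i' k * expi (k%:~R * t)) *
         sym_partial_sum (tailc L i'.+1 m) t X by rewrite subrK.
    apply: (le_trans (ncD _ _)); apply: lerD.
      by apply: hX0; apply: leq_trans XX; rewrite leq_addr.
    rewrite ncM -[leRHS](@divfK _ M) ?gt_eqF// mulrC.
    apply: ler_pM; rewrite ?nc_ge0//; first by apply: hL0 => //; lia.
    apply: (le_trans (nc_zs _ _)); apply: le_trans (hM L).
    apply: ler_zs => k _; rewrite ncM nc_expi ler_wpM2l ?nc_ge0//.
    by rewrite lerDl sqr_ge0.
  apply/cvgrPdist_le => /= e e0.
  have e2 : 0 < e / 2 by lra.
  have [X0 hX0] := main 0%N (leq0n _) _ e2.
  exists X0 => // X /= XX.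
  rewrite sub0r normrN ger0_norm ?nc_ge0//.
  have [L0 hL0] := hX0 X XX.
  have d0 : 0 < e / 2 / (2 * X).+1%:R by rewrite divr_gt0.
  have [K KK hK] := hc X _ (L0 + j.+1)%N d0.
  have -> : sym_partial_sum c t X = sym_partial_sum (tailc K 0 K) t X -
     zs X (fun n => (tailc K 0 K n - c n) * expi (n%:~R * t)).
    rewrite -[sym_partial_sum (tailc K 0 K) t X]/(zs X (fun n => tailc K 0 K n * expi (n%:~R * t))).
    transitivity (zs X (fun n => c n * expi (n%:~R * t))) => //.
    by rewrite -zsB; apply: zs_ext => n; rewrite mulrBl subKr.
  apply: (le_trans (ncBD _ _)); apply: (le_trans (_ : _ <= e / 2 + e / 2)); last by lra.
  apply: lerD; first by apply: hL0; lia.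
  apply: (le_trans (nc_zs _ _)).
  apply: (@le_trans _ _ (zs X (fun=> e / 2 / (2 * X).+1%:R))).
    by apply: ler_zs => n nX; rewrite ncM nc_expi mulr1; exact: hK.
  by rewrite /zs sumr_const_nat subn0 -[X in X <= _]mulr_natr divfK.
Qed.

End Assembly.

(** * Discrete Fourier analysis on roots of unity *)

Section FiniteSums.
Variable R : realType.

Lemma pigeonhole_mean (Q : nat) (f : nat -> R) (B : R) : (0 < Q)%N ->
  \sum_(0 <= k < Q) f k <= Q%:R * B -> exists2 k, (k < Q)%N & f k <= B.
Proof.
move=> Q0 h; apply: contrapT => nex.
have fB k : (k < Q)%N -> B < f k.
  by move=> kQ; rewrite ltNge; apply/negP => fk; apply: nex; exists k.
suff : \sum_(0 <= k < Q) B < \sum_(0 <= k < Q) f k.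
  by rewrite sumr_const_nat subn0 -[_ *+ _]mulr_natl => /lt_le_trans/(_ h); rewrite ltxx.
by apply: ltr_sum_nat => // k /andP[_ kQ]; exact: fB.
Qed.

Lemma sum_mod_shift (V : nmodType) (Q l : nat) (g : nat -> V) : (0 < Q)%N ->
  \sum_(0 <= k < Q) g ((l + k) %% Q)%N = \sum_(0 <= k < Q) g k.
Proof.
move=> Q0; elim: l => [|l IH].
  rewrite big_nat [RHS]big_nat; apply: eq_bigr => k /andP[_ kQ].
  by rewrite add0n modn_small.
rewrite -IH; case: Q Q0 {IH} => // Q _.
rewrite big_nat_recr//= [RHS]big_nat_recl//= [RHS]addrC; congr (_ + _).
  by apply: eq_bigr => k _; rewrite addSnnS.
by rewrite addn0 addSnnS modnDr.
Qed.

Lemma cauchy_schwarz (n : nat) (x y : nat -> R) :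
  (\sum_(0 <= i < n) x i * y i) ^+ 2 <=
  (\sum_(0 <= i < n) x i ^+ 2) * (\sum_(0 <= i < n) y i ^+ 2).
Proof.
elim: n => [|n IH]; first by rewrite !big_geq// mul0r expr0n.
rewrite !big_nat_recr//=; move: IH.
have Y0 : 0 <= \sum_(0 <= i < n) y i ^+ 2 by apply: sumr_ge0 => i _; exact: sqr_ge0.
have X0 : 0 <= \sum_(0 <= i < n) x i ^+ 2 by apply: sumr_ge0 => i _; exact: sqr_ge0.
move: (\sum_(_ <= _ < _) _) (\sum_(_ <= _ < _) _) (\sum_(_ <= _ < _) _) X0 Y0.
move=> S Y X X0 Y0 S2.
have [|] := leP (S * (x n * y n)) 0 => h.
  by have := sqr_ge0 (x n); have := sqr_ge0 (y n); nra.
have h2 : (2 * (S * (x n * y n))) ^+ 2 <= (X * y n ^+ 2 + Y * x n ^+ 2) ^+ 2.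
  have : 0 <= (X * y n ^+ 2 - Y * x n ^+ 2) ^+ 2 by exact: sqr_ge0.
  have : 0 <= (X * Y - S ^+ 2) * (x n * y n) ^+ 2.
    by rewrite mulr_ge0 ?sqr_ge0// subr_ge0.
  by nra.
have h3 : 2 * (S * (x n * y n)) <= X * y n ^+ 2 + Y * x n ^+ 2.
  rewrite -(@ler_pXn2r _ 2) ?nnegrE//; first by lra.
  by apply: addr_ge0; apply: mulr_ge0 => //; exact: sqr_ge0.
by nra.
Qed.

Lemma sum_conv_le (Q : nat) (a b : nat -> R) :
  (forall n, 0 <= a n) -> (forall n, 0 <= b n) ->
  \sum_(0 <= n < Q) \sum_(0 <= m < n.+1) a m * b (n - m)%N <=
  (\sum_(0 <= m < Q) a m) * (\sum_(0 <= l < Q) b l).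
Proof.
move=> a0 b0.
elim: Q => [|Q IH]; first by rewrite !big_geq// mul0r.
have -> : \sum_(0 <= n < Q.+1) \sum_(0 <= m < n.+1) a m * b (n - m)%N =
    \sum_(0 <= m < Q.+1) a m * \sum_(0 <= l < (Q - m).+1) b l.
  elim: Q {IH} => [|Q IH]; first by rewrite !big_nat1.
  rewrite big_nat_recr// IH [RHS]big_nat_recr//= subnn big_nat1.
  rewrite [X in _ + X]big_nat_recr//= subnn addrA; congr (_ + _).
  rewrite -big_split /= big_nat [RHS]big_nat; apply: eq_bigr => m /andP[_ mQ].
  by rewrite -mulrDr subSn// [in RHS]big_nat_recr.
rewrite mulr_suml big_nat [leRHS]big_nat; apply: ler_sum => m /andP[_ mQ].
rewrite ler_wpM2l// (@big_cat_nat _ _ _ (Q - m).+1 0 Q.+1)//=; last by lia.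
by rewrite lerDl sumr_ge0.
Qed.

(* The two sides differ by [2 |r|^2 |u - r|^2]. *)
Lemma nc_quartic (u r : R[i]) :
  nc (u + r) ^+ 4 <= nc u ^+ 4 + 3 * nc r ^+ 4 + 6 * (nc u ^+ 2 * nc r ^+ 2) +
    4 * (nc u ^+ 2 * Re (conjc u * r)) + 2 * Re ((conjc u * r) ^+ 2).
Proof.
have e4 (x : R[i]) : nc x ^+ 4 = (Re x ^+ 2 + Im x ^+ 2) ^+ 2.
  by rewrite -nc_sqr -exprM.
rewrite !e4 !nc_sqr expr2; case: u r => [a b] [c d].
rewrite !(Re_mul, Im_mul, Re_add, Im_add) /=.
have h : 0 <= 2 * ((c ^+ 2 + d ^+ 2) * ((a - c) ^+ 2 + (b - d) ^+ 2)).
  by apply: mulr_ge0 => //; apply: mulr_ge0; apply: addr_ge0; exact: sqr_ge0.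
rewrite -subr_ge0; apply: le_trans h _; rewrite le_eqVlt; apply/orP; left.
by apply/eqP; ring.
Qed.

End FiniteSums.

Section DFT.
Variables (R : realType) (Q : nat).
Hypothesis Q_gt0 : (0 < Q)%N.

Definition rootu : R[i] := expi (2 * pi / Q%:R).
Local Notation w := rootu.

Let Q_neq0 : Q%:R != 0 :> R. Proof. by rewrite pnatr_eq0; lia. Qed.

Lemma rootuX n : w ^+ n = expi (2 * pi * n%:R / Q%:R).
Proof. by rewrite /w -expi_natM; congr expi; field. Qed.

Lemma nc_rootuX n : nc (w ^+ n) = 1.
Proof. by rewrite rootuX nc_expi. Qed.

Lemma rootuQ : w ^+ Q = 1.
Proof. by rewrite rootuX mulfK// expi_2pi. Qed.

Lemma rootu_mod n : w ^+ (n %% Q) = w ^+ n.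
Proof. by rewrite {2}(divn_eq n Q) exprD mulnC exprM rootuQ expr1n mul1r. Qed.

Lemma rootuX_neq0 n : w ^+ n != 0.
Proof. by rewrite rootuX expi_neq0. Qed.

Lemma expi_eq1_lt (x : R) : 0 < x < 2 * pi -> expi x != 1.
Proof.
move=> /andP[x0 x2]; rewrite /expi eq_complex /= negb_and.
have [xp|xp|->] := ltgtP x pi.
- by rewrite [sin x == 0]gt_eqF ?orbT// sin_gt0_pi// x0.
- have : 0 < sin (x - pi) by rewrite sin_gt0_pi//; lra.
  rewrite sinB cospi sinpi mulr0 subr0 mulrN1 oppr_gt0 => h.
  by rewrite [sin x == 0]lt_eqF ?orbT.
- by rewrite cospi; apply/orP; left; rewrite lt_eqF//; lra.
Qed.

Lemma rootuX_neq1 m : (0 < m < Q)%N -> w ^+ m != 1.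
Proof.
move=> /andP[m0 mQ]; rewrite rootuX expi_eq1_lt//.
have Qp : 0 < Q%:R :> R by rewrite ltr0n.
have pp : 0 < pi :> R by exact: pi_gt0.
have mp : 0 < m%:R :> R by rewrite ltr0n.
have mQ' : m%:R < Q%:R :> R by rewrite ltr_nat.
by rewrite divr_gt0 ?mulr_gt0//= ltr_pdivrMr// ltr_pM2l// mulr_gt0.
Qed.

Lemma sum_rootu_neq1 (z : R[i]) : z ^+ Q = 1 -> z != 1 ->
  \sum_(0 <= k < Q) z ^+ k = 0.
Proof.
move=> zQ z1; have := subrX1 z Q; rewrite zQ subrr => /esym/eqP.
by rewrite mulf_eq0 subr_eq0 (negPf z1) /= big_mkord => /eqP.
Qed.

Lemma rootu_orth (m m' : nat) : (m < Q)%N -> (m' < Q)%N ->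
  \sum_(0 <= k < Q) (w ^+ k) ^+ m / (w ^+ k) ^+ m' = if m == m' then Q%:R else 0.
Proof.
move=> mQ m'Q.
have -> : \sum_(0 <= k < Q) (w ^+ k) ^+ m / (w ^+ k) ^+ m' =
    \sum_(0 <= k < Q) (w ^+ m / w ^+ m') ^+ k.
  by apply: eq_bigr => k _; rewrite expr_div_n -!exprM mulnC [(m' * k)%N]mulnC.
case: eqP => [->|mm'].
  rewrite divff ?rootuX_neq0//.
  under eq_bigr do rewrite expr1n.
  by rewrite sumr_const_nat subn0.
apply: sum_rootu_neq1.
  by rewrite expr_div_n -!exprM !(mulnC _ Q) !exprM rootuQ !expr1n divr1.
apply/eqP => e; have {e} : w ^+ m = w ^+ m'.
  by rewrite -[LHS](divfK (rootuX_neq0 m')) e mul1r.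
wlog mm : m m' mQ m'Q mm' / (m < m')%N => [th|].
  have [] := ltngtP m m'; [exact: th|move=> h /esym; apply: th => //|done].
  by move=> e; apply: mm'.
rewrite -(subnKC (ltnW mm)) exprD -{1}[w ^+ m]mulr1 => /(mulfI (rootuX_neq0 m)).
by move=> /esym/eqP; apply/negP/rootuX_neq1; lia.
Qed.

Lemma rootu_coef (u : {poly R[i]}) m : (size u <= Q)%N -> (m < Q)%N ->
  \sum_(0 <= k < Q) u.[w ^+ k] / (w ^+ k) ^+ m = Q%:R * u`_m.
Proof.
move=> uQ mQ.
under eq_bigr => k _ do rewrite (horner_coef_wide _ uQ) mulr_suml.
rewrite exchange_big /= (bigD1 (Ordinal mQ))//= [X in _ + X]big1 ?addr0.
  under eq_bigr do rewrite -mulrA.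
  by rewrite -mulr_sumr rootu_orth// eqxx mulrC.
move=> i im; under eq_bigr do rewrite -mulrA.
rewrite -mulr_sumr rootu_orth//.
by case: eqP => [e|]; rewrite ?mulr0//; move/eqP: im; case; exact: val_inj.
Qed.

Lemma rootu_mean (u : {poly R[i]}) : (size u <= Q)%N ->
  \sum_(0 <= k < Q) u.[w ^+ k] = Q%:R * u`_0.
Proof.
move=> uQ; rewrite -rootu_coef//; apply: eq_bigr => k _.
by rewrite expr0 divr1.
Qed.

Lemma nc_coef_le (u : {poly R[i]}) m : (size u <= Q)%N -> (m < Q)%N ->
  nc u`_m <= (\sum_(0 <= k < Q) nc u.[w ^+ k]) / Q%:R.
Proof.
move=> uQ mQ; rewrite ler_pdivlMr ?ltr0n// mulrC -nc_natr -ncM -rootu_coef//.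
apply: (le_trans (nc_sum _ _ _)); apply: ler_sum => k _.
by rewrite ncM Normc.normcV ncX nc_rootuX expr1n invr1 mulr1.
Qed.

Lemma conjc_rootu k m : conjc ((w ^+ k) ^+ m) = ((w ^+ k) ^+ m)^-1.
Proof.
rewrite rootuX -expi_natM -expiN /expi cosN sinN; move: (_ * _) => x.
by apply/eqP; rewrite eq_complex /= !eqxx.
Qed.

Lemma nc_sqr_conj (z : R[i]) : (nc z ^+ 2)%:C%C = z * conjc z.
Proof.
rewrite nc_sqr; case: z => a b; apply/eqP; rewrite eq_complex Re_mul Im_mul /=.
by apply/andP; split; apply/eqP; ring.
Qed.

Lemma conjcD (x y : R[i]) : conjc (x + y) = conjc x + conjc y.
Proof. by case: x y => [? ?] [? ?]; apply/eqP; rewrite eq_complex /= opprD !eqxx. Qed.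

Lemma conjc_sum (I : Type) (r : seq I) (P : pred I) (F : I -> R[i]) :
  conjc (\sum_(i <- r | P i) F i) = \sum_(i <- r | P i) conjc (F i).
Proof.
elim/big_rec2: _ => [|i a z _ <-]; last by rewrite conjcD.
by apply/eqP; rewrite eq_complex /= oppr0 !eqxx.
Qed.

Lemma conjcM' (x y : R[i]) : conjc (x * y) = conjc x * conjc y.
Proof.
case: x y => [a b] [c d]; apply/eqP; rewrite eq_complex Re_mul Im_mul /=.
by apply/andP; split; apply/eqP; ring.
Qed.

Lemma parseval (u : {poly R[i]}) : (size u <= Q)%N ->
  \sum_(0 <= k < Q) nc u.[w ^+ k] ^+ 2 = Q%:R * \sum_(0 <= m < Q) nc u`_m ^+ 2.
Proof.
move=> uQ; apply: (@complexI R).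
rewrite rmorphM rmorph_sum /= rmorph_sum /= rmorph_nat.
under eq_bigr => k _ do rewrite nc_sqr_conj {2}(horner_coef_wide _ uQ) conjc_sum mulr_sumr.
rewrite exchange_big /= big_mkord mulr_sumr; apply: eq_bigr => m _.
rewrite nc_sqr_conj mulrA -rootu_coef// mulr_suml; apply: eq_bigr => k _.
by rewrite conjcM' conjc_rootu [conjc _ * _]mulrC mulrA.
Qed.

End DFT.

(** * Greedy choice of rotations *)

Section Greedy.
Variables (R : realType) (Q D : nat) (h : {poly R[i]}) (I : pred nat).
Variables (mu eta s iota : R).
Hypothesis Q_gt0 : (0 < Q)%N.
Local Notation w := (rootu R Q).
Hypothesis size_h : (size h <= D.+1)%N.
Hypothesis DQ : (2 * D < Q)%N.
Hypothesis h_0 : h`_0 = 1.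
Hypothesis s_ge1 : 1 <= s.
Hypothesis h_sup : forall k, nc h.[w ^+ k] <= s.
Hypothesis h_mu : forall m, (0 < m)%N -> nc h`_m <= mu.
Hypothesis h_eta : \sum_(1 <= m < Q) nc h`_m ^+ 2 <= eta.
Hypothesis I_card : iota * Q%:R <= \sum_(0 <= k < Q) (I k)%:R.

Definition rotp (k : nat) : {poly R[i]} := h \Po (w ^+ k *: 'X).
Definition rprod (ks : seq nat) : {poly R[i]} := \prod_(k <- ks) rotp k.

Lemma rotp_coef k m : (rotp k)`_m = h`_m * (w ^+ k) ^+ m.
Proof.
rewrite /rotp comp_polyE coef_sum.
under eq_bigr => i _ do rewrite exprZn !coefZ coefXn.
have [mh|mh] := ltnP m (size h).
  rewrite (bigD1 (Ordinal mh))//= eqxx mulr1 big1 ?addr0// => i /eqP im.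
  by case: eqP => [e|_]; rewrite ?mulr0// /= in im *; case: im; exact: val_inj.
rewrite nth_default// mul0r big1// => i _; case: eqP => [e|_]; rewrite ?mulr0//.
by have := ltn_ord i; rewrite -e ltnNge mh.
Qed.

Lemma rotp_horner k z : (rotp k).[z] = h.[w ^+ k * z].
Proof. by rewrite /rotp horner_comp hornerZ hornerX. Qed.

Lemma size_rotp k : (size (rotp k) <= D.+1)%N.
Proof.
apply/leq_sizeP => m mD; rewrite rotp_coef nth_default ?mul0r//.
exact: leq_trans size_h mD.
Qed.

Lemma rprod_sup ks l : nc (rprod ks).[w ^+ l] <= s ^+ size ks.
Proof.
rewrite /rprod; elim: ks => [|k ks IH].
  by rewrite big_nil hornerC nc1 expr0.
rewrite big_cons hornerM ncM /= exprS ler_pM ?nc_ge0//.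
by rewrite rotp_horner -exprD.
Qed.

Lemma rprod_0 ks : (rprod ks)`_0 = 1.
Proof.
rewrite /rprod; elim: ks => [|k ks IH]; first by rewrite big_nil coef1.
by rewrite big_cons coef0M IH rotp_coef h_0 expr0 !mulr1.
Qed.

Lemma size_rprod ks : (size (rprod ks) <= (size ks * D).+1)%N.
Proof.
rewrite /rprod; elim: ks => [|k ks IH]; first by rewrite big_nil size_poly1.
rewrite big_cons (leq_trans (size_polyMleq _ _))//.
have -> : (size (k :: ks) * D).+1 = (D.+1 + (size ks * D).+1).-1.
  by rewrite /= mulSn addnS.
by rewrite -!subn1 leq_sub2r// leq_add// size_rotp.
Qed.

Definition quartic (ks : seq nat) : R :=
  \sum_(1 <= n < Q) nc (rprod ks)`_n ^+ 4.
Definition uncovered (ks : seq nat) : R :=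
  \sum_(0 <= l < Q) (all (fun k => ~~ I ((l + k) %% Q)%N) ks)%:R.

(** For fixed [l], the index [l + k] runs once through all residues as [k] does, so a random
    rotation covers each uncovered point with probability at least [iota]. *)
Lemma uncovered_cons ks :
  \sum_(0 <= k < Q) uncovered (k :: ks) <= Q%:R * ((1 - iota) * uncovered ks).
Proof.
rewrite /uncovered exchange_big /= mulr_sumr mulr_sumr; apply: ler_sum => l _.
under eq_bigr do rewrite -mulnb natrM.
rewrite -mulr_suml mulrA ler_wpM2r//.
rewrite (sum_mod_shift l (fun k => (~~ I k)%:R))//.
have -> : \sum_(0 <= k < Q) (~~ I k)%:R = Q%:R - \sum_(0 <= k < Q) (I k)%:R :> R.
  apply/eqP; rewrite eq_sym subr_eq -big_split /=.
  under eq_bigr do rewrite -natrD addn_negb.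
  by rewrite sumr_const_nat subn0.
by move: I_card; move: (\sum_(_ <= _ < _) _) => x; lra.
Qed.

Section Step.
Variables (ks : seq nat) (S : R).
Hypothesis sizeH : ((size ks * D).+1 <= Q)%N.
Hypothesis H_sup : forall l, nc (rprod ks).[w ^+ l] <= S.
Let H := rprod ks.

Let S_ge0 : 0 <= S. Proof. exact: le_trans (nc_ge0 _) (H_sup 0). Qed.

Let H_l2 : \sum_(0 <= n < Q) nc H`_n ^+ 2 <= S ^+ 2.
Proof.
rewrite -(@ler_pM2l _ Q%:R) ?ltr0n// -parseval//; last first.
  exact: leq_trans (size_rprod ks) sizeH.
apply: (@le_trans _ _ (\sum_(0 <= k < Q) S ^+ 2)).
  by apply: ler_sum => k _; rewrite lerXn2r ?nnegrE ?nc_ge0.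
by rewrite sumr_const_nat subn0 -[X in X <= _]mulr_natl.
Qed.

(** As a function of the rotation [k], the [n]-th coefficient of [rotp k * H] is that of [H] plus
    the value of [rp n] at [w ^+ k]. Averages over rotations become averages over roots of unity,
    and [rho n] below is the mean square of that change. *)
Let rp n : {poly R[i]} := \poly_(m < n.+1) (if m == 0 then 0 else h`_m * H`_(n - m)).

Let rp_coef n m : (rp n)`_m = if (0 < m <= n)%N then h`_m * H`_(n - m) else 0.
Proof. by rewrite coef_poly ltnS; case: m => [|m]//=; rewrite if_same. Qed.

Let size_rp n : (size (rp n) <= D.+1)%N.
Proof.
apply/leq_sizeP => m mD; rewrite rp_coef; case: ifP => // _.
by rewrite [h`__]nth_default ?mul0r//; exact: leq_trans size_h mD.
Qed.

Let rp_horner n k : (rotp k * H)`_n = H`_n + (rp n).[w ^+ k].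
Proof.
rewrite coefM big_ord_recl /= rotp_coef h_0 expr0 !mul1r subn0; congr (_ + _).
rewrite horner_poly big_ord_recl /= mul0r add0r; apply: eq_bigr => i _.
by rewrite rotp_coef /= mulrAC.
Qed.

Let rho n : R := \sum_(0 <= m < n.+1) (if m == 0 then 0 else nc h`_m ^+ 2) * nc H`_(n - m) ^+ 2.

Let h_eta' : \sum_(0 <= m < Q) (if m == 0 then 0 else nc h`_m ^+ 2) <= eta.
Proof.
apply: le_trans h_eta; rewrite big_ltn//= add0r.
rewrite big_nat [leRHS]big_nat; apply: ler_sum => m /andP[m0 _].
by case: eqP => // e; rewrite e in m0.
Qed.

Let eta_ge0 : 0 <= eta.
Proof. by apply: le_trans h_eta; apply: sumr_ge0 => m _; exact: sqr_ge0. Qed.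

Let rp_l2 n : (n < Q)%N -> \sum_(0 <= k < Q) nc (rp n).[w ^+ k] ^+ 2 = Q%:R * rho n.
Proof.
move=> nQ; rewrite parseval//; last by apply: leq_trans (size_rp n) _; lia.
congr (_ * _); rewrite (@big_cat_nat _ _ _ n.+1)//= [X in _ + X]big_nat [X in _ + X]big1 ?addr0.
  rewrite /rho big_nat [RHS]big_nat; apply: eq_bigr => m /andP[_ mn].
  rewrite rp_coef; case: m mn => [|m] mn; first by rewrite ltnn nc0 expr0n /= mul0r.
  by rewrite ltn0Sn -ltnS mn andTb ncM exprMn.
move=> m /andP[nm _]; have z : (0 < m <= n)%N = false by lia.
by rewrite rp_coef z nc0 expr0n.
Qed.

Let rp_sup n k : (n < Q)%N -> nc (rp n).[w ^+ k] ^+ 2 <= eta * S ^+ 2.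
Proof.
move=> nQ; rewrite horner_poly.
apply: (@le_trans _ _ ((\sum_(0 <= m < n.+1) (if m == 0 then 0 else nc h`_m) * nc H`_(n - m)) ^+ 2)).
  rewrite lerXn2r ?nnegrE ?nc_ge0//.
    by apply: sumr_ge0 => m _; case: ifP; rewrite ?mul0r// mulr_ge0 ?nc_ge0.
  apply: (le_trans (nc_sum _ _ _)); rewrite big_mkord; apply: ler_sum => m _.
  have e1 : nc (w ^+ k ^+ m) = 1 by rewrite -exprM nc_rootuX.
  rewrite ncM e1 mulr1.
  by case: ifP; rewrite ?nc0 ?mul0r ?ncM.
apply: (le_trans (cauchy_schwarz _ _ _)).
apply: ler_pM; try by apply: sumr_ge0 => m _; exact: sqr_ge0.
  apply: le_trans h_eta'; rewrite [leRHS](@big_cat_nat _ _ _ n.+1)//=.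
  rewrite -[leLHS]addr0 lerD//; last by apply: sumr_ge0 => m _; case: ifP => // _; exact: sqr_ge0.
  by apply: ler_sum => m _; case: ifP => //; rewrite expr0n.
apply: le_trans H_l2; rewrite [leRHS](@big_cat_nat _ _ _ n.+1)//=.
rewrite -[leLHS]addr0 lerD//; last by apply: sumr_ge0 => m _; exact: sqr_ge0.
rewrite big_nat_rev /= big_nat [leRHS]big_nat; apply: ler_sum => m /andP[_ mn].
by rewrite add0n subSS subKn.
Qed.

Let rho_sum : \sum_(0 <= n < Q) rho n <= eta * S ^+ 2.
Proof.
apply: le_trans (sum_conv_le Q (a := fun m => if m == 0 then 0 else nc h`_m ^+ 2)
   (b := fun l => nc H`_l ^+ 2) _ _) _.
- by move=> n; case: ifP => // _; exact: sqr_ge0.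
- by move=> n; exact: sqr_ge0.
apply: ler_pM => //; apply: sumr_ge0 => m _; last exact: sqr_ge0.
by case: ifP => // _; exact: sqr_ge0.
Qed.

Let rho_ge0 n : 0 <= rho n.
Proof.
apply: sumr_ge0 => m _; apply: mulr_ge0; last exact: sqr_ge0.
by case: ifP => // _; exact: sqr_ge0.
Qed.

Let rho_mu n : (n < Q)%N -> rho n <= mu ^+ 2 * S ^+ 2.
Proof.
move=> nQ; apply: (@le_trans _ _ (\sum_(0 <= m < n.+1) mu ^+ 2 * nc H`_(n - m) ^+ 2)).
  apply: ler_sum => m _; apply: ler_wpM2r; first exact: sqr_ge0.
  case: ifP => [_|/negbT]; first exact: sqr_ge0.
  rewrite -lt0n => m0; rewrite lerXn2r ?nnegrE ?nc_ge0 ?h_mu//.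
  by apply: le_trans (h_mu m0); exact: nc_ge0.
rewrite -mulr_sumr; apply: ler_wpM2l; first exact: sqr_ge0.
apply: le_trans H_l2; rewrite [leRHS](@big_cat_nat _ _ _ n.+1)//=.
rewrite -[leLHS]addr0 lerD//; last by apply: sumr_ge0 => m _; exact: sqr_ge0.
rewrite big_nat_rev /= big_nat [leRHS]big_nat; apply: ler_sum => m /andP[_ mn].
by rewrite add0n subSS subKn.
Qed.

(** Averaged over [k], both [Re] terms of [nc_quartic] vanish: [rp n] and its square have no
    constant term, and [2 * D < Q] keeps their degree below [Q]. The surviving terms are quadratic
    or quartic in the change, controlled by [rho n] and [rp_sup]. *)
Lemma quartic_term n : (0 < n < Q)%N ->
  \sum_(0 <= k < Q) nc (rotp k * H)`_n ^+ 4 <=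
  Q%:R * (nc H`_n ^+ 4 + 6 * (nc H`_n ^+ 2 * rho n) + 3 * (eta * S ^+ 2 * rho n)).
Proof.
move=> /andP[n0 nQ].
apply: (@le_trans _ _ (\sum_(0 <= k < Q) (nc H`_n ^+ 4 +
    3 * (eta * S ^+ 2) * nc (rp n).[w ^+ k] ^+ 2 +
    6 * (nc H`_n ^+ 2) * nc (rp n).[w ^+ k] ^+ 2 +
    4 * nc H`_n ^+ 2 * Re (conjc H`_n * (rp n).[w ^+ k]) +
    2 * Re (conjc H`_n ^+ 2 * (rp n ^+ 2).[w ^+ k])))).
  apply: ler_sum => k _; rewrite rp_horner; apply: (le_trans (nc_quartic _ _)).
  rewrite exprMn horner_exp.
  have : nc (rp n).[w ^+ k] ^+ 4 <= eta * S ^+ 2 * nc (rp n).[w ^+ k] ^+ 2.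
    by rewrite (exprD _ 2 2); apply: ler_wpM2r; [exact: sqr_ge0|exact: rp_sup].
  move: (Re _) (Re _) (nc _ ^+ 4) (nc _ ^+ 4) (nc _ ^+ 2) (nc _ ^+ 2) (eta * S ^+ 2).
  by move=> *; lra.
rewrite !big_split /=.
rewrite (_ : \sum_(0 <= k < Q) nc H`_n ^+ 4 = Q%:R * nc H`_n ^+ 4); last first.
  by rewrite sumr_const_nat subn0 mulr_natl.
rewrite -!mulr_sumr rp_l2//.
have -> : \sum_(0 <= k < Q) Re (conjc H`_n * (rp n).[w ^+ k]) = 0.
  rewrite -Re_sum -mulr_sumr rootu_mean//; last by apply: leq_trans (size_rp n) _; lia.
  by rewrite rp_coef /= !mulr0.
have -> : \sum_(0 <= k < Q) Re (conjc H`_n ^+ 2 * (rp n ^+ 2).[w ^+ k]) = 0.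
  rewrite -Re_sum -mulr_sumr rootu_mean//.
    by rewrite expr2 coef0M rp_coef /= !mulr0.
  by rewrite expr2 (leq_trans (size_polyMleq _ _))//; have := size_rp n; lia.
by rewrite le_eqVlt; apply/orP; left; apply/eqP; ring.
Qed.

Lemma quartic_cons : \sum_(0 <= k < Q) quartic (k :: ks) <=
  Q%:R * (quartic ks + (6 * mu ^+ 2 + 3 * eta ^+ 2) * S ^+ 4).
Proof.
rewrite /quartic exchange_big /=.
apply: (@le_trans _ _ (\sum_(1 <= n < Q) Q%:R * (nc H`_n ^+ 4 +
   6 * (nc H`_n ^+ 2 * (mu ^+ 2 * S ^+ 2)) + 3 * (eta * S ^+ 2 * rho n)))).
  rewrite big_nat [leRHS]big_nat; apply: ler_sum => n nQ.
  under eq_bigr do rewrite /rprod big_cons.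
  apply: (le_trans (quartic_term nQ)); rewrite ler_pM2l ?ltr0n// lerD2r lerD2l.
  rewrite ler_pM2l// ler_wpM2l ?sqr_ge0// rho_mu//; by case/andP: nQ.
rewrite -mulr_sumr ler_pM2l ?ltr0n// !big_split /= -!addrA lerD2l.
rewrite -!mulr_sumr -mulr_suml.
have h1 : \sum_(1 <= n < Q) nc H`_n ^+ 2 <= S ^+ 2.
  by apply: le_trans H_l2; rewrite [leRHS]big_ltn// lerDr sqr_ge0.
have h2 : \sum_(1 <= n < Q) rho n <= eta * S ^+ 2.
  by apply: le_trans rho_sum; rewrite [leRHS]big_ltn// lerDr.
have h3 : (\sum_(1 <= n < Q) nc H`_n ^+ 2) * (mu ^+ 2 * S ^+ 2) <= S ^+ 2 * (mu ^+ 2 * S ^+ 2).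
  by apply: ler_wpM2r => //; apply: mulr_ge0; exact: sqr_ge0.
have h4 : eta * S ^+ 2 * (\sum_(1 <= n < Q) rho n) <= eta * S ^+ 2 * (eta * S ^+ 2).
  by apply: ler_wpM2l => //; apply: mulr_ge0 => //; exact: sqr_ge0.
rewrite (_ : _ * S ^+ 4 = 6 * (S ^+ 2 * (mu ^+ 2 * S ^+ 2)) + 3 * (eta * S ^+ 2 * (eta * S ^+ 2))).
  by lra.
by ring.
Qed.

End Step.

(** One pigeonhole on a weighted sum of the two quantities serves both at once. Since [uncovered]
    never increases, the gain [iota * uncovered] of a step can be stored in the weight
    [1 + iota * V], which grows by [iota] each time. *)
Lemma greedy (V : nat) (S : R) (a : R) : (V * D < Q)%N -> s ^+ V <= S ->
  0 <= a -> 0 <= iota ->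
  exists2 ks : seq nat, size ks = V &
    a * quartic ks + (1 + iota * V%:R) * (uncovered ks / Q%:R) <=
    1 + V%:R * (a * ((6 * mu ^+ 2 + 3 * eta ^+ 2) * S ^+ 4)).
Proof.
move=> VD sV a0 i0; have Qp : 0 < Q%:R :> R by rewrite ltr0n.
set b := a * _.
elim: V VD sV => [|V IH] VD sV.
  exists [::] => //; rewrite mulr0 addr0 mul1r mul0r addr0.
  have -> : quartic [::] = 0.
    rewrite /quartic big_nat big1// => n /andP[n0 _].
    by rewrite /rprod big_nil coef1 gtn_eqF// nc0 expr0n.
  rewrite mulr0 add0r /uncovered /= sumr_const_nat subn0 divff//.
  by rewrite gt_eqF.
have sV' : s ^+ V <= S.
  by apply: le_trans sV; rewrite exprS ler_peMl// exprn_ge0// (le_trans ler01).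
have [ks sz IHks] := IH ltac:(lia) sV'.
have H_sup l : nc (rprod ks).[w ^+ l] <= S.
  by apply: le_trans (rprod_sup _ _) _; rewrite sz.
have q := @quartic_cons ks S ltac:(rewrite sz; lia) H_sup.
have mean : \sum_(0 <= k < Q) (a * quartic (k :: ks) + uncovered (k :: ks) / Q%:R)
    <= Q%:R * (a * quartic ks + b + (1 - iota) * (uncovered ks / Q%:R)).
  rewrite big_split /= -mulr_sumr -mulr_suml mulrDr lerD//.
    by rewrite /b -mulrDr mulrCA ler_wpM2l.
  by rewrite !mulrA ler_pM2r ?invr_gt0// -mulrA uncovered_cons.
have [k kQ hk] := pigeonhole_mean Q_gt0 mean.
exists (k :: ks); first by rewrite /= sz.
have mono : uncovered (k :: ks) / Q%:R <= uncovered ks / Q%:R.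
  rewrite ler_pM2r ?invr_gt0//; apply: ler_sum => l _ /=.
  by rewrite ler_nat; case: (I _).
rewrite -natr1 [iota * _]mulrDr mulr1 mulrDl mul1r.
have : iota * V%:R * (uncovered (k :: ks) / Q%:R) <= iota * V%:R * (uncovered ks / Q%:R).
  by apply: ler_wpM2l => //; apply: mulr_ge0.
have : iota * (uncovered (k :: ks) / Q%:R) <= iota * (uncovered ks / Q%:R).
  by apply: ler_wpM2l.
rewrite mulrDl mul1r in IHks.
move: (uncovered ks / _) (uncovered (k :: ks) / _) (quartic ks) (quartic (k :: ks)) IHks hk mono.
by move=> *; lra.
Qed.

End Greedy.

(** * Smooth kernels with fast decay *)

Section Sine.
Variable R : realType.
Implicit Types x y : R.

Lemma expR1_le4 : expR 1 <= 4 :> R.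
Proof.
have h : 2^-1 <= expR (- 2^-1) :> R by have := expR_ge1Dx (- 2^-1 : R); lra.
have e : expR (1 : R) = expR 2^-1 ^+ 2 by rewrite -expRM_natl; congr expR; field.
have h2 : expR (2^-1 : R) <= 2.
  by rewrite -[expR _]invrK -expRN -[leRHS]invrK lef_pV2 ?posrE ?expR_gt0.
by rewrite e; have := expR_gt0 (2^-1 : R); nra.
Qed.

Lemma expR_le4X (n : nat) : expR n%:R <= 4 ^+ n :> R.
Proof.
by rewrite -[n%:R]mulr1 expRM_natl lerXn2r ?nnegrE ?expR_ge0// expR1_le4.
Qed.

Lemma cos_ge x : 1 - x ^+ 2 / 2 <= cos x.
Proof.
have -> : cos x = 1 - 2 * sin (x / 2) ^+ 2.
  have {1}-> : x = (x / 2) *+ 2 by rewrite -mulr_natr divfK.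
  by rewrite cos_mulr2n cos2sin2; ring.
have h : `|sin (x / 2)| ^+ 2 <= `|x / 2| ^+ 2.
  by rewrite lerXn2r ?nnegrE ?abs_sin_le.
by rewrite !real_normK ?num_real// in h; lra.
Qed.

Lemma sin_ge_half y : 0 <= y <= 1 -> y / 2 <= sin y.
Proof.
move=> /andP[y0 y1]; have [->|yn0] := eqVneq y 0; first by rewrite sin0 mul0r.
have yp : 0 < y by lra.
have [c] : exists2 c, c \in `]0, y[%R & sin y - sin 0 = cos c * (y - 0).
  apply: MVT => //.
  by apply: continuous_subspaceT => x; exact: continuous_sin.
rewrite in_itv /= sin0 !subr0 => /andP[c0 cy] ->.
have := cos_ge c; have : c ^+ 2 <= 1 by rewrite expr_le1//; lra.
by move: (cos c) => C; nra.
Qed.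

Lemma sin_ge_quarter x : 0 <= x <= pi / 2 -> x / 4 <= sin x.
Proof.
move=> /andP[x0 xp]; have [x1|x1] := leP x 1.
  by have := @sin_ge_half x; rewrite x0 x1 => /(_ isT); lra.
have := @sin_ge_half 1; rewrite ler01 lexx => /(_ isT) h1.
have : sin 1 < sin x.
  by rewrite ltr_sin// in_itv /=; have := @pihalf_ge1 R; lra.
by have := @pihalf_lt2 R; lra.
Qed.

Lemma viete K x :
  (\prod_(0 <= l < K) cos (x / 2 ^+ l.+1)) * (2 ^+ K * sin (x / 2 ^+ K)) = sin x.
Proof.
elim: K => [|K IH]; first by rewrite big_geq// expr0 divr1 !mul1r.
rewrite -[RHS]IH big_nat_recr//= -mulrA; congr (_ * _).
have -> : x / 2 ^+ K = (x / 2 ^+ K.+1) *+ 2.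
  by rewrite -mulr_natr exprS; field; rewrite expf_neq0.
by rewrite sin_mulr2n -mulr_natr exprS; ring.
Qed.

Definition cos2prod K x := \prod_(0 <= l < K) cos (x / 2 ^+ l.+1) ^+ 2.

Lemma cos2prod_ge0 K x : 0 <= cos2prod K x.
Proof. by apply: prodr_ge0 => l _; exact: sqr_ge0. Qed.

Lemma cos2_le1 x : cos x ^+ 2 <= 1.
Proof. by have := cos2Dsin2 x; have := sqr_ge0 (sin x); lra. Qed.

Lemma cos2prodS K x : cos2prod K.+1 x <= cos2prod K x.
Proof.
rewrite /cos2prod big_nat_recr//= -[leRHS]mulr1.
by apply: ler_wpM2l; [exact: cos2prod_ge0|exact: cos2_le1].
Qed.

Lemma cos2prod_le1 K x : cos2prod K x <= 1.
Proof.
elim: K => [|K IH]; first by rewrite /cos2prod big_geq.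
exact: le_trans (cos2prodS _ _) IH.
Qed.

(** The full product is [(sin x / x) ^ 2]; the truncated one has [2 ^ K * sin (x / 2 ^ K) >= x / 2]
    in the denominator, hence the 4. *)
Lemma cos2prod_bound K x : 0 < x <= 2 ^+ K -> cos2prod K x <= 4 / x ^+ 2.
Proof.
move=> /andP[x0 xK]; have K0 : 0 < 2 ^+ K :> R by rewrite exprn_gt0.
rewrite /cos2prod prodrXl; have := viete K x.
have := @sin_ge_half (x / 2 ^+ K).
rewrite divr_ge0 ?(ltW x0) ?(ltW K0)//= ler_pdivrMr// mul1r xK => /(_ isT) h.
have h2 : x / 2 <= 2 ^+ K * sin (x / 2 ^+ K).
  have -> : x / 2 = 2 ^+ K * (x / 2 ^+ K / 2) by field; rewrite gt_eqF.
  by rewrite ler_pM2l.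
have := sin_max x; move: (\prod_(_ <= _ < _) _) (2 ^+ K * _) (sin x) h2 => p y z h2.
rewrite ler_norml => /andP[z1 z2] e.
rewrite ler_pdivlMr ?exprn_gt0//.
have e2 : p ^+ 2 * y ^+ 2 <= 1 by rewrite -exprMn e; nra.
have h3 : x ^+ 2 <= 4 * y ^+ 2 by nra.
by have := sqr_ge0 p; nra.
Qed.

End Sine.

Section SpectralSupport.
Variable R : realType.
Implicit Types (s : R) (f g : int -> R).

(* [f] is the Fourier transform of a functional carried by [-s, s]. *)
Definition carried s f := forall (L : nat) (b : int -> R[i]) (B : R),
  (forall x, `|x| <= s -> nc (zs L (fun m => b m * expi (m%:~R * x))) <= B) ->
  nc (zs L (fun m => b m * ((f m)%:C)%C)) <= B.

Lemma carried_one : carried 0 (fun=> 1).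
Proof.
move=> L b B hB; have := hB 0; rewrite normr0 lexx => /(_ isT); congr (nc _ <= _).
by apply: zs_ext => m; rewrite mulr0 expi0.
Qed.

Lemma carried_cos a : 0 <= a -> carried a (fun m => cos (a * m%:~R)).
Proof.
move=> a0 L b B hB.
have h1 := hB a; rewrite ger0_norm// lexx in h1.
have h2 := hB (- a); rewrite normrN ger0_norm// lexx in h2.
have {}h1 := h1 isT; have {}h2 := h2 isT.
have -> : zs L (fun m => b m * ((cos (a * m%:~R))%:C)%C) =
   ((2^-1)%:C)%C * (zs L (fun m => b m * expi (m%:~R * a)) +
          zs L (fun m => b m * expi (m%:~R * - a))).
  rewrite -zsD -zsMl; apply: zs_ext => m; rewrite -mulrDr mulrCA; congr (_ * _).
  rewrite mulrN /expi cosN sinN [a * _]mulrC; apply/eqP.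
  rewrite eq_complex Re_mul Im_mul Re_add Im_add /=.
  by apply/andP; split; apply/eqP; field.
rewrite ncM nc_realC ger0_norm// (le_trans (ler_wpM2l _ (ncD _ _)))//.
by lra.
Qed.

Lemma carriedM s s' f g : carried s f -> carried s' g ->
  carried (s + s') (fun m => f m * g m).
Proof.
move=> hf hg L b B hB.
have := hf L (fun m => b m * ((g m)%:C)%C) B.
move=> hf'; have {hf'} : nc (zs L (fun m => b m * ((g m)%:C)%C * ((f m)%:C)%C)) <= B.
  apply: hf' => x xs.
  have := hg L (fun m => b m * expi (m%:~R * x)) B.
  rewrite (_ : zs L (fun m => b m * expi (m%:~R * x) * ((g m)%:C)%C) =
     zs L (fun m => b m * ((g m)%:C)%C * expi (m%:~R * x))); last first.
    by apply: zs_ext => m; rewrite mulrAC.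
  apply => y ys; have := hB (x + y).
  rewrite (_ : zs L (fun m => b m * expi (m%:~R * (x + y))) =
    zs L (fun m => b m * expi (m%:~R * x) * expi (m%:~R * y))); last first.
    by apply: zs_ext => m; rewrite mulrDr expiD mulrA.
  by apply; rewrite (le_trans (ler_normD _ _))// lerD.
congr (nc _ <= _); apply: zs_ext => m.
by rewrite -mulrA -rmorphM [g m * _]mulrC.
Qed.

Lemma carried_mono s s' f : s <= s' -> carried s f -> carried s' f.
Proof. by move=> ss hf L b B hB; apply: hf => x xs; apply: hB; exact: le_trans ss. Qed.

Lemma carried_ext s f g : (forall m, f m = g m) -> carried s f -> carried s g.
Proof. by move=> fg; rewrite (_ : f = g)//; apply/funext. Qed.

Lemma carried_prod (I : Type) (r : seq I) (s_ : I -> R) (f_ : I -> int -> R) :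
  (forall i, carried (s_ i) (f_ i)) ->
  carried (\sum_(i <- r) s_ i) (fun m => \prod_(i <- r) f_ i m).
Proof.
move=> h; elim: r => [|i r IH].
  rewrite big_nil; apply: carried_ext carried_one => m; by rewrite big_nil.
rewrite big_cons; apply: carried_ext (carriedM (h i) IH) => m.
by rewrite big_cons.
Qed.

Lemma carried_lim s f (fK : nat -> int -> R) :
  (forall K, carried s (fK K)) ->
  (forall m, (fun K => fK K m) @ \oo --> (f m : R)) -> carried s f.
Proof.
move=> hK hlim L b B hB.
have small L' (e : R) : 0 < e -> \forall K \near \oo,
    zs L' (fun m => nc (b m) * `|f m - fK K m|) <= e.
  have one m (e' : R) : 0 < e' -> \forall K \near \oo, nc (b m) * `|f m - fK K m| <= e'.
    move=> e0; have p : 0 < e' / (nc (b m) + 1).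
      by rewrite divr_gt0// ltr_wpDl ?nc_ge0.
    have /cvgrPdist_le/(_ _ p) := hlim m; apply: filterS => K hKm.
    have b1 : 0 < nc (b m) + 1 by rewrite ltr_wpDl ?nc_ge0.
    rewrite ler_pdivlMr// in hKm; apply: le_trans hKm.
    by rewrite mulrC ler_wpM2l// lerDl.
  elim: L' e => [|L' IH] e e0.
    by apply: filterS (one 0 e e0) => K; rewrite zs0E.
  have e3 : 0 < e / 3 by lra.
  apply: filterS (filterI (IH _ e3) (filterI (one L'.+1%:Z _ e3) (one (- L'.+1%:Z) _ e3))).
  by move=> K [k1 [k2 k3]]; rewrite zsS; lra.
apply/ler_addgt0Pr => e e0.
have [K hKe] := filter_ex (small L e e0).
have -> : zs L (fun m => b m * ((f m)%:C)%C) =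
   zs L (fun m => b m * ((fK K m)%:C)%C) + zs L (fun m => b m * ((f m - fK K m)%:C)%C).
  by rewrite -zsD; apply: zs_ext => m; rewrite -mulrDr -rmorphD addrC subrK.
apply: (le_trans (ncD _ _)); apply: lerD; first exact: hK.
apply: (le_trans (nc_zs _ _)); apply: le_trans hKe.
by apply: ler_zs => m _; rewrite ncM nc_realC.
Qed.

Lemma sum_dyadic (x : R) n :
  \sum_(0 <= l < n) (x / 2 ^+ l.+1 + x / 2 ^+ l.+1) = 2 * x * (1 - 2 ^- n).
Proof.
elim: n => [|n IH]; first by rewrite big_geq// expr0 invr1; ring.
by rewrite big_nat_recr//= IH exprS; field; rewrite expf_neq0.
Qed.

Lemma sum_inv_sqr n : \sum_(0 <= k < n) (k.+1%:R : R) ^- 2 <= 2.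
Proof.
case: n => [|n]; first by rewrite big_geq.
suff : \sum_(0 <= k < n.+1) (k.+1%:R : R) ^- 2 <= 2 - (n.+1%:R)^-1.
  have : 0 < (n.+1%:R : R)^-1 by rewrite invr_gt0 ltr0n.
  by move=> h1 /le_trans; apply; rewrite gerBl ltW.
elim: n => [|n IH]; first by rewrite big_nat1 expr1n invr1; lra.
rewrite big_nat_recr//=; apply: (le_trans (lerD IH (lexx _))).
have n1 : 0 < n.+1%:R :> R by rewrite ltr0n.
rewrite -[n.+2%:R]natr1; move: (n.+1%:R) n1 => x x0.
have x1 : 0 < x + 1 by lra.
rewrite -subr_ge0 (_ : _ - _ = (x * (x + 1) ^+ 2)^-1).
  by rewrite invr_ge0 mulr_ge0 ?exprn_ge0// ltW.
by field; rewrite !gt_eqF.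
Qed.

Lemma smooth_kernel s0 : 0 < s0 -> exists K : int -> R,
  [/\ K 0 = 1, forall m, 0 <= K m <= 1, carried s0 K &
      forall m (n : nat), 32 * n%:R ^+ 2 <= s0 * `|m|%:R -> K m <= expR (- (2 * n%:R))].
Proof.
move=> s0p.
pose sk (k : nat) : R := s0 / 4 / k.+1%:R ^+ 2.
have sk0 k : 0 < sk k by rewrite !divr_gt0 ?exprn_gt0 ?ltr0n.
pose xk (k : nat) (m : int) : R := sk k * `|m|%:R.
pose kK K m := \prod_(0 <= k < K) cos2prod K (xk k m).
have kK0 K m : 0 <= kK K m by apply: prodr_ge0 => k _; exact: cos2prod_ge0.
have kKS K m : kK K.+1 m <= kK K m.
  rewrite /kK big_nat_recr//= -[leRHS]mulr1; apply: ler_pM.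
  - by apply: prodr_ge0 => k _; exact: cos2prod_ge0.
  - exact: cos2prod_ge0.
  - by apply: ler_prod => k _; rewrite cos2prod_ge0 cos2prodS.
  - exact: cos2prod_le1.
have kKcvg m : cvgn (fun K => kK K m).
  apply: nonincreasing_is_cvgn; first by apply/nonincreasing_seqP => K.
  by exists 0 => _ [K _ <-].
pose K m := limn (fun K => kK K m).
have Kle m N : K m <= kK N m.
  by apply: (@nonincreasing_cvgn_ge _ (fun K => kK K m)) => //; apply/nonincreasing_seqP.
have carr N : carried s0 (kK N).
  apply: (@carried_mono (\sum_(0 <= k < N) \sum_(0 <= l < N)
      (sk k / 2 ^+ l.+1 + sk k / 2 ^+ l.+1))).
    apply: (@le_trans _ _ (\sum_(0 <= k < N) s0 / 2 * k.+1%:R ^- 2)).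
      apply: ler_sum => k _; rewrite sum_dyadic -[leRHS]mulr1.
      have -> : 2 * sk k = s0 / 2 * k.+1%:R ^- 2 by rewrite /sk -!mulrA; field.
      apply: ler_wpM2l; last by rewrite gerBl invr_ge0 exprn_ge0.
      by rewrite mulr_ge0 ?invr_ge0 ?exprn_ge0// divr_ge0// ltW.
    rewrite -mulr_sumr.
    by have := sum_inv_sqr N; move: (\sum_(_ <= _ < _) _) => x; nra.
  apply: carried_prod => k; apply: carried_prod => l.
  have hc : carried (sk k / 2 ^+ l.+1) (fun m => cos (sk k / 2 ^+ l.+1 * m%:~R)).
    by apply: carried_cos; rewrite divr_ge0 ?exprn_ge0// ltW.
  apply: carried_ext (carriedM hc hc) => m.
  rewrite -expr2 -cos_norm normrM ger0_norm; last by rewrite divr_ge0 ?exprn_ge0// ltW.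
  by rewrite -intr_norm -natr_absz /xk mulrAC.
exists K; split.
- apply: cvg_lim => //; rewrite (_ : (fun N => kK N 0) = fun=> 1); first exact: cvg_cst.
  apply/funext => N; rewrite /kK big1// => k _.
  by rewrite /xk mulr0 /cos2prod big1// => l _; rewrite mul0r cos0 expr1n.
- move=> m; apply/andP; split.
    by apply: limr_ge => //; near=> N; exact: kK0.
  by apply: le_trans (Kle m 0%N) _; rewrite /kK big_geq.
- by apply: carried_lim carr _ => m; exact: kKcvg.
- move=> m n hn.
  (* Large enough to contain the [n] useful factors and to satisfy [x <= 2 ^ N] in
     [cos2prod_bound]. *)
  pose N := (n + (Num.truncn (xk 0 m)).+1)%N.
  have xN : xk 0 m <= 2 ^+ N.
    apply: (@le_trans _ _ N%:R); last by rewrite -natrX ler_nat ltnW// ltn_expl.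
    rewrite ltW// (lt_le_trans (truncnS_gt _))// ler_nat.
    exact: leq_addl.
  apply: le_trans (Kle m N) _.
  rewrite /kK (@big_cat_nat _ _ _ n)//=; last exact: leq_addr.
  apply: (@le_trans _ _ (16^-1 ^+ n * 1)).
    apply: ler_pM; try by apply: prodr_ge0 => k _; exact: cos2prod_ge0.
      rewrite -[n in leRHS]subn0 -prodr_const_nat big_nat [leRHS]big_nat.
      apply: ler_prod => k /andP[_ kn]; rewrite cos2prod_ge0 /=.
      have k1 : 1 <= k.+1%:R :> R by rewrite ler1n.
      have kn' : k.+1%:R <= n%:R :> R by rewrite ler_nat.
      have x8 : 8 <= xk k m.
        rewrite /xk /sk mulrAC ler_pdivlMr ?exprn_gt0 ?ltr0n//.
        have : (k.+1%:R : R) ^+ 2 <= n%:R ^+ 2 by rewrite lerXn2r ?nnegrE.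
        by rewrite [s0 / 4 * _]mulrAC; move: hn; move: (s0 * _) (n%:R ^+ 2) (k.+1%:R ^+ 2) => y a b; lra.
      apply: (le_trans (cos2prod_bound _)).
        rewrite (lt_le_trans _ x8)//= (le_trans _ xN)// /xk ler_wpM2r//.
        rewrite /sk expr1n divr1 ler_pdivrMr ?exprn_gt0 ?ltr0n//.
        by rewrite ler_peMr ?divr_ge0 ?(ltW s0p)// exprn_ege1.
      rewrite ler_pdivrMr ?exprn_gt0// ?(lt_le_trans _ x8)//.
      by nra.
    by apply: prodr_ile1 => k _; rewrite cos2prod_ge0 cos2prod_le1.
  rewrite mulr1 expRN exprVn lef_pV2 ?posrE ?expR_gt0 ?exprn_gt0//.
  have := expR_le4X R (2 * n); rewrite natrM => /le_trans; apply.
  by rewrite exprM -natrX.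
Unshelve. all: by end_near.
Qed.

End SpectralSupport.

(** * The notch polynomials *)

Section Harmonic.
Variable R : realType.

Lemma harmonic_le_ln n : (0 < n)%N ->
  \sum_(1 <= k < n.+1) (k%:R : R)^-1 <= 1 + ln n%:R.
Proof.
case: n => // n _; elim: n => [|n IH]; first by rewrite big_nat1 invr1 ln1 addr0.
rewrite big_nat_recr//=; apply: (le_trans (lerD IH (lexx _))).
rewrite -addrA lerD2l -lerBrDl.
have n1 : 0 < n.+1%:R :> R by rewrite ltr0n.
have n2 : 0 < n.+2%:R :> R by rewrite ltr0n.
rewrite -ln_div ?posrE//.
have := @le_ln1Dx R (- n.+2%:R^-1).
have -> : 1 + - n.+2%:R^-1 = n.+1%:R / n.+2%:R :> R.
  rewrite -[n.+2%:R]natr1 in n2 *; move: (n.+1%:R) n1 n2 => x x0 x1.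
  by field; rewrite gt_eqF.
have lt1 : -1 < - n.+2%:R^-1 :> R by rewrite ltrN2 invf_lt1// ltr1n.
move=> /(_ lt1); rewrite !ln_div ?posrE//.
by move: (ln _) (ln _) (_^-1) => a b c; lra.
Qed.

End Harmonic.

Section RootDistance.
Variables (R : realType) (Q : nat).
Local Notation w := (rootu R Q).

Lemma nc_rootu_sub1_half k : (0 < k)%N -> (2 * k <= Q)%N ->
  k%:R / Q%:R <= nc (w ^+ k - 1).
Proof.
move=> k0 kQ; have Q0 : 0 < Q%:R :> R by rewrite ltr0n; lia.
have p2 := @pi_ge2 R.
rewrite rootuX ?nc_expi_sub1; last by lia.
set x := _ / 2.
have xE : x = pi * (k%:R / Q%:R) by rewrite /x; field; rewrite gt_eqF.
have r0 : 0 <= k%:R / Q%:R :> R by rewrite divr_ge0// ltW.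
have r2 : k%:R / Q%:R <= 2^-1 :> R.
  by rewrite ler_pdivrMr// ler_pdivlMl// -natrM ler_nat.
have := @sin_ge_quarter R x.
have -> : 0 <= x <= pi / 2.
  by rewrite xE mulr_ge0 ?pi_ge0//= ler_wpM2l// pi_ge0.
move=> /(_ isT) h; have := ler_norm (sin x).
by rewrite xE in h *; move: (k%:R / Q%:R) r0 h => r; nra.
Qed.

Lemma inv_nc_rootu_sub1 k : (0 < k < Q)%N ->
  (nc (w ^+ k - 1))^-1 <= Q%:R * (k%:R^-1 + (Q - k)%:R^-1).
Proof.
move=> /andP[k0 kQ]; have Q0 : 0 < Q%:R :> R by rewrite ltr0n; lia.
have main m : (0 < m)%N -> (2 * m <= Q)%N -> (nc (w ^+ m - 1))^-1 <= Q%:R * m%:R^-1.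
  move=> m0 mQ; have mp : 0 < m%:R :> R by rewrite ltr0n.
  rewrite -[leRHS]invrK invfM invrK mulrC.
  have h := nc_rootu_sub1_half m0 mQ.
  have mQp : 0 < m%:R / Q%:R :> R by exact: divr_gt0.
  by rewrite lef_pV2 ?posrE//; exact: lt_le_trans h.
have [h|h] := leqP (2 * k)%N Q.
  by apply: (le_trans (main k k0 h)); rewrite ler_pM2l// lerDl invr_ge0.
have -> : nc (w ^+ k - 1) = nc (w ^+ (Q - k) - 1).
  rewrite -[LHS]mul1r -(@nc_rootuX R Q _ (Q - k)); last by lia.
  rewrite -ncM mulrBr mulr1 -exprD subnK ?rootuQ; [|lia..].
  by rewrite ncB.
have kQ' : (0 < Q - k)%N by lia.
by apply: (le_trans (main _ kQ' _)); [lia|rewrite ler_pM2l// lerDr invr_ge0].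
Qed.

Lemma sum_inv_nc_rootu : (1 < Q)%N ->
  \sum_(1 <= k < Q) (nc (w ^+ k - 1))^-1 <= 2 * Q%:R * (1 + ln Q%:R).
Proof.
move=> Q1; have Q0 : 0 < Q%:R :> R by rewrite ltr0n; lia.
apply: (@le_trans _ _ (\sum_(1 <= k < Q) Q%:R * (k%:R^-1 + (Q - k)%:R^-1))).
  by rewrite big_nat [leRHS]big_nat; apply: ler_sum => k /inv_nc_rootu_sub1.
rewrite -mulr_sumr big_split /= [X in _ + X]big_nat_rev /=.
have -> : \sum_(1 <= i < Q) ((Q - (1 + Q - i.+1))%:R : R)^-1 = \sum_(1 <= i < Q) i%:R^-1.
  rewrite big_nat [RHS]big_nat; apply: eq_bigr => i hi.
  by congr (_%:R^-1); lia.
have : \sum_(1 <= i < Q) (i%:R : R)^-1 <= 1 + ln Q%:R.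
  apply: le_trans (harmonic_le_ln R (ltnW Q1)).
  by rewrite [leRHS]big_nat_recr /=; [rewrite lerDl invr_ge0|exact: ltnW].
by move: (\sum_(_ <= _ < _) _) => x; nra.
Qed.

End RootDistance.

Section Factor.
Variables (R : realType) (d : nat).
Variable e : R.
Hypothesis eE : e = d%:R^-1.
Hypothesis dp : 0 < d%:R :> R.
Hypothesis e0 : 0 < e.
Hypothesis e1 : e <= 16^-1.
Let r : R[i] := ((1 - e)%:C)%C.

(* The Blaschke-like quotient [(1 - z) / (1 - r z)], truncated at degree [d ^ 2]. *)
Definition notch : {poly R[i]} :=
  \poly_(m < (d ^ 2).+1) (if m == 0 then 1 else - ((e%:C)%C * r ^+ m.-1)).

Local Ltac elra := have := e0; have := e1; lra.
Local Ltac enra := have := e0; have := e1; nra.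

Let ncr : nc r = 1 - e. Proof. by rewrite nc_realC ger0_norm//; elra. Qed.

(** The reason for the degree [d ^ 2]: [(1 - 1 / d) ^ (d ^ 2) <= exp (- d)], so the truncation error
    in the numerator is at most [e ^ 2]. *)
Let rhoX : (1 - e) ^+ (d ^ 2) <= e.
Proof.
have h : 1 - e <= expR (- e) by have := expR_ge1Dx (- e).
have : (1 - e) ^+ (d ^ 2) <= expR (- e) ^+ (d ^ 2).
  by rewrite lerXn2r ?nnegrE ?expR_ge0//; elra.
move=> /le_trans; apply.
rewrite -expRM_natl natrX eE mulrN expr2 mulfK ?gt_eqF//.
rewrite expRN lef_pV2 ?posrE ?expR_gt0//.
by have := expR_ge1Dx (d%:R : R); elra.
Qed.

Let geom z : notch.[z] = 1 - (e%:C)%C * z * \sum_(0 <= m < d ^ 2) (r * z) ^+ m.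
Proof.
rewrite horner_poly big_ord_recl /= expr0 mulr1; congr (_ + _).
rewrite big_mkord mulr_sumr -sumrN; apply: eq_bigr => m _.
by rewrite /= exprS exprMn; ring.
Qed.

Let notchE z : (1 - r * z) * notch.[z] =
  1 - z + (e%:C)%C * z * (r * z) ^+ (d ^ 2).
Proof.
have g : (1 - r * z) * (\sum_(0 <= m < d ^ 2) (r * z) ^+ m) = 1 - (r * z) ^+ (d ^ 2).
  have := subrX1 (r * z) (d ^ 2); rewrite -(big_mkord xpredT (fun i => (r * z) ^+ i)) => h.
  by rewrite -[RHS]opprB h; ring.
rewrite geom mulrBr mulr1 mulrCA g.
have r1 : 1 = r + (e%:C)%C by rewrite -rmorphD /= subrK.
have -> : 1 - r * z = 1 - z + (e%:C)%C * z.
  have -> : (e%:C)%C = 1 - r by rewrite {1}r1 addrC addKr.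
  by ring.
by ring.
Qed.

Section OnCircle.
Variable z : R[i].
Hypothesis z1 : nc z = 1.

Let ncrz : nc (r * z) = 1 - e. Proof. by rewrite ncM z1 mulr1 ncr. Qed.

Let den_ge : e <= nc (1 - r * z).
Proof.
have : nc (1 : R[i]) <= nc (1 - r * z) + nc (r * z).
  by apply: le_trans (ncD _ _); rewrite subrK.
by rewrite nc1 ncrz; elra.
Qed.

(** After squaring, the difference of the two sides is affine in [x = Re z]; it is written as the
    interpolation of its values at [x = 1] and [x = -1], both nonnegative. *)
Let den_ge2 : nc (1 - z) <= (1 + e) * nc (1 - r * z).
Proof.
rewrite -(@ler_pXn2r _ 2) ?nnegrE ?nc_ge0 ?mulr_ge0 ?nc_ge0//; last by elra.
rewrite exprMn !nc_sqr; have := nc_sqr z; rewrite z1 expr1n.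
rewrite !(Re_add, Im_add, Re_opp, Im_opp, Re_mul, Im_mul) /=.
case: z => x y /= xy; rewrite !mul0r subr0 addr0 sub0r.
have x1 : -1 <= x <= 1 by apply/andP; split; enra.
rewrite !sub0r !sqrrN.
have -> : (1 - x) ^+ 2 + y ^+ 2 = 2 - 2 * x by enra.
have -> : (1 - (1 - e) * x) ^+ 2 + ((1 - e) * y) ^+ 2 =
    1 + (1 - e) ^+ 2 - 2 * (1 - e) * x.
  rewrite [((1 - e) * y) ^+ 2]exprMn; have -> : y ^+ 2 = 1 - x ^+ 2 by elra.
  by ring.
have h2 : 0 <= ((1 + e) * (2 - e)) ^+ 2 - 4.
  by have h : 2 <= (1 + e) * (2 - e); [enra|move: (_ * _) h => u; nra].
rewrite -subr_ge0 (_ : _ - _ = (1 + x) / 2 * ((1 + e) * e) ^+ 2 +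
  (1 - x) / 2 * (((1 + e) * (2 - e)) ^+ 2 - 4)); last by field.
by apply: addr_ge0; apply: mulr_ge0; rewrite ?sqr_ge0//; lra.
Qed.

Let num_tail : nc ((e%:C)%C * z * (r * z) ^+ (d ^ 2)) <= e * e.
Proof.
rewrite !ncM ncX ncrz z1 mulr1 nc_realC ger0_norm; last by elra.
by rewrite ler_pM2l//; elra.
Qed.

Lemma nc_notch : nc notch.[z] <= 1 + 2 * e.
Proof.
have D0 : 0 < nc (1 - r * z) by apply: lt_le_trans den_ge; elra.
rewrite -(ler_pM2l D0) -ncM notchE; apply: (le_trans (ncD _ _)).
apply: (le_trans (lerD den_ge2 num_tail)).
by have := den_ge; move: (nc _) => x; enra.
Qed.

(** The numerator is at most [e / 16 + e ^ 2 <= e / 8], while the denominator is at least [e]. *)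
Lemma nc_notch_small : nc (1 - z) <= e / 16 -> nc notch.[z] <= 8^-1.
Proof.
move=> h; have D0 : 0 < nc (1 - r * z) by apply: lt_le_trans den_ge; elra.
rewrite -(ler_pM2l D0) -ncM notchE; apply: (le_trans (ncD _ _)).
apply: (le_trans (lerD h num_tail)); have := den_ge; move: (nc _) => x; enra.
Qed.

Let notch_sub1 : nc (1 - r * z) * nc (notch.[z] - 1) <= 2 * e.
Proof.
rewrite -ncM mulrBr mulr1 notchE.
have r1 : 1 = r + (e%:C)%C by rewrite -rmorphD /= subrK.
have -> : 1 - z + (e%:C)%C * z * (r * z) ^+ (d ^ 2) - (1 - r * z) =
   (e%:C)%C * z * (r * z) ^+ (d ^ 2) - (e%:C)%C * z.
  have -> : (e%:C)%C = 1 - r by rewrite {1}r1 addrC addKr.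
  by ring.
apply: (le_trans (ncBD _ _)); apply: (le_trans (lerD num_tail (lexx _))).
rewrite ncM z1 mulr1 nc_realC ger0_norm; last by elra.
by enra.
Qed.

Lemma nc_notch_sub1 : nc (notch.[z] - 1) <= 2.
Proof.
rewrite -(@ler_pM2l _ e); last by elra.
apply: le_trans (_ : _ <= 2 * e) _; last by elra.
by apply: le_trans notch_sub1; rewrite ler_wpM2r ?nc_ge0.
Qed.

Lemma nc_notch_sub1' : nc (1 - z) * nc (notch.[z] - 1) <= 4 * e.
Proof.
have h : nc (1 - z) <= 2 * nc (1 - r * z).
  by apply: (le_trans den_ge2); have := nc_ge0 (1 - r * z); move: (nc _) => a; enra.
apply: (le_trans (ler_wpM2r (nc_ge0 _) h)); rewrite -mulrA.
by have := notch_sub1; elra.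
Qed.

End OnCircle.

Lemma size_notch : (size notch <= (d ^ 2).+1)%N.
Proof. exact: size_poly. Qed.

Variable p : nat.
Definition notchX : {poly R[i]} := notch ^+ p.

Lemma size_notchX : (size notchX <= (p * d ^ 2).+1)%N.
Proof.
apply: (leq_trans (size_poly_exp_leq _ _)); rewrite ltnS mulnC leq_mul2l.
by have := size_notch; lia.
Qed.

Lemma notchX_0 : notchX`_0 = 1.
Proof.
by rewrite -horner_coef0 horner_exp geom mulr0 mul0r subr0 expr1n.
Qed.

Let s : R := (1 + 2 * e) ^+ p.

Lemma nc_notchX z : nc z = 1 -> nc notchX.[z] <= s.
Proof.
move=> z1; rewrite horner_exp ncX lerXn2r ?nnegrE ?nc_ge0 ?nc_notch//; elra.
Qed.

Lemma nc_notchX_small z : nc z = 1 -> nc (1 - z) <= e / 16 ->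
  nc notchX.[z] <= 8^-1 ^+ p.
Proof.
by move=> z1 h; rewrite horner_exp ncX lerXn2r ?nnegrE ?nc_ge0 ?nc_notch_small//; elra.
Qed.

Let nc_notchX_sub1 z : nc z = 1 -> nc (notchX.[z] - 1) <= p%:R * s * nc (notch.[z] - 1).
Proof.
move=> z1; rewrite horner_exp subrX1 ncM mulrC ler_wpM2r ?nc_ge0//.
apply: (le_trans (nc_sum _ _ _)).
apply: (@le_trans _ _ (\sum_(i < p) s)).
  apply: ler_sum => i _; rewrite ncX.
  apply: (@le_trans _ _ ((1 + 2 * e) ^+ i)).
    by rewrite lerXn2r ?nnegrE ?nc_ge0 ?nc_notch//; elra.
  by rewrite /s ler_weXn2l ?(ltnW (ltn_ord i))//; elra.
by rewrite sumr_const card_ord mulr_natl.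
Qed.

Variable Q : nat.
Hypothesis dQ : (d <= Q)%N.
Hypothesis pQ : (p * d ^ 2 < Q)%N.
Local Notation w := (rootu R Q).

Let Q_gt0 : (0 < Q)%N. Proof. by lia. Qed.

Lemma notchX_eta : \sum_(1 <= m < Q) nc notchX`_m ^+ 2 <= s ^+ 2 - 1.
Proof.
have szQ : (size notchX <= Q)%N by apply: leq_trans size_notchX _.
have Q0 : 0 < Q%:R :> R by rewrite ltr0n.
have := parseval Q_gt0 szQ; rewrite [X in _ * X]big_ltn// notchX_0 nc1 expr1n => pe.
have : \sum_(0 <= k < Q) nc notchX.[w ^+ k] ^+ 2 <= Q%:R * s ^+ 2.
  rewrite mulr_natl -[X in _ *+ X]subn0 -sumr_const_nat.
  apply: ler_sum => k _; rewrite lerXn2r ?nnegrE ?nc_ge0 ?nc_notchX ?nc_rootuX//.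
  by rewrite exprn_ge0//; elra.
by rewrite pe ler_pM2l//; elra.
Qed.

(** Away from the constant term these are the coefficients of [notchX - 1], bounded by its mean
    modulus over the roots of unity. That modulus decays like [e / |1 - z|], so the mean is a
    harmonic sum, whence the logarithm; the root 1 itself is absorbed through [e * Q >= 1]. *)
Lemma notchX_mu m : (0 < m)%N ->
  nc notchX`_m <= p%:R * s * ((10 + 8 * ln Q%:R) * e).
Proof.
move=> m0; have szQ : (size notchX <= Q)%N by apply: leq_trans size_notchX _.
have Q0 : 0 < Q%:R :> R by rewrite ltr0n.
have s0 : 0 <= s by rewrite exprn_ge0//; elra.
have lnQ : 0 <= ln Q%:R :> R by rewrite ln_ge0// ler1n.
have [mQ|mQ] := ltnP m Q; last first.
  rewrite nth_default ?nc0; last exact: leq_trans szQ mQ.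
  by rewrite !mulr_ge0 //; elra.
have szQ1 : (size (notchX - 1%:P)%R <= Q)%N.
  rewrite (leq_trans (size_polyD _ _))// geq_max szQ size_polyN size_poly1.
  exact: Q_gt0.
have := nc_coef_le Q_gt0 szQ1 mQ; rewrite coefB coefC gtn_eqF// subr0.
move=> /le_trans; apply; rewrite ler_pdivrMr// -(mulrA (p%:R * s)).
apply: (@le_trans _ _ (\sum_(0 <= k < Q) p%:R * s * nc (notch.[w ^+ k] - 1))).
  apply: ler_sum => k _; rewrite hornerD hornerN hornerC.
  by apply: nc_notchX_sub1; rewrite nc_rootuX.
rewrite -mulr_sumr; apply: ler_wpM2l; first by rewrite mulr_ge0.
rewrite big_ltn//.
have h1 := @nc_notch_sub1 (w ^+ 0) (nc_rootuX R Q_gt0 0).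
have h2 : \sum_(1 <= k < Q) nc (notch.[w ^+ k] - 1) <=
    4 * e * (2 * Q%:R * (1 + ln Q%:R)).
  apply: (@le_trans _ _ (4 * e * \sum_(1 <= k < Q) (nc (w ^+ k - 1))^-1)); last first.
    by rewrite ler_wpM2l ?sum_inv_nc_rootu ?mulr_ge0//; [elra|lia].
  rewrite mulr_sumr big_nat [leRHS]big_nat; apply: ler_sum => k hk.
  have kp : 0 < nc (w ^+ k - 1).
    rewrite lt_neqAle nc_ge0 andbT eq_sym; apply/eqP => /Normc.eq0_normc/eqP.
    by rewrite subr_eq0; apply/negP; exact: rootuX_neq1.
  rewrite ler_pdivlMr// mulrC ncB; apply: nc_notch_sub1'.
  by rewrite nc_rootuX.
apply: (le_trans (lerD h1 h2)).
have Qd : 2 <= 2 * e * Q%:R.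
  by rewrite eE mulrAC ler_pdivlMr// ler_pM2l// ler_nat.
rewrite (_ : (10 + 8 * ln Q%:R) * e * Q%:R =
  2 * e * Q%:R + 4 * e * (2 * Q%:R * (1 + ln Q%:R))).
  by rewrite lerD2r.
by ring.
Qed.

End Factor.

(** * Cutting a polynomial to zero on arcs *)

Section Fejer.
Variable R : realType.

Lemma expi_zE (x : R) (n : nat) : expi (n%:Z%:~R * x) = expi x ^+ n.
Proof. by rewrite -expi_natM. Qed.

Lemma expi_zNE (x : R) (n : nat) : expi ((- n%:Z)%:~R * x) = (expi x)^-1 ^+ n.
Proof. by rewrite mulrNz mulNr -mulrN -expiN -expi_natM. Qed.

Lemma dirichlet_telescope (x : R) L :
  (1 - expi x) * zs L (fun m => expi (m%:~R * x)) =
  (expi x)^-1 ^+ L - expi x ^+ L.+1.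
Proof.
elim: L => [|L IH]; first by rewrite zs0E mul0r expi0 mulr1 expr0 expr1.
rewrite zsS mulrDr IH expi_zE expi_zNE.
have -> : (expi x)^-1 ^+ L = expi x * (expi x)^-1 ^+ L.+1.
  by rewrite [_ ^+ L.+1]exprS mulrA divff ?mul1r// expi_neq0.
by rewrite ![expi x ^+ L.+2]exprS; ring.
Qed.

Lemma fejer_telescope (x : R) L :
  (1 - expi x) * (1 - (expi x)^-1) *
    zs L (fun m => (L.+1%:R - `|m|%:R) * expi (m%:~R * x)) =
  2 - expi x ^+ L.+1 - (expi x)^-1 ^+ L.+1.
Proof.
have nz := expi_neq0 x.
elim: L => [|L IH].
  rewrite zs0E mul0r expi0 !expr1 subr0 !mulr1.
  by field.
have -> : zs L.+1 (fun m => (L.+2%:R - `|m|%:R) * expi (m%:~R * x)) =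
   zs L (fun m => (L.+1%:R - `|m|%:R) * expi (m%:~R * x)) +
   zs L.+1 (fun m => expi (m%:~R * x)).
  have -> : zs L (fun m => (L.+1%:R - `|m|%:R) * expi (m%:~R * x)) =
      zs L.+1 (fun m => (L.+1%:R - `|m|%:R) * expi (m%:~R * x)).
    rewrite zsS (_ : `|- L.+1%:Z|%N = L.+1) ?absz_nat; last by lia.
    by rewrite subrr !mul0r !addr0.
  rewrite -zsD; apply: zs_ext => m; rewrite -[L.+2%:R]natr1.
  by ring.
rewrite mulrDr IH mulrAC [_ * zs _ _]dirichlet_telescope.
by rewrite !exprS; field.
Qed.

(** The Fejer sum is left unnormalised: away from [x = 0] it stays bounded while its mass at 0
    grows, and [cut_vanish] divides by [L + 1]. *)
Lemma fejer_bound (x eta : R) L : 0 < eta -> eta <= nc (expi x - 1) ->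
  nc (zs L (fun m => (L.+1%:R - `|m|%:R) * expi (m%:~R * x))) <= 4 / eta ^+ 2.
Proof.
move=> eta0 h; rewrite ler_pdivlMr ?exprn_gt0//.
set F := zs _ _.
have e1 : nc (1 - expi x) = nc (expi x - 1) by rewrite ncB.
have e2 : nc (1 - (expi x)^-1) = nc (expi x - 1).
  have -> : 1 - (expi x)^-1 = (expi x - 1) * (expi x)^-1.
    by rewrite mulrBl divff ?expi_neq0// mul1r.
  by rewrite ncM Normc.normcV nc_expi invr1 mulr1.
have := congr1 (@Normc.normc R) (fejer_telescope x L).
rewrite !ncM e1 e2 -/F => e.
have up : nc (2 - expi x ^+ L.+1 - (expi x)^-1 ^+ L.+1) <= 4.
  apply: (le_trans (ncBD _ _)); apply: (le_trans (lerD (ncBD _ _) (lexx _))).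
  by rewrite !ncX Normc.normcV nc_expi invr1 expr1n nc_natr; lra.
rewrite -e in up; apply: le_trans up.
have F0 := nc_ge0 F; rewrite mulrC -mulrA; move: (nc _) (nc F) h F0 => a f h F0.
have : eta ^+ 2 <= a ^+ 2 by rewrite lerXn2r ?nnegrE//; lra.
by nra.
Qed.

End Fejer.

Section SupportSums.
Variable R : realType.

Lemma zs_indicator (N L : nat) (B : R) (f : int -> R) : 0 <= B ->
  (forall k, f k <= if 0 <= k < N%:Z then B else 0) -> zs L f <= B * N%:R.
Proof.
move=> B0 fB.
apply: (@le_trans _ _ (zs L (fun k => B * \sum_(0 <= i < N) (k == i%:Z)%:R))).
  apply: ler_zs => k _; apply: (le_trans (fB k)).
  have s0 : 0 <= \sum_(0 <= i < N) ((k == i%:Z)%:R : R) by apply: sumr_ge0.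
  case: ifP => [/andP[k0 kN]|_]; last exact: mulr_ge0.
  rewrite (bigD1_seq `|k|%N) ?iota_uniq//=; last by rewrite mem_index_iota; lia.
  rewrite (_ : (k == _)); last by lia.
  by rewrite ler_peMr// lerDl sumr_ge0.
rewrite zsMl ler_wpM2l// zs_exchange (@le_trans _ _ (\sum_(0 <= i < N) 1))//.
  apply: ler_sum => i _.
  rewrite (@zs_single _ L _ i%:Z); last by move=> k /negPf ->.
  by rewrite eqxx; case: ifP.
by rewrite sumr_const_nat subn0.
Qed.

Lemma zs_inv_sqr L : zs L (fun m => ((1 + `|m|)%:R : R) ^- 2) <= 4.
Proof.
have : zs L (fun m => ((1 + `|m|)%:R : R) ^- 2) <=
    2 * \sum_(0 <= k < L.+1) (k.+1%:R : R) ^- 2.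
  elim: L => [|L IH]; first by rewrite zs0E big_nat1 expr1n invr1; lra.
  rewrite zsS big_nat_recr//= mulrDr; apply: lerD => //.
  by rewrite add1n; move: (L.+2%:R ^- 2) => x; lra.
by have := sum_inv_sqr R L.+1; lra.
Qed.

End SupportSums.

Section Cutoff.
Variables (R : realType) (Q : nat) (H : {poly R[i]}) (Z : pred nat).
Variables (K : int -> R) (s0 : R).
Hypothesis Q_gt0 : (0 < Q)%N.
Hypothesis size_H : (2 * size H <= Q)%N.
Hypothesis K_0 : K 0 = 1.
Hypothesis K_01 : forall m, 0 <= K m <= 1.
Hypothesis K_carried : carried s0 K.
Hypothesis H_0 : H`_0 = 1.
Hypothesis H_le1 : forall n, nc H`_n <= 1.
Local Notation w := (rootu R Q).

Let ang l : R := 2 * pi * l%:R / Q%:R.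
(** Fourier coefficients of the measure with mass [F l / Q] at the angle [ang l]; they are
    [Q]-periodic in [m]. *)
Definition yhat (F : nat -> R[i]) (m : int) : R[i] :=
  Q%:R^-1 * \sum_(0 <= l < Q) F l * expi (- (m%:~R * ang l)).

Lemma yhat_poly m : yhat (fun l => H.[w ^+ l]) m = H`_(`|(m %% Q%:Z)%Z|).
Proof.
have QZ : Q%:Z != 0 by lia.
have mQ : (`|(m %% Q%:Z)%Z| < Q)%N.
  by have := modz_ge0 m QZ; have := ltz_pmod m (_ : 0 < Q%:Z); lia.
have szQ : (size H <= Q)%N by lia.
have := rootu_coef Q_gt0 szQ mQ; set m' := `|_|%N => e.
have Q0 : Q%:R != 0 :> R[i] by rewrite pnatr_eq0; lia.
rewrite /yhat; apply: (mulfI Q0); rewrite mulrA divff// mul1r -e.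
apply: eq_bigr => l _; congr (_ * _).
rewrite rootuX// -expi_natM -expiN.
have mE : m = (m %/ Q%:Z)%Z * Q%:Z + m'%:Z.
  by rewrite {1}(divz_eq m Q%:Z) /m' gez0_abs// modz_ge0.
rewrite {1}mE intrD intrM mulrDl opprD expiD.
have -> : - ((m %/ Q)%Z%:~R * Q%:~R * ang l) = (- ((m %/ Q)%Z * l%:Z))%:~R * (2 * pi) :> R.
  rewrite /ang mulrNz intrM; field.
  by rewrite pnatr_eq0; lia.
by rewrite expi_2piM mul1r.
Qed.

Let y l := if Z l then 0 else H.[w ^+ l].

(** [K m * yhat y m] is the transform of the masses [y l] smeared over intervals of half-width [s0].
    [cutA] is its analytic part read off from [H]; [cutR] collects the error of zeroing the values
    on [Z] and the periodic copies, damped by [K]. *)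
Definition cutA (m : int) : R[i] :=
  if 0 <= m < Q%:Z then (K m)%:C%C * H`_(`|m|) else 0.
Definition cutR (m : int) : R[i] := (K m)%:C%C * yhat y m - cutA m.

Lemma cutA_0 : cutA 0 = 1.
Proof. by rewrite /cutA (_ : 0 <= 0 < Q%:Z) ?K_0 ?H_0 ?mulr1//; lia. Qed.

Lemma cutA_le m : nc (cutA m) <= nc H`_(`|m|).
Proof.
rewrite /cutA; case: ifP => _; last by rewrite nc0 nc_ge0.
have /andP[k0 k1] := K_01 m.
by rewrite ncM nc_realC ger0_norm// ler_piMl ?nc_ge0.
Qed.

(** [L + 1] times the partial sum is the unnormalised Fejer sum plus the sum weighted by [|m|]. The
    first is bounded because [t] is far from every smeared mass, the second by the moment bounds, so
    the partial sums are [O(1 / L)]. *)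
Lemma cut_vanish (t eta B : R) : 0 < eta ->
  (forall l, (l < Q)%N -> ~~ Z l -> s0 + eta <= nc (expi t - w ^+ l)) ->
  (forall L, zs L (fun m => nc (cutR m) * `|m|%:R) <= B) ->
  forall e, 0 < e -> exists L0, forall L, (L0 <= L)%N ->
    nc (zs L (fun m => (cutA m + cutR m) * expi (m%:~R * t))) <= e.
Proof.
move=> eta0 sep hB e e0.
pose C1 : R := Q%:R^-1 * \sum_(0 <= l < Q) nc (y l) * (4 / eta ^+ 2).
pose C2 : R := Q%:R * Q%:R + B.
exists (Num.truncn ((C1 + C2) / e)) => L LL.
have P m : cutA m + cutR m = (K m)%:C%C * yhat y m by rewrite /cutR addrC subrK.
have LP : 0 < L.+1%:R :> R by rewrite ltr0n.
suff main : nc (zs L (fun m => (cutA m + cutR m) * expi (m%:~R * t))) * L.+1%:R <= C1 + C2.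
  have := main; rewrite -ler_pdivlMr// => /le_trans; apply.
  rewrite ler_pdivrMr// mulrC -ler_pdivrMr// ltW// (lt_le_trans (truncnS_gt _))//.
  by rewrite ler_nat ltnS.
have -> : nc (zs L (fun m => (cutA m + cutR m) * expi (m%:~R * t))) * L.+1%:R =
  nc (zs L (fun m => (L.+1%:R - `|m|%:R) * ((cutA m + cutR m) * expi (m%:~R * t))) +
      zs L (fun m => `|m|%:R * ((cutA m + cutR m) * expi (m%:~R * t)))).
  rewrite -nc_natr -ncM mulrC -zsMl -zsD; congr (nc _); apply: zs_ext => m.
  by rewrite -mulrDl subrK.
apply: (le_trans (ncD _ _)); apply: lerD.
  have -> : zs L (fun m => (L.+1%:R - `|m|%:R) * ((cutA m + cutR m) * expi (m%:~R * t))) =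
    Q%:R^-1 * \sum_(0 <= l < Q) y l *
      zs L (fun m => (L.+1%:R - `|m|%:R) * expi (m%:~R * (t - ang l)) * (K m)%:C%C).
    under [X in _ = _ * X]eq_bigr => l _ do rewrite -zsMl.
    rewrite -zs_exchange -zsMl; apply: zs_ext => m; rewrite P /yhat.
    rewrite !mulr_sumr mulr_suml mulr_sumr; apply: eq_bigr => l _.
    by rewrite mulrBr expiD; ring.
  rewrite ncM Normc.normcV nc_natr ler_wpM2l ?invr_ge0//.
  apply: (le_trans (nc_sum _ _ _)); rewrite big_nat [leRHS]big_nat.
  apply: ler_sum => l /andP[_ lQ]; rewrite ncM.
  have [yl|yl] := boolP (Z l); first by rewrite /y yl nc0 !mul0r.
  apply: ler_wpM2l; first exact: nc_ge0.
  apply: K_carried => x xs.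
  have -> : zs L (fun m => (L.+1%:R - `|m|%:R) * expi (m%:~R * (t - ang l)) * expi (m%:~R * x)) =
     zs L (fun m => (L.+1%:R - `|m|%:R) * expi (m%:~R * (t - ang l + x))).
    by apply: zs_ext => m; rewrite -mulrA -expiD -mulrDr.
  apply: fejer_bound => //.
  have h1 : nc (expi t - w ^+ l) <= nc (expi (t - ang l + x) - 1) + `|x|.
    have -> : nc (expi t - w ^+ l) = nc (expi (t - ang l) - 1).
      rewrite rootuX// -/(ang l) -[RHS]mul1r -(nc_expi (ang l)) -ncM mulrBr mulr1.
      by rewrite -expiD [ang l + _]addrC subrK.
    apply: (le_trans (nc_dist _ (expi (t - ang l + x)) _)); rewrite addrC lerD2l.
    by apply: (le_trans (expi_lip _ _)); rewrite opprD addrA subrr sub0r normrN.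
  by have := sep l lQ yl; lra.
apply: (@le_trans _ _ (zs L (fun m => nc (cutA m) * `|m|%:R) + zs L (fun m => nc (cutR m) * `|m|%:R))).
  rewrite -zsD (le_trans (nc_zs _ _))//; apply: ler_zs => m _.
  by rewrite !ncM nc_expi nc_natr mulr1 mulrC -mulrDl ler_wpM2r// ncD.
apply: lerD => //; apply: zs_indicator => // m.
case: ifP => mQ; last by rewrite /cutA mQ nc0 mul0r.
rewrite -[leRHS]mul1r ler_pM ?nc_ge0//; first exact: le_trans (cutA_le m) (H_le1 _).
by rewrite ler_nat; lia.
Qed.

Variable E0 : R.
Hypothesis E0_ge0 : 0 <= E0.
Hypothesis H_small : forall l, Z l -> nc H.[w ^+ l] <= E0.

Lemma yhatE m : exists2 err : R[i], nc err <= E0 &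
  yhat y m = H`_(`|(m %% Q%:Z)%Z|) - err.
Proof.
exists (yhat (fun l => if Z l then H.[w ^+ l] else 0) m).
  have Qp : 0 < Q%:R :> R by rewrite ltr0n.
  rewrite /yhat ncM Normc.normcV nc_natr mulrC ler_pdivrMr//.
  apply: (le_trans (nc_sum _ _ _)).
  apply: (@le_trans _ _ (\sum_(0 <= l < Q) E0)).
    apply: ler_sum => l _; rewrite ncM nc_expi mulr1.
    by case: ifP => [/H_small//|]; rewrite nc0.
  by rewrite sumr_const_nat subn0 mulr_natr.
rewrite -yhat_poly /yhat -mulrBr -sumrB; congr (_ * _); apply: eq_bigr => l _.
by rewrite -mulrBl /y; case: ifP; rewrite ?subrr ?subr0.
Qed.

(** For negative [m] with [2 * |m| < Q] the residue [m + Q] exceeds [Q / 2 >= size H], so the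
    periodic copy contributes 0 and only the zeroing error remains. *)
Lemma cutR_le m : nc (cutR m) <= K m * (E0 + (Q <= 2 * `|m|)%:R).
Proof.
have /andP[k0 k1] := K_01 m; have [err herr yE] := yhatE m.
have QZ : Q%:Z != 0 by lia.
rewrite /cutR yE /cutA; case: ifP => mQ.
  rewrite modz_small//.
  rewrite -mulrBr addrAC subrr sub0r ncM ncN nc_realC ger0_norm// ler_wpM2l//.
  by rewrite (le_trans herr)// lerDl.
rewrite subr0 ncM nc_realC ger0_norm// ler_wpM2l//.
apply: (le_trans (ncBD _ _)); rewrite addrC lerD//.
case: leqP => h; first exact: H_le1.
rewrite nth_default ?nc0//.
have m0 : m < 0 by lia.
have -> : (m %% Q%:Z)%Z = m + Q%:Z.
  by rewrite -[LHS](modzDr m Q%:Z) modz_small//; lia.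
by have := size_H; move: (size H) => sz; lia.
Qed.

Section Weights.
Variables (W : nat -> R) (d : nat) (del : R).
Hypothesis W_ge0 : forall n, 0 <= W n.
Hypothesis E0_le1 : E0 <= 1.
Hypothesis near_w : forall m, (m < Q)%N -> E0 * W (d * m)%N * Q%:R ^+ 2 <= del.
Hypothesis far_w : forall m, (Q <= 2 * `|m|)%N ->
  2 * K m * W (d * `|m|)%N * (1 + `|m|)%:R ^+ 2 <= del.

(** The weight is taken at [d * |m|] because the block is later dilated by [d = N_j]. The factor
    [(1 + |m|) ^ 2] in the hypotheses makes the terms summable. *)
Lemma cutR_weight L : zs L (fun m => nc (cutR m) * W (d * `|m|)%N) <= 4 * del.
Proof.
apply: (@le_trans _ _ (zs L (fun m => del * ((1 + `|m|)%:R : R) ^- 2))).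
  apply: ler_zs => m _; have /andP[k0 k1] := K_01 m.
  rewrite ler_pdivlMr ?exprn_gt0 ?ltr0n//.
  have W0 := W_ge0 (d * `|m|)%N.
  apply: (@le_trans _ _ (K m * (E0 + (Q <= 2 * `|m|)%:R) * W (d * `|m|)%N * (1 + `|m|)%:R ^+ 2)).
    by apply: ler_wpM2r; [exact: sqr_ge0|apply: ler_wpM2r => //; exact: cutR_le].
  case: leqP => h.
    apply: le_trans (far_w h).
    apply: ler_wpM2r; first exact: sqr_ge0.
    apply: ler_wpM2r => //; rewrite [2 * _]mulrC; apply: ler_wpM2l => //.
    by rewrite -[true%:R]/(1 : R); have := E0_le1; lra.
  rewrite addr0; apply: le_trans (near_w (_ : (`|m| < Q)%N)); last by lia.
  have hm : (1 + `|m|)%:R ^+ 2 <= Q%:R ^+ 2 :> R.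
    by rewrite lerXn2r ?nnegrE// ler_nat; lia.
  apply: ler_pM => //; rewrite ?mulr_ge0 ?exprn_ge0//.
  by apply: ler_wpM2r => //; rewrite ler_piMl.
by rewrite zsMl mulrC ler_wpM2r ?zs_inv_sqr//; apply: le_trans (near_w Q_gt0); rewrite !mulr_ge0 ?exprn_ge0.
Qed.

End Weights.

End Cutoff.

(** * One block *)

(** The budget behind the exponent 16, with [X = M]: the target takes 4 powers, [p ^ 2] and
    [8 * k * G] take 2 each, and the fourth power of the sup norm [M ^ 2] takes 8. *)
Lemma beta_small_aux (R : realType) (p X e k G : R) :
  0 < e -> 0 < X -> e * X ^+ 16 = 1 -> 0 < k -> 0 <= p <= X -> 0 <= G ->
  8 * k * G <= X ^+ 2 ->
  8 * (p ^+ 2 * G * e ^+ 2 * X ^+ 8) / (e / k) <= X ^- 4.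
Proof.
move=> e0 X0 eX k0 /andP[p0 pX] G0 hG.
rewrite ler_pdivrMr ?divr_gt0// ler_pdivlMl ?exprn_gt0//.
have p2 : p ^+ 2 <= X ^+ 2 by rewrite lerXn2r ?nnegrE ?(ltW X0).
have -> : X ^+ 4 * (8 * (p ^+ 2 * G * e ^+ 2 * X ^+ 8)) =
    (p ^+ 2 * (8 * k * G)) * (e ^+ 2 * X ^+ 12 / k).
  by field; rewrite gt_eqF.
apply: (@le_trans _ _ (X ^+ 2 * X ^+ 2 * (e ^+ 2 * X ^+ 12 / k))).
  apply: ler_wpM2r; first by rewrite divr_ge0 ?(ltW k0)// mulr_ge0 ?exprn_ge0 ?ltW.
  by apply: ler_pM => //; rewrite ?exprn_ge0// !mulr_ge0// ltW.
have -> : X ^+ 2 * X ^+ 2 * (e ^+ 2 * X ^+ 12 / k) = (e * X ^+ 16) * (e / k).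
  by ring.
by rewrite eX mul1r.
Qed.

(** Values are zeroed out to distance [e / 16] but an arc is counted only within [e / 32]. The
    margin [e / 32] pays for the kernel width [e / 64], for [eta = e / 128], and for the length of
    an arc, at most [8 / Q <= e / 128]. *)
Lemma arc_far (R : realType) (Q j j' k : nat) (e t : R) : (0 < Q)%N ->
  32 * 32 <= e * Q%:R ->
  e / 16 < nc (1 - rootu R Q ^+ (k + j')) -> nc (1 - rootu R Q ^+ (j + k)) <= e / 32 ->
  2 * pi * j%:R / Q%:R <= t -> t <= 2 * pi * j.+1%:R / Q%:R ->
  e / 64 + e / (8 * 16) <= nc (expi t - rootu R Q ^+ j').
Proof.
move=> Q_gt0 d_big hZ Ik t1 t2; set w := rootu R Q in hZ Ik *.
have Q_gt0R : 0 < Q%:R :> R by rewrite ltr0n.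
have dist : nc (w ^+ j - w ^+ j') >= e / 32.
  have : nc (1 - w ^+ (k + j')) <= nc (1 - w ^+ (j + k)) + nc (w ^+ j - w ^+ j').
    apply: (le_trans (nc_dist _ (w ^+ (j + k)) _)); rewrite lerD2l.
    rewrite [(j + k)%N]addnC !exprD -mulrBr ncM nc_rootuX ?mul1r//.
  by lra.
have near_t : nc (w ^+ j - expi t) <= e / (8 * 16).
  rewrite rootuX//; apply: (le_trans (expi_lip _ _)).
  have p0 := pi_gt0 R; have p4 : pi < 4 :> R by have := pihalf_lt2 R; lra.
  rewrite distrC ger0_norm; last by rewrite subr_ge0.
  apply: (@le_trans _ _ (8 / Q%:R)).
    have : 2 * pi * j.+1%:R / Q%:R = 2 * pi * j%:R / Q%:R + 2 * pi / Q%:R :> R.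
      by rewrite -[j.+1%:R]natr1; ring.
    have : 2 * pi / Q%:R <= 8 / Q%:R :> R by rewrite ler_pM2r ?invr_gt0//; lra.
    by lra.
  by rewrite ler_pdivrMr// mulrAC; lra.
have : nc (w ^+ j - w ^+ j') <= nc (w ^+ j - expi t) + nc (expi t - w ^+ j').
  exact: nc_dist.
by lra.
Qed.

Section Block.
Variables (R : realType) (W : nat -> R) (M p d Q : nat) (l e : R).
Hypothesis Md : (16 * (16 * M) <= d)%N.
Hypothesis dQ4 : (2 * (d * d * d * d) + 2 <= Q)%N.
Hypothesis dQ : (d <= Q)%N.
Hypothesis M16 : (16 <= M)%N.
Hypothesis p_gt0 : (0 < p)%N.
Hypothesis p_leM : (p <= M)%N.

Let d16 : (16 <= d)%N. Proof. by clear dQ4; lia. Qed.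
Let d_pos : (0 < d)%N. Proof. by have := d16; clear; lia. Qed.
Let Q_gt0 : (0 < Q)%N. Proof. by apply: leq_trans dQ. Qed.
Let p2d : (2 * p <= d)%N. Proof. by clear dQ4; lia. Qed.
Let Mled : (M <= d)%N. Proof. by clear dQ4; lia. Qed.
Let M_pos : (0 < M)%N. Proof. by clear dQ4; lia. Qed.

Let size_bound_of V : (V * p <= d * M)%N -> (2 * (V * (p * d ^ 2)).+1 <= Q)%N.
Proof.
move=> VpM; have h1 : (V * (p * d ^ 2) <= d * d * d * d)%N.
  rewrite mulnA -[(d * d * d * d)%N]mulnA; apply: leq_mul => //.
  by apply: leq_trans VpM _; rewrite leq_mul2l Mled orbT.
apply: leq_trans dQ4; move: (V * _)%N (d * d * d * d)%N h1 => v D; clear.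
by lia.
Qed.

Let size_bound2 : (2 * (p * d ^ 2) < Q)%N.
Proof.
have h1 : (p * d ^ 2 <= d * d * d * d)%N.
  rewrite -[(d * d * d * d)%N]mulnA; apply: leq_mul => //.
  by apply: (leq_trans p_leM); apply: (leq_trans Mled); rewrite leq_pmull.
apply: leq_trans dQ4; move: (p * _)%N (d * d * d * d)%N h1 => v D; clear.
by lia.
Qed.

Let pdQ : (p * d ^ 2 < Q)%N.
Proof. by apply: leq_ltn_trans size_bound2; rewrite leq_pmull. Qed.

Hypothesis lE : l = ln M%:R.
Hypothesis eE : e = d%:R^-1.
Hypothesis eM16 : e * M%:R ^+ 16 = 1.
Hypothesis d_big : 32 * 32 <= e * Q%:R.
Hypothesis l_lep : l <= p%:R.
Variable lam : R.
Hypothesis lam_ge : 10 + 8 * ln Q%:R <= lam.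
Hypothesis M_large : 8 * (16 * 16) * (24 * lam ^+ 2 + 12 * 16) <= M%:R ^+ 2.
Hypothesis W_ge1 : forall n, 1 <= W n.
Hypothesis W_sqr : forall n, n%:R ^+ 2 <= W n.
Hypothesis near_w : forall m, (m < Q)%N ->
  8^-1 ^+ p * M%:R ^+ 2 * W (d * m)%N * Q%:R ^+ 2 <= (4 * M%:R)^-1.
Hypothesis far_w : forall n, (Q <= 2 * n)%N -> exists2 k : nat,
  32 * k%:R ^+ 2 <= e / 64 * n%:R &
  2 * expR (- (2 * k%:R)) * W (d * n)%N * (1 + n)%:R ^+ 2 <= (4 * M%:R)^-1.

Let s : R := (1 + 2 * e) ^+ p.
Local Notation w := (rootu R Q).
Local Notation h := (notchX d e p).

Let M_gt0 : 0 < M%:R :> R. Proof. by rewrite ltr0n. Qed.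
Let M_ge16 : 16 <= M%:R :> R. Proof. by rewrite ler_nat. Qed.
Let d_gt0 : 0 < d%:R :> R. Proof. by rewrite ltr0n. Qed.
Let e_gt0 : 0 < e. Proof. by rewrite eE invr_gt0. Qed.
Let e_le : e <= 16^-1. Proof. by rewrite eE lef_pV2 ?posrE// ler_nat. Qed.
Let Q_gt0R : 0 < Q%:R :> R. Proof. by rewrite ltr0n. Qed.

Let l_ge1 : 1 <= l.
Proof.
rewrite -ler_expR lE lnK ?posrE//; have := expR1_le4 R; have := M_ge16; lra.
Qed.
Let l_leM : l <= M%:R. Proof. by rewrite lE ltW// ln_sublinear. Qed.
Let pR : 0 < p%:R :> R. Proof. by rewrite ltr0n. Qed.
Let pMR : p%:R <= M%:R :> R. Proof. by rewrite ler_nat. Qed.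
(** As many rotations as the sup norm [M ^ 2] allows: [s ^ V <= exp (2 * e * p * V) <= exp (2 *
    l)]. *)
Let V := Num.truncn (d%:R * l / p%:R).

Let V_le : V%:R * p%:R <= d%:R * l.
Proof.
rewrite -ler_pdivlMr// truncn_le divr_ge0 ?mulr_ge0//.
by apply: le_trans l_ge1.
Qed.

Let V_ge : d%:R * l <= 2 * (V%:R * p%:R).
Proof.
have : d%:R * l / p%:R < V.+1%:R by rewrite truncnS_gt.
rewrite ltr_pdivrMr// -natr1 mulrDl mul1r => h1.
have h2 : 2 * p%:R <= d%:R * l.
  apply: (@le_trans _ _ d%:R); last by rewrite ler_peMr// ltW.
  by rewrite -natrM ler_nat.
lra.
Qed.

Let VpM : (V * p <= d * M)%N.
Proof.
rewrite -(ler_nat R) !natrM; apply: (le_trans V_le).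
by apply: ler_wpM2l.
Qed.

Let size_bound : (2 * (V * (p * d ^ 2)).+1 <= Q)%N.
Proof. exact: size_bound_of. Qed.

Let s_ge1 : 1 <= s.
Proof. by rewrite exprn_ege1//; have := e_gt0; lra. Qed.

Let exp_bound n : (1 + 2 * e) ^+ n <= expR (2 * e * n%:R).
Proof.
rewrite expRM_natr lerXn2r ?nnegrE ?expR_ge0 ?expR_ge1Dx//.
by have := e_gt0; lra.
Qed.

Let sV : s ^+ V <= M%:R ^+ 2.
Proof.
rewrite /s -exprM; apply: (le_trans (exp_bound _)).
have -> : M%:R ^+ 2 = expR (2 * l) by rewrite expRM_natl lE lnK.
rewrite ler_expR -mulrA ler_pM2l// eE ler_pdivrMl// natrM mulrC.
exact: V_le.
Qed.

Let pe_small : 4 * (p%:R * e) <= 2^-1.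
Proof.
have : p%:R * e <= M%:R * e by rewrite ler_pM2r.
have : M%:R * e <= (16 * 16)^-1.
  rewrite eE ler_pdivrMr// ler_pdivlMl//.
  by have := Md; rewrite -(ler_nat R) !natrM; lra.
by lra.
Qed.

Let s_bounds : s <= 2 /\ s ^+ 2 - 1 <= 8 * (p%:R * e).
Proof.
have expb (x : R) : 0 <= x <= 2^-1 -> expR x <= 1 + 2 * x.
  move=> /andP[x0 x1]; have := expR_ge1Dx (- x); rewrite expRN => h1.
  have h2 := expR_gt0 x.
  have : expR x * (1 - x) <= 1.
    by rewrite -[leRHS](mulfV (lt0r_neq0 h2)) ler_pM2l.
  by nra.
have pe0 : 0 < p%:R * e by rewrite mulr_gt0.
have h := pe_small.
split.
  apply: (le_trans (exp_bound p)).
  have -> : 2 * e * p%:R = 2 * (p%:R * e) by ring.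
  by apply: (le_trans (expb _ _)); lra.
rewrite /s -exprM; have := exp_bound (p * 2).
have -> : 2 * e * (p * 2)%:R = 4 * (p%:R * e) by rewrite natrM; ring.
have := expb (4 * (p%:R * e)); have -> : 0 <= 4 * (p%:R * e) <= 2^-1 by lra.
by move=> /(_ isT); lra.
Qed.

Let I : pred nat := fun k => nc (1 - w ^+ k) <= e / 32.

(** It is enough to count one side: for [k <= e * Q / 256] the distance to 1 is at most
    [2 * pi * k / Q <= 8 * k / Q <= e / 32]. *)
Let I_card : e / (16 * 16) * Q%:R <= \sum_(0 <= k < Q) (I k)%:R.
Proof.
pose K := (Num.truncn (e / (16 * 16) * Q%:R)).+1.
have eQ0 : 0 <= e / (16 * 16) * Q%:R by rewrite !mulr_ge0 ?ltW// e_gt0.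
have KQ : (K <= Q)%N.
  rewrite /K -(ltr_nat R); apply: (@le_lt_trans _ _ (e / (16 * 16) * Q%:R)).
    by rewrite truncn_le.
  by rewrite -[ltRHS]mul1r ltr_pM2r//; have := e_le; lra.
apply: (@le_trans _ _ K%:R); first by rewrite ltW// truncnS_gt.
rewrite (@big_cat_nat _ _ _ K)//= -[leLHS]addr0 lerD//; last by apply: sumr_ge0.
have -> : K%:R = \sum_(0 <= k < K) 1 :> R by rewrite sumr_const_nat subn0.
apply: ler_sum_nat => k /andP[_ kK].
have -> // : I k.
rewrite /I ncB rootuX//; apply: (le_trans (_ : _ <= `|2 * pi * k%:R / Q%:R - 0|)).
  by rewrite -[X in _ - X](expi0 R) expi_lip.
have p0 := pi_gt0 R; have p4 : pi < 4 :> R by have := pihalf_lt2 R; lra.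
rewrite subr0 ger0_norm; last by rewrite !mulr_ge0 ?invr_ge0// ltW.
rewrite ler_pdivrMr//.
have kR : k%:R <= e / (16 * 16) * Q%:R.
  by rewrite (le_trans (_ : _ <= (Num.truncn (e / (16 * 16) * Q%:R))%:R)) ?ler_nat// truncn_le.
have k0 : 0 <= k%:R :> R by [].
move: (k%:R) (Q%:R) kR k0 => x y kR k0.
apply: (@le_trans _ _ (8 * x)); first by nra.
by lra.
Qed.

Let mu : R := 2 * p%:R * lam * e.
Let eta : R := 8 * (p%:R * e).

Let h_mu m : (0 < m)%N -> nc h`_m <= mu.
Proof.
move=> m0; have [s2 _] := s_bounds.
apply: (le_trans (notchX_mu eE d_gt0 e_gt0 e_le dQ pdQ m0)).
rewrite /mu -/s.
have lnQ0 : 0 <= ln Q%:R :> R by rewrite ln_ge0// ler1n.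
have G0 : 0 <= (10 + 8 * ln Q%:R) * e by rewrite mulr_ge0 ?(ltW e_gt0)//; lra.
rewrite (_ : 2 * p%:R * lam * e = p%:R * 2 * (lam * e)); last by ring.
apply: ler_pM => //; first by rewrite mulr_ge0// (le_trans ler01 s_ge1).
  by rewrite ler_pM2l.
by rewrite ler_wpM2r ?(ltW e_gt0).
Qed.

Let h_eta : \sum_(1 <= m < Q) nc h`_m ^+ 2 <= eta.
Proof.
apply: (le_trans (notchX_eta eE d_gt0 e_gt0 e_le dQ pdQ)).
exact: s_bounds.2.
Qed.

Let h_sup k : nc h.[w ^+ k] <= s.
Proof.
by apply: (nc_notchX eE d_gt0 e_gt0 e_le); exact: nc_rootuX.
Qed.

Let h_0 : h`_0 = 1. Proof. exact: notchX_0. Qed.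

Let beta : R := (6 * mu ^+ 2 + 3 * eta ^+ 2) * (M%:R ^+ 2) ^+ 4.

Let beta_gt0 : 0 < beta.
Proof.
rewrite mulr_gt0 ?exprn_gt0//; apply: ltr_wpDl.
  by rewrite mulr_ge0// sqr_ge0.
by rewrite mulr_gt0// exprn_gt0// /eta !mulr_gt0.
Qed.

Let beta_small : 8 * beta / (e / (16 * 16)) <= M%:R ^- 4.
Proof.
have -> : beta = p%:R ^+ 2 * (24 * lam ^+ 2 + 12 * 16) * e ^+ 2 * M%:R ^+ 8.
  by rewrite /beta /mu /eta; ring.
apply: beta_small_aux => //; first by rewrite ler0n pMR.
by rewrite addr_ge0// mulr_ge0// sqr_ge0.
Qed.

Lemma rprod_small ks k n b : 0 <= b -> k \in ks -> nc h.[w ^+ (k + n)] <= b ->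
  nc (rprod Q h ks).[w ^+ n] <= b * s ^+ size ks.
Proof.
move=> b0 + hb; rewrite /rprod; elim: ks => // k' ks IH.
rewrite inE big_cons hornerM ncM => /predU1P[<-|kks].
  apply: ler_pM; rewrite ?nc_ge0//; first by rewrite rotp_horner -exprD.
  apply: (le_trans (rprod_sup h_sup ks n)).
  by rewrite /= exprS ler_peMl// exprn_ge0// (le_trans ler01 s_ge1).
rewrite mulrC /= exprSr mulrA; apply: ler_pM; rewrite ?nc_ge0//; first exact: IH.
by rewrite rotp_horner -exprD.
Qed.

Theorem block : exists (A Rm : int -> R[i]) (U : pred nat),
  [/\ (forall m, A m != 0 -> 0 <= m < Q%:Z), A 0 = 1,
      (forall m, m != 0 -> nc (A m) <= M%:R^-1),
      (forall L, zs L (fun m => nc (Rm m) * W (d * `|m|)%N) <= M%:R^-1) &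
      \sum_(0 <= j < Q) (~~ U j)%:R <= (1 - l / (8 * (16 * 16) * p%:R)) * Q%:R /\
      forall j (t : R), U j -> 2 * pi * j%:R / Q%:R <= t <= 2 * pi * j.+1%:R / Q%:R ->
      forall c, 0 < c -> exists L0, forall L, (L0 <= L)%N ->
        nc (zs L (fun m => (A m + Rm m) * expi (m%:~R * t))) <= c].
Proof.
have e0 := e_gt0; have S0 : 0 <= M%:R ^+ 2 :> R by rewrite exprn_ge0.
pose iota : R := e / (16 * 16); have i0 : 0 < iota by rewrite divr_gt0.
(* With this weight the total cost [V * a * beta] of the fourth powers is [x / 4], a quarter of the
   gain [x = iota * V] in covering. *)
pose a := iota / (4 * beta).
have a0 : 0 < a by rewrite divr_gt0// mulr_gt0.
have szh : (size h <= (p * d ^ 2).+1)%N by exact: size_notchX.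
have VQ : (V * (p * d ^ 2) < Q)%N by apply: leq_trans size_bound; rewrite leq_pmull.
have [ks szks hks] := greedy Q_gt0 szh size_bound2 h_0 s_ge1 h_sup h_mu h_eta I_card
  VQ sV (ltW a0) (ltW i0).
rewrite -/beta in hks.
set H := rprod Q h ks.
have ab : a * beta = iota / 4 by rewrite /a; field; rewrite gt_eqF.
rewrite ab in hks.
pose x := iota * V%:R.
have x0 : 0 <= x by rewrite mulr_ge0// ltW.
have xle : x <= 1.
  have h1 : V%:R <= d%:R :> R.
    rewrite -(ler_pM2r pR); apply: (le_trans V_le); rewrite ler_pM2l//.
  have : e * V%:R <= 1 by rewrite eE ler_pdivrMl// mulr1.
  by rewrite /x /iota mulrAC; lra.
have xge : l / (8 * (16 * 16) * p%:R) <= x / 4.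
  rewrite ler_pdivrMr ?mulr_gt0// /x /iota.
  have : l <= 2 * (e * V%:R * p%:R).
    have -> : l = e * (d%:R * l) by rewrite eE mulKf ?gt_eqF.
    have -> : 2 * (e * V%:R * p%:R) = e * (2 * (V%:R * p%:R)) by ring.
    by apply: ler_wpM2l (ltW e0) _ _ V_ge.
  by rewrite (_ : e / (16 * 16) * V%:R / 4 * (8 * (16 * 16) * p%:R) = 2 * (e * V%:R * p%:R))//; field.
pose c := uncovered R Q I ks / Q%:R.
have c0 : 0 <= c by rewrite divr_ge0// sumr_ge0.
have F0 : 0 <= quartic Q h ks by apply: sumr_ge0 => n _; rewrite exprn_ge0 ?nc_ge0.
have hks' : a * quartic Q h ks + (1 + x) * c <= 1 + x / 4.
  by apply: le_trans hks _; rewrite /x [_ * V%:R]mulrC mulrA.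
have Fle : quartic Q h ks <= M%:R ^- 4.
  apply: le_trans beta_small; rewrite -/iota ler_pdivlMr//.
  have h1 : a * quartic Q h ks <= 2 by nra.
  have : a * quartic Q h ks * (4 * beta) <= 2 * (4 * beta).
    by rewrite ler_pM2r// mulr_gt0.
  have -> : a * quartic Q h ks * (4 * beta) = quartic Q h ks * iota.
    by rewrite /a; field; rewrite gt_eqF.
  by lra.
(* Uses [(1 - x / 4) * (1 + x) >= 1 + x / 4] for [0 <= x <= 1]. *)
have cle : c <= 1 - x / 4 by nra.
have szH : (size H <= (V * (p * d ^ 2)).+1)%N by rewrite -szks; apply: size_rprod.
have szH2 : (2 * size H <= Q)%N.
  by apply: leq_trans size_bound; rewrite leq_mul2l szH.
have H0 : H`_0 = 1 by apply: rprod_0.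
have Hn n : (0 < n)%N -> nc H`_n <= M%:R^-1.
  move=> n0; have [nQ|nQ] := ltnP n Q; last first.
    rewrite nth_default ?nc0 ?invr_ge0 ?ltW//.
    by apply: leq_trans nQ; apply: leq_trans szH VQ.
  rewrite -(@ler_pXn2r _ 4) ?nnegrE ?nc_ge0 ?invr_ge0 ?(ltW M_gt0)// exprVn.
  apply: le_trans Fle; rewrite /quartic.
  rewrite (bigD1_seq n) ?iota_uniq ?mem_index_iota ?n0//=.
  by rewrite lerDl sumr_ge0// => i _; rewrite exprn_ge0 ?nc_ge0.
have M1 : M%:R^-1 <= 1 :> R by rewrite invf_le1//; have := M_ge16; lra.
have H1 n : nc H`_n <= 1.
  case: n => [|n]; first by rewrite H0 nc1.
  exact: le_trans (Hn _ _) M1.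
have s0p : 0 < e / 64 by rewrite divr_gt0.
have [K [K0 K01 Kc Kd]] := smooth_kernel s0p.
pose Z : pred nat := fun n => has (fun k => nc (1 - w ^+ (k + n)) <= e / 16) ks.
pose E0 : R := 8^-1 ^+ p * M%:R ^+ 2.
have E00 : 0 <= E0 by rewrite mulr_ge0// exprn_ge0.
have Hsm n : Z n -> nc H.[w ^+ n] <= E0.
  move=> /hasP[k kks hk]; rewrite /E0.
  apply: (le_trans (rprod_small (b := 8^-1 ^+ p) _ kks _)).
  - by rewrite exprn_ge0.
  - apply: (nc_notchX_small eE d_gt0 e_gt0 e_le) => //.
    exact: nc_rootuX.
  by rewrite ler_wpM2l ?exprn_ge0// szks sV.
have Q1 : 1 <= Q%:R :> R by rewrite ler1n.
have E01 : E0 <= 1.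
  have h1 := near_w Q_gt0; rewrite -/E0 in h1.
  have h2 : (4 * M%:R)^-1 <= 1 :> R by rewrite invf_le1 ?mulr_gt0//; have := M_ge16; lra.
  apply: le_trans (le_trans h1 h2); rewrite -mulrA ler_peMr//.
  by rewrite -[leLHS]mulr1 ler_pM// exprn_ege1.
have W0 n : 0 <= W n by apply: le_trans (W_ge1 n).
have far m : (Q <= 2 * `|m|)%N ->
    2 * K m * W (d * `|m|)%N * (1 + `|m|)%:R ^+ 2 <= (4 * M%:R)^-1.
  move=> hm; have [k k1 k2] := far_w hm; apply: le_trans k2.
  apply: ler_wpM2r; first exact: sqr_ge0.
  by apply: ler_wpM2r => //; rewrite ler_pM2l// Kd.
pose A := cutA Q H K; pose Rm := cutR Q H Z K.
have Rw L : zs L (fun m => nc (Rm m) * W (d * `|m|)%N) <= M%:R^-1.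
  have := cutR_weight Q_gt0 szH2 K01 H1 E00 Hsm W0 E01 near_w far L.
  by rewrite invfM mulrA mulfV ?mul1r.
exists A, Rm, (fun n => has (fun k => I ((n + k) %% Q)%N) ks); split.
- by move=> m; rewrite /A /cutA; case: ifP => //; rewrite eqxx.
- by apply: cutA_0.
- move=> m m0; apply: le_trans (cutA_le _ _ K01 _) _; apply: Hn.
  by rewrite lt0n absz_eq0.
- exact: Rw.
split.
  have -> : \sum_(0 <= j < Q) (~~ has (fun k => I ((j + k) %% Q)%N) ks)%:R = uncovered R Q I ks.
    by apply: eq_bigr => j _; rewrite -all_predC.
  have -> : uncovered R Q I ks = c * Q%:R by rewrite /c divfK ?gt_eqF.
  by rewrite ler_pM2r//; lra.
move=> j t /hasP[k kks]; rewrite /I rootu_mod// => Ik /andP[t1 t2].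
apply: (@cut_vanish _ _ _ _ _ (e / 64) Q_gt0 szH2 K01 Kc H1 t (e / (8 * 16)) M%:R^-1).
- by rewrite divr_gt0.
- move=> j' j'Q /hasPn/(_ _ kks); rewrite -ltNge => hZ.
  exact: (arc_far Q_gt0 d_big hZ Ik t1 t2).
move=> L; apply: le_trans (Rw L); apply: ler_zs => m _; rewrite ler_wpM2l ?nc_ge0//.
apply: le_trans (W_sqr _); rewrite -natrX ler_nat.
have [->|m0] := eqVneq `|m|%N 0%N; first by [].
apply: (@leq_trans (d * `|m|)); first by rewrite leq_pmull.
have dm : (0 < d * `|m|)%N by rewrite muln_gt0 -(ltr0n R) d_gt0 lt0n.
by move: dm; clear; nia.
Qed.

End Block.

(** * The weight *)

Section ConcavePositive.
Variables (R : realType) (g : R -> R).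
Hypothesis g_gt0 : forall t, 0 < t -> 0 < g t.
Hypothesis g_concave : concave_on_pos g.

Lemma concave_between x y z : 0 < x -> x <= y -> y <= z -> x < z ->
  (z - y) * g x + (y - x) * g z <= (z - x) * g y.
Proof.
move=> x0 xy yz xz; have zx0 : 0 < z - x by lra.
have z0 : 0 < z by lra.
have l01 : 0 <= (z - y) / (z - x) <= 1.
  rewrite ler_pdivrMr// mul1r; apply/andP; split; last by lra.
  by rewrite divr_ge0//; lra.
have := g_concave x0 z0 l01.
have -> : 1 - (z - y) / (z - x) = (y - x) / (z - x) by field; rewrite gt_eqF.
have -> : (z - y) / (z - x) * x + (y - x) / (z - x) * z = y by field; rewrite gt_eqF.
move=> h; have := ler_wpM2l (ltW zx0) h; congr (_ <= _).
by field; rewrite gt_eqF.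
Qed.

Lemma concave_pos_nondecreasing x y : 0 < x -> x <= y -> g x <= g y.
Proof.
move=> x0 xy; have y0 : 0 < y by lra.
rewrite leNgt; apply/negP => h.
have D0 : 0 < g x - g y by lra.
have gx := g_gt0 x0; have gy := g_gt0 y0.
(* A point beyond the zero of the decreasing chord through [x] and [y]; by concavity [g z] would be
   negative. *)
pose z := y + 1 + y * g x / (g x - g y).
have zy : y + 1 <= z by rewrite /z lerDl divr_ge0// ?mulr_ge0 ?ltW.
have z0 : 0 < z by lra.
have yz : y <= z by lra.
have xz : x < z by lra.
have h1 := concave_between x0 xy yz xz.
have h2 : 0 <= (y - x) * g z by rewrite mulr_ge0 ?subr_ge0// ltW// g_gt0.
have h3 : (z - y - 1) * (g x - g y) = y * g x.
  by rewrite /z; field; rewrite gt_eqF.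
have h4 : 0 <= y * g y by rewrite mulr_ge0 ?ltW.
have h5 : 0 <= x * g y by rewrite mulr_ge0 ?ltW.
by nra.
Qed.

(** Concavity with the third point at 0 would give this at once, but [g] is controlled only on
    positive reals; an explicit small [u > 0] replaces 0, and the loss [u * (g y - g x)] is at most
    half of the supposed defect [D]. *)
Lemma concave_pos_div x y : 0 < x -> x <= y -> x * g y <= y * g x.
Proof.
move=> x0 xy; have y0 : 0 < y by lra.
rewrite leNgt; apply/negP => h.
have gx := g_gt0 x0; have gy := g_gt0 y0.
have mono := concave_pos_nondecreasing x0 xy.
have xlty : x < y.
  by rewrite lt_neqAle xy andbT; apply/eqP => E; move: h; rewrite E ltxx.
pose D := x * g y - y * g x; have D0 : 0 < D by rewrite /D; lra.
have Dx0 : 0 < D / x by rewrite divr_gt0.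
have DG0 : 0 < 2 * (g y - g x + D / x) by lra.
pose u := D / (2 * (g y - g x + D / x)).
have u0 : 0 < u by rewrite divr_gt0.
have ux : 2 * u <= x.
  rewrite /u mulrA ler_pdivrMr//.
  have : x * (D / x) = D by field; rewrite gt_eqF.
  have : 0 <= x * (g y - g x) by apply: mulr_ge0; lra.
  by lra.
have uG : 2 * (u * (g y - g x)) <= D.
  have e1 : 2 * (u * (g y - g x + D / x)) = D by rewrite /u; field; rewrite !gt_eqF//; nra.
  have e2 : 0 <= u * (D / x) by rewrite mulr_ge0 ?ltW// divr_gt0.
  by rewrite -[leRHS]e1 mulrDr; lra.
have ux' : u <= x by lra.
have uy : u < y by lra.
have h1 := concave_between u0 ux' xy uy.
have h2 : 0 <= (y - x) * g u by rewrite mulr_ge0 ?subr_ge0// ltW// g_gt0.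
by rewrite /D in uG D0; nra.
Qed.

End ConcavePositive.

Section Weight.
Variables (R : realType) (f : R -> R).
Hypothesis f_ge3 : forall t, 0 < t -> 3 <= f t.
Hypothesis f_mono : forall x y, 0 < x -> x <= y -> f x <= f y.
Hypothesis f_slow : forall x y, 0 < x -> x <= y -> x * f y <= y * f x.

Definition omf (t : R) := t * f t.
(** The shift 64 exceeds [e ^ 3], so the logarithm is at least 3, as [omf_incr] requires. *)
Definition weight (n : nat) : R := expR (omf (ln (64 + n)%:R)).

Lemma omf_mono x y : 0 < x -> x <= y -> omf x <= omf y.
Proof.
move=> x0 xy; apply: ler_pM => //; [exact: ltW| |exact: f_mono].
by have := f_ge3 x0; lra.
Qed.

Lemma omf_ge3 t : 0 < t -> 3 * t <= omf t.
Proof. by move=> t0; rewrite /omf mulrC ler_pM2l// f_ge3. Qed.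

Lemma omf_scale c t : 1 <= c -> 0 < t -> omf (c * t) <= c ^+ 2 * omf t.
Proof.
move=> c1 t0; have h := @f_slow t (c * t) t0.
have tc : t <= c * t by rewrite ler_peMl// ltW.
have h1 := h tc; rewrite /omf.
have : c * (t * f (c * t)) <= c * (c * t * f t) by rewrite ler_wpM2l//; lra.
by lra.
Qed.

Lemma omf_quad t : 1 <= t -> omf t <= f 1 * t ^+ 2.
Proof.
by move=> t1; have := @omf_scale t 1 t1 ltr01; rewrite mulr1 {2}/omf mul1r mulrC.
Qed.

Lemma ln64_ge3 (n : nat) : 3 <= ln (64 + n)%:R :> R.
Proof.
rewrite -[leLHS]expRK ler_ln ?posrE ?expR_gt0 ?ltr0n//.
apply: (@le_trans _ _ 64%:R); last by rewrite ler_nat leq_addr.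
have -> : 3 = 3%:R * 1 :> R by rewrite mulr1.
rewrite expRM_natl; apply: (@le_trans _ _ (4 ^+ 3)); last by lra.
by rewrite lerXn2r ?nnegrE ?expR_ge0// expR1_le4.
Qed.

Let ln64_gt0 (n : nat) : 0 < ln (64 + n)%:R :> R.
Proof. by have := ln64_ge3 n; lra. Qed.

Lemma weight_mono m n : (m <= n)%N -> weight m <= weight n.
Proof.
move=> mn; rewrite ler_expR omf_mono// ler_ln ?posrE ?ltr0n//.
by rewrite ler_nat leq_add2l.
Qed.

Lemma weight_ge1 n : 1 <= weight n.
Proof.
rewrite -expR0 ler_expR; have := omf_ge3 (ln64_gt0 n); have := ln64_gt0 n; lra.
Qed.

Lemma weight_sqr n : n%:R ^+ 2 <= weight n.
Proof.
apply: (@le_trans _ _ ((64 + n)%:R ^+ 2)).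
  by rewrite lerXn2r ?nnegrE// ler_nat leq_addl.
rewrite -[leLHS]lnK ?posrE ?exprn_gt0// ?ltr0n// ler_expR lnXn ?ltr0n//.
have := omf_ge3 (ln64_gt0 n); have := ln64_gt0 n.
by rewrite mulr2n; lra.
Qed.

(** To be read with [X = 64 + m], [Y = 64 + n], [y = n], and [s'], [s], [t] the logarithms of
    [X + y], [X], [Y]. Slow growth of [f] bounds the increment of [omf] by [3 * (s' - s) * f s],
    where [s' - s <= y / X] and [f s <= (s / t) * f t]; then [s / X <= t / Y] and [3 <= t] bring it
    below [t * f t]. *)
Lemma omf_incr (X Y y s' s t : R) : 0 < X -> 0 <= y -> y <= Y -> Y <= X ->
  3 <= t -> t <= s -> s <= s' ->
  X * (s' - s) <= y -> Y * (s - t) <= X - Y -> omf s' <= omf s + omf t.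
Proof.
move=> X0 y0 yY YX t3 ts ss' incr incr2; have s3 : 3 <= s by lra.
have yX : y <= X by lra.
have s0 : 0 < s by lra.
have t0 : 0 < t by lra.
have eta1 : s' - s <= 1 by rewrite -(ler_pM2l X0); lra.
have fs3 := f_ge3 s0; have ft3 := f_ge3 t0.
have h1 : omf s' - omf s <= 3 * (s' - s) * f s.
  rewrite -(ler_pM2l s0).
  have a1 : s * omf s' <= s' ^+ 2 * f s.
    rewrite /omf; have := ler_wpM2l (le_trans (ltW s0) ss') (f_slow s0 ss').
    by lra.
  have a2 : (s' - s) * (s' + s) * f s <= (s' - s) * (3 * s) * f s.
    rewrite ler_wpM2r//; first by lra.
    by rewrite ler_wpM2l//; lra.
  by rewrite /omf in a1 *; lra.
have h2 := f_slow t0 ts.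
have h3 : s * Y <= t * X.
  have : 0 <= (t - 1) * (X - Y) by rewrite mulr_ge0//; lra.
  by lra.
suff : 3 * (s' - s) * f s <= omf t by lra.
rewrite -(ler_pM2l X0) -(ler_pM2l t0).
have b1 : (X * (s' - s)) * (t * f s) <= y * (s * f t).
  apply: ler_pM => //.
    by rewrite mulr_ge0//; lra.
  by rewrite mulr_ge0//; lra.
have b2 : y * s * f t <= t * X * f t.
  rewrite ler_wpM2r//; first by lra.
  by apply: le_trans h3; rewrite mulrC ler_pM2l.
have b3 : 3 * (t * X * f t) <= t * (t * X * f t).
  by rewrite ler_wpM2r// !mulr_ge0//; lra.
by rewrite /omf; lra.
Qed.

Lemma weight_submul_le m n : (n <= m)%N -> weight (m + n) <= weight m * weight n.
Proof.
move=> nm; rewrite -expRD ler_expR.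
pose x : R := m%:R; pose y : R := n%:R; pose b : R := 64.
have y0 : 0 <= y by rewrite /y.
have yx : y <= x by rewrite /x /y ler_nat.
have -> : (64 + m)%:R = b + x :> R by rewrite natrD.
rewrite !natrD -/x -/y -/b.
have s3 : 3 <= ln (b + x) by have := ln64_ge3 m; rewrite natrD.
have t3 : 3 <= ln (b + y) by have := ln64_ge3 n; rewrite natrD.
have b0 : 0 < b + x by rewrite /b; lra.
have by0 : 0 < b + y by rewrite /b; lra.
have lnle (u v : R) : 0 < u -> 0 < v -> v * (ln v - ln u) <= v * (v / u - 1).
  move=> u0 v0; rewrite ler_pM2l// -ln_div ?posrE//.
  rewrite -{1}[v / u](subrK 1) addrC; apply: le_ln1Dx.
  have vu0 : 0 < v / u by rewrite divr_gt0.
  by lra.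
have incr : (b + x) * (ln (b + (x + y)) - ln (b + x)) <= y.
  have v0 : 0 < b + (x + y) by rewrite /b; lra.
  have := lnle _ _ b0 v0; rewrite ler_pM2l// => h.
  have := ler_wpM2l (ltW b0) h.
  have -> : (b + x) * ((b + (x + y)) / (b + x) - 1) = y by field; rewrite gt_eqF.
  by [].
have incr2 : (b + y) * (ln (b + x) - ln (b + y)) <= x - y.
  have := lnle _ _ by0 b0; rewrite ler_pM2l// => h.
  have := ler_wpM2l (ltW by0) h.
  have -> : (b + y) * ((b + x) / (b + y) - 1) = x - y by field; rewrite gt_eqF.
  by [].
have s'0 : ln (b + x) <= ln (b + (x + y)).
  by rewrite ler_ln ?posrE//; rewrite /b; lra.
have st : ln (b + y) <= ln (b + x) by rewrite ler_ln ?posrE//; lra.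
have bx : y <= b + x by rewrite /b; lra.
have XY : b + x - (b + y) = x - y by ring.
have yY : y <= b + y by rewrite /b; lra.
have YX : b + y <= b + x by lra.
move: (ln (b + (x + y))) (ln (b + x)) (ln (b + y)) s3 t3 s'0 st incr incr2.
rewrite -{1}XY; move: {XY} (b + x) (b + y) b0 by0 bx yY YX => X Y X0 Y0 yX yY YX.
move=> s' s t s3 t3 ss' ts incr incr2.
exact: (@omf_incr X Y y).
Qed.

Lemma weight_submul m n : weight (m + n) <= weight m * weight n.
Proof.
have [nm|/ltnW mn] := leqP n m; first exact: weight_submul_le.
by rewrite addnC mulrC; exact: weight_submul_le.
Qed.

(** The block from [P = 9 ^ j * n0] to [9 * P] has [8 * P] terms, each at most [1 / (P * f P)], so
    it contributes at most [8 / f P]. The ratio is 9 because [N_(j+1) = N_j ^ 9]. *)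
Lemma condensation (T : R) : 0 < T ->
  (forall B, exists n, B <= \sum_(1 <= k < n) (omf k%:R)^-1) ->
  forall B, exists J, B <= \sum_(0 <= j < J) (f ((9 ^ j)%:R * T))^-1.
Proof.
move=> T0 Hs B; pose n0 := (Num.trunc T).+1.
have Tn0 : T <= n0%:R by rewrite ltW// /n0 truncnS_gt.
have omf0 k : (0 < k)%N -> 0 < omf k%:R.
  by move=> k0; have k0' : 0 < k%:R :> R by [rewrite ltr0n]; have := omf_ge3 k0'; lra.
have main J : \sum_(1 <= k < 9 ^ J * n0) (omf k%:R)^-1 <=
    \sum_(1 <= k < n0) (omf k%:R)^-1 + 8 * \sum_(0 <= j < J) (f ((9 ^ j)%:R * T))^-1.
  elim: J => [|J IH]; first by rewrite expn0 mul1n [X in 8 * X]big_geq// mulr0 addr0.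
  have P0 : (0 < 9 ^ J * n0)%N by rewrite muln_gt0 expn_gt0.
  rewrite [in leRHS](big_nat_recr J)//= mulrDr addrA.
  rewrite (@big_cat_nat _ _ _ (9 ^ J * n0))//=; last by rewrite expnS -mulnA leq_pmull.
  apply: lerD => //; set P := (9 ^ J * n0)%N in P0 *.
  have PR : 0 < P%:R :> R by rewrite ltr0n.
  have -> : (9 ^ J.+1 * n0 = P + 8 * P)%N by rewrite expnS /P -mulnA; lia.
  apply: (@le_trans _ _ (\sum_(P <= k < P + 8 * P) (omf P%:R)^-1)).
    apply: ler_sum_nat => k /andP[Pk _].
    rewrite lef_pV2 ?posrE ?omf0//; last exact: leq_trans Pk.
    by rewrite omf_mono// ler_nat.
  rewrite sumr_const_nat addKn -[_ *+ (8 * P)]mulr_natl [(8 * P)%:R]natrM.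
  have -> : 8 * P%:R * (omf P%:R)^-1 = 8 * (f P%:R)^-1.
    have fP := f_ge3 PR.
    by rewrite /omf; field; rewrite !gt_eqF//; lra.
  rewrite ler_pM2l// lef_pV2 ?posrE.
  - apply: f_mono; first by rewrite mulr_gt0// ltr0n expn_gt0.
    by rewrite /P natrM ler_pM2l// ltr0n expn_gt0.
  - by have := f_ge3 PR; lra.
  - have : 0 < (9 ^ J)%:R * T by rewrite mulr_gt0// ltr0n expn_gt0.
    by move/f_ge3; lra.
have [n hn] := Hs (\sum_(1 <= k < n0) (omf k%:R)^-1 + 8 * B).
exists n; suff : \sum_(1 <= k < n) (omf k%:R)^-1 <= \sum_(1 <= k < 9 ^ n * n0) (omf k%:R)^-1.
  by have := main n; lra.
have nP : (n <= 9 ^ n * n0)%N.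
  by apply: leq_trans (leq_pmulr _ _) => //; apply: ltnW; apply: ltn_expl.
have [n1|n1] := leqP n 1.
  rewrite big_geq//; rewrite big_nat; apply: sumr_ge0 => k /andP[k0 _].
  by rewrite invr_ge0 ltW// omf0.
rewrite [leRHS](@big_cat_nat _ _ _ n)//= ?(ltnW n1)// lerDl big_nat; apply: sumr_ge0 => k /andP[k0 _].
by rewrite invr_ge0 ltW// omf0//; apply: leq_trans k0; apply: ltnW.
Qed.

End Weight.

(** * Choice of the parameters *)

Lemma expR_geX (R : realType) (n : nat) (x : R) : 0 <= x ->
  (x / n.+1%:R) ^+ n.+1 <= expR x.
Proof.
move=> x0; have -> : expR x = expR (x / n.+1%:R) ^+ n.+1.
  by rewrite -expRM_natl mulrC divfK ?pnatr_eq0.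
rewrite lerXn2r ?nnegrE ?expR_ge0 ?divr_ge0//.
by move: (x / _) => y; have := expR_ge1Dx y; lra.
Qed.

Lemma exists_nat_above (R : realType) (x : R) : 0 <= x ->
  exists k : nat, [/\ (0 < k)%N, x <= k%:R & k%:R <= x + 1].
Proof.
move=> x0; exists (Num.trunc x).+1; split => //; first by rewrite ltW// truncnS_gt.
by rewrite -natr1 lerD2r truncn_le.
Qed.

(** With [la = ln n] the conclusion reads [2048 * K ^ 2 <= n ^ (3/4)]; in [far_w] the remaining
    [n ^ (1/4)] dominates [d]. *)
Lemma sqr_le_expR (R : realType) (F la K : R) : 0 <= F -> 1000 * 1000 * F <= la ->
  0 <= K -> K <= 8 * (F * la ^+ 2) -> 32 * K ^+ 2 * 64 <= expR (3 / 4 * la).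
Proof.
move=> F0 laF K0 KF; pose a := la / 8.
have laE : la = 8 * a by rewrite /a; lra.
have aF : 64 * (8 * (64 * F)) <= a by lra.
have a0 : 0 <= a by apply: le_trans aF; rewrite !mulr_ge0.
have aE : 3 / 4 * la = 6%:R * a by lra.
rewrite aE expRM_natl; clear aE.
have ea : a <= expR a by have := expR_ge1Dx a; lra.
have a3 : 64 * K <= a * a ^+ 2.
  apply: (@le_trans _ _ (64 * (8 * (64 * F)) * a ^+ 2)).
    have -> : 64 * (8 * (64 * F)) * a ^+ 2 = 64 * (8 * (F * la ^+ 2)) by rewrite laE; ring.
    by rewrite ler_pM2l.
  by rewrite ler_wpM2r ?sqr_ge0.
apply: (@le_trans _ _ ((64 * K) ^+ 2)).
  have -> : (64 * K) ^+ 2 = 64 * (64 * K ^+ 2) by ring.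
  by have := sqr_ge0 K; lra.
apply: (@le_trans _ _ ((a * a ^+ 2) ^+ 2)).
  have K64 : 0 <= 64 * K by rewrite mulr_ge0.
  by rewrite lerXn2r ?nnegrE//; apply: le_trans a3.
have -> : (a * a ^+ 2) ^+ 2 = a ^+ 6 by ring.
by rewrite lerXn2r ?nnegrE ?expR_ge0.
Qed.

Lemma M_large_of (R : realType) (F l m : R) :
  3 <= F -> 1000 * 1000 <= l -> 37 * 1000 * F * l ^+ 2 <= m ->
  8 * (16 * 16) * (24 * (10 + 8 * (128 * l)) ^+ 2 + 12 * 16) <= m ^+ 2.
Proof.
move=> F3 l1 hm; have l3 : 1000 <= l by lra.
have l0 : 0 <= l by lra.
clear l1; set y := 10 + 8 * (128 * l).
have y16 : 16 <= y by rewrite /y; lra.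
have m1 : 16 * (16 * y) <= m.
  apply: le_trans hm; rewrite expr2.
  have ll : 1000 * l <= l * l by apply: ler_wpM2r.
  have ll0 : 0 <= l * l by apply: mulr_ge0.
  have Fll : 3 * (l * l) <= F * (l * l) by apply: ler_wpM2r.
  rewrite /y -[37 * 1000 * F * _]mulrA; move: (F * _) Fll => z Fll.
  by move: (l * l) ll Fll {ll0} => q; lra.
have y0 : 0 <= 16 * (16 * y) by rewrite !mulr_ge0//; lra.
apply: (@le_trans _ _ ((16 * (16 * y)) ^+ 2)); last first.
  by rewrite lerXn2r ?nnegrE//; apply: le_trans m1.
have -> : (16 * (16 * y)) ^+ 2 = 16 * (16 * (16 * (16 * y ^+ 2))) by ring.
have : 16 * y <= y ^+ 2 by rewrite expr2; apply: ler_wpM2r => //; lra.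
by move: (y ^+ 2) => q; lra.
Qed.

Section Level.
Variables (R : realType) (f : R -> R) (M : nat).
Hypothesis f_ge3 : forall t, 0 < t -> 3 <= f t.
Hypothesis f_mono : forall x y, 0 < x -> x <= y -> f x <= f y.
Hypothesis f_slow : forall x y, 0 < x -> x <= y -> x * f y <= y * f x.

Let l : R := ln M%:R.
Hypothesis l_big : 1000 * 1000 * f 1 <= l.
Let d := (M ^ 16)%N.
Let Q := (d ^ 8)%N.
Let F := f 1.
Let t := 16 * l.

Let F3 : 3 <= F. Proof. exact: f_ge3. Qed.
Let l1 : 1000 * 1000 <= l. Proof. by have := l_big; have := F3; rewrite /F; lra. Qed.
Let t_gt0 : 0 < t. Proof. by have := l1; rewrite /t; lra. Qed.

Lemma level_M_gt0 : (0 < M)%N.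
Proof. by case: (posnP M) l1 => // M0; rewrite /l M0 ln0//; lra. Qed.

Let M_E : M%:R = expR l :> R.
Proof. by rewrite lnK// posrE ltr0n level_M_gt0. Qed.
Let d_E : d%:R = expR (16 * l) :> R.
Proof. by rewrite natrX M_E expRM_natl. Qed.
Let Q_E : Q%:R = expR (128 * l) :> R.
Proof. by rewrite natrX d_E -expRM_natl; congr expR; lra. Qed.
Let omt : 48 * l <= omf f t.
Proof. by have := omf_ge3 f_ge3 t_gt0; rewrite {1}/t; lra. Qed.

Let expR_l (c : R) : 0 <= c -> c <= 1000 * 1000 -> c <= expR l.
Proof. by move=> c0 c1; have := expR_ge1Dx l; have := l1; lra. Qed.

(** From [exp l >= (l / 3) ^ 3] and [10 ^ 6 / 27 > 37000]. The constant exceeds [121 * 16 ^ 2], as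
    needed for [p <= M]. *)
Let M_ge : 37 * 1000 * F * l ^+ 2 <= M%:R.
Proof.
rewrite M_E; apply: le_trans (@expR_geX _ 2 l _); last by have := l1; lra.
have -> : (l / 3) ^+ 3 = l / 27 * l ^+ 2 by field.
rewrite ler_wpM2r ?sqr_ge0//.
by have := l_big; have := F3; rewrite /F; lra.
Qed.

Let p_leM (p : nat) : p%:R <= 121 * omf f t -> (p <= M)%N.
Proof.
move=> p_le; rewrite -(ler_nat R); apply: le_trans p_le _; apply: le_trans M_ge.
have t1 : 1 <= t by have := l1; rewrite /t; lra.
have := omf_quad f_slow t1; rewrite -/F /t.
have : 0 <= F * l ^+ 2 by rewrite mulr_ge0 ?sqr_ge0//; have := F3; lra.
by lra.
Qed.

Let weight_le (n : nat) (x : R) : 1 <= x -> 64 + n%:R <= expR x ->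
  weight f n <= expR (omf f x).
Proof.
move=> x1 h; rewrite ler_expR; apply: (omf_mono f_ge3 f_mono).
  by have := ln64_ge3 R n; lra.
rewrite -[leRHS]expRK ler_ln ?posrE ?expR_gt0 ?ltr0n//.
by rewrite natrD.
Qed.

Let inv4M : expR (- (2 * l)) <= (4 * M%:R)^-1.
Proof.
rewrite expRN lef_pV2 ?posrE ?expR_gt0 ?mulr_gt0 ?ltr0n ?level_M_gt0//.
have -> : 2 * l = l + l by ring.
by rewrite expRD M_E ler_pM2r ?expR_gt0// expR_l//; lra.
Qed.

(** Here [d * m] is at most [exp (9 * t)], and one more [t] absorbs the shift 64, so the weight is
    at most [exp (omf (10 * t)) <= exp (100 * omf t)]. The remaining [20 * omf t >= 960 * l] covers
    the powers of [M] and [Q]. *)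
Let near_w (p m : nat) : 120 * omf f t <= p%:R -> (m < Q)%N ->
  8^-1 ^+ p * M%:R ^+ 2 * weight f (d * m)%N * Q%:R ^+ 2 <= (4 * M%:R)^-1.
Proof.
move=> p_ge mQ; apply: le_trans inv4M.
have Wle : weight f (d * m)%N <= expR (100 * omf f t).
  apply: (@le_trans _ _ (expR (omf f (10 * t)))).
    apply: weight_le; first by have := l1; rewrite /t; lra.
    apply: (@le_trans _ _ (64 + expR (144 * l))).
      rewrite lerD2l natrM.
      have -> : 144 * l = 16 * l + 128 * l by ring.
      rewrite expRD -d_E -Q_E ler_wpM2l// ler_nat; exact: ltnW.
    have -> : 10 * t = 16 * l + 144 * l by rewrite /t; ring.
    rewrite expRD.
    have a : 65 <= expR (16 * l) by have := expR_ge1Dx (16 * l); have := l1; lra.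
    have b : 1 <= expR (144 * l) by have := expR_ge1Dx (144 * l); have := l1; lra.
    by have := ler_wpM2r (le_trans ler01 b) a; lra.
  rewrite ler_expR; apply: (le_trans (omf_scale f_slow _ t_gt0)); lra.
have p8 : (8^-1 : R) ^+ p <= expR (- p%:R).
  have -> : - p%:R = p%:R * (- 1) :> R by rewrite mulrN mulr1.
  rewrite expRM_natl lerXn2r ?nnegrE ?expR_ge0//.
  by rewrite expRN lef_pV2 ?posrE ?expR_gt0//; have := expR1_le4 R; lra.
apply: (@le_trans _ _ (expR (- p%:R) * M%:R ^+ 2 * expR (100 * omf f t) * Q%:R ^+ 2)).
  rewrite ler_wpM2r ?sqr_ge0//; apply: ler_pM => //.
  - exact: expR_ge0.
  - by rewrite ler_wpM2r ?sqr_ge0.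
rewrite M_E Q_E -!expRM_natl -!expRD ler_expR.
by have := omt; have := l1; move: p_ge; clear p8 Wle mQ; lra.
Qed.

(** With [la = ln n], the weight at [d * n] is at most [exp (omf (3 * la)) <= exp (9 * F * la ^ 2)].
    Taking [k] about [7 * F * la ^ 2], the kernel decay [exp (- 2 * k)] beats it with room for the
    polynomial factors. *)
Let far_w n : (Q <= 2 * n)%N -> exists2 k : nat,
  32 * k%:R ^+ 2 <= d%:R^-1 / 64 * n%:R :> R &
  2 * expR (- (2 * k%:R)) * weight f (d * n)%N * (1 + n)%:R ^+ 2 <= (4 * M%:R)^-1.
Proof.
move=> Qn; have n0 : (0 < n)%N.
  case: (posnP n) Qn => // -> ; rewrite muln0 leqn0 /Q /d !expn_eq0.
  by have := level_M_gt0; case: (M).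
pose la : R := ln n%:R.
have nE : n%:R = expR la :> R by rewrite lnK// posrE ltr0n.
have la_ge : 127 * l <= la.
  rewrite -ler_expR -nE.
  have := Qn; rewrite -(ler_nat R) Q_E natrM.
  have -> : 128 * l = l + 127 * l by ring.
  rewrite expRD.
  have := @expR_l 2; have := expR_gt0 (127 * l); move: (expR l) (expR (127 * l)) n%:R.
  move=> a b c b0 /(_ _ _) h; have {}h : 2 <= a by apply: h; lra.
  by have := ler_wpM2r (ltW b0) h; lra.
have laF : 1000 * 1000 * F <= la by have := l_big; have := l1; rewrite -/F; lra.
have la0 : 0 < la by have := l1; lra.
have Fla : 1 <= F * la ^+ 2.
  by rewrite -[leLHS]mulr1 ler_pM// ?exprn_ege1//; have := F3; have := l1; lra.
have [k [_ k_ge k_le]] : exists k : nat, [/\ (0 < k)%N,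
    7 * (F * la ^+ 2) <= k%:R & k%:R <= 7 * (F * la ^+ 2) + 1].
  by apply: exists_nat_above; lra.
have {}k_le : k%:R <= 8 * (F * la ^+ 2) by lra.
have expla c : 0 <= c -> c <= 1000 * 1000 -> c <= expR la.
  by move=> c0 c1; have := expR_ge1Dx la; have := l1; lra.
exists k.
  have d0 : 0 < d%:R :> R by rewrite d_E expR_gt0.
  have -> : d%:R^-1 / 64 * n%:R = n%:R / (64 * d%:R) :> R by field; rewrite gt_eqF.
  rewrite ler_pdivlMr ?mulr_gt0// nE mulrA.
  have -> : expR la = expR (3 / 4 * la) * expR (la / 4) by rewrite -expRD; congr expR; lra.
  apply: ler_pM => //; first by apply: sqr_le_expR laF _ k_le => //; have := F3; lra.
  by rewrite d_E ler_expR; have := l1; move: la_ge; lra.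
apply: le_trans inv4M.
have Wle : weight f (d * n)%N <= expR (9 * (F * la ^+ 2)).
  apply: (@le_trans _ _ (expR (omf f (3 * la)))).
    apply: weight_le; first by have := l1; lra.
    rewrite natrM d_E nE -expRD.
    apply: (@le_trans _ _ (64 + expR (2 * la))).
      by rewrite lerD2l ler_expR; have := l1; lra.
    have -> : 3 * la = la + 2 * la by ring.
    rewrite expRD.
    have a := @expla 65.
    have b : 1 <= expR (2 * la) by have := expR_ge1Dx (2 * la); lra.
    have {}a : 65 <= expR la by apply: a; lra.
    by have := ler_wpM2r (le_trans ler01 b) a; lra.
  rewrite ler_expR; apply: (le_trans (omf_quad f_slow _)); first by have := l1; lra.
  by rewrite -/F; lra.
have n1 : (1 + n)%:R <= expR (2 * la).
  rewrite natrD nE; have -> : 2 * la = la + la by ring.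
  rewrite expRD; have a := @expla 2.
  have {}a : 2 <= expR la by apply: a; lra.
  by have := ler_wpM2r (le_trans (ler0n _ 2) a) a; lra.
have two := @expla 2.
have {}two : 2 <= expR la by apply: two; lra.
apply: (@le_trans _ _ (expR la * expR (- (2 * k%:R)) * expR (9 * (F * la ^+ 2)) * expR (2 * la) ^+ 2)).
  apply: ler_pM => //.
  - by rewrite !mulr_ge0 ?expR_ge0.
  - apply: ler_pM => //.
      exact: expR_ge0.
    by rewrite ler_wpM2r ?expR_ge0.
  - by rewrite lerXn2r ?nnegrE ?expR_ge0.
rewrite -!expRM_natl -!expRD ler_expR.
have : 3 * la <= F * la ^+ 2.
  rewrite expr2 mulrA; apply: ler_wpM2r; first exact: ltW.
  have : 3 * 1 <= F * la by apply: ler_pM => //; [have := l1; lra].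
  by lra.
have := l1; move: la_ge k_ge; lra.
Qed.

(** The factor [121 * 16] comes from [p <= 121 * omf t = 121 * 16 * l * f (16 * l)], which turns the
    covered proportion [l / p] of [block] into a multiple of [1 / f (16 * l)]. *)
Lemma level : exists (A Rm : int -> R[i]) (U : pred nat),
  [/\ (forall m, A m != 0 -> 0 <= m < Q%:Z), A 0 = 1,
      (forall m, m != 0 -> nc (A m) <= M%:R^-1),
      (forall L, zs L (fun m => nc (Rm m) * weight f (d * `|m|)%N) <= M%:R^-1) &
  \sum_(0 <= j < Q) (~~ U j)%:R <=
      (1 - (8 * (16 * 16) * (121 * 16))^-1 * (f (16 * l))^-1) * Q%:R /\
  forall j (x : R), U j -> 2 * pi * j%:R / Q%:R <= x <= 2 * pi * j.+1%:R / Q%:R ->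
    forall c : R, 0 < c -> exists L0, forall L, (L0 <= L)%N ->
      nc (zs L (fun m => (A m + Rm m) * expi (m%:~R * x))) <= c].
Proof.
have M16 : (16 <= M)%N by rewrite -(ler_nat R) M_E expR_l//; lra.
have M0 := level_M_gt0.
have Md : (16 * (16 * M) <= d)%N.
  rewrite /d mulnA; apply: (@leq_trans (M * M * M)).
    by rewrite leq_mul2r (leq_mul M16 M16) orbT.
  have -> : (M * M * M = M ^ 3)%N by rewrite !expnS expn0 muln1 mulnA.
  by rewrite leq_exp2l//; apply: leq_trans M16.
have d1 : (16 * 16 <= d)%N.
  by apply: leq_trans Md; rewrite leq_mul2l leq_pmulr// orbT.
have d0 : (0 < d)%N by apply: leq_trans d1.
have dQ4 : (2 * (d * d * d * d) + 2 <= Q)%N.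
  have -> : (Q = (d * d * d * d) * (d * d * d * d))%N by rewrite /Q !expnS expn0 muln1 !mulnA.
  have : (16 * 16 <= d * d * d * d)%N.
    by apply: (leq_trans d1); move: (d) d0 => D D0; rewrite leq_pmull// !muln_gt0 D0.
  by move: (d * d * d * d)%N => D; clear; nia.
have dQ : (d <= Q)%N by rewrite /Q expnS leq_pmulr// expn_gt0 d0.
have [p [p0 p_ge p_le]] : exists p : nat, [/\ (0 < p)%N,
    120 * omf f t <= p%:R & p%:R <= 120 * omf f t + 1].
  by apply: exists_nat_above; have := omt; have := l1; lra.
have {}p_le : p%:R <= 121 * omf f t by have := omt; have := l1; lra.
have [] := @block R (weight f) M p d Q l (d%:R^-1) Md dQ4 dQ M16 p0 (p_leM p_le) erefl erefl _ _ _
  (10 + 8 * (128 * l)) _ _ (weight_ge1 f_ge3) (weight_sqr f_ge3) (fun m => @near_w p m p_ge) far_w.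
- by rewrite -natrX mulVf// pnatr_eq0 -lt0n.
- rewrite d_E Q_E -expRN -expRD; have := expR_ge1Dx (- (16 * l) + 128 * l).
  by have := l1; lra.
- by have := omt; have := l1; lra.
- by rewrite Q_E expRK.
- exact: (M_large_of F3 l1 M_ge).
move=> A [Rm [U [h1 h2 h3 h4 [h5 h6]]]]; exists A, Rm, U; split => //; split => //.
apply: (le_trans h5); rewrite ler_wpM2r// lerD2l lerN2.
have p0R : 0 < p%:R :> R by rewrite ltr0n.
have ft := f_ge3 t_gt0; rewrite -/t.
rewrite -invfM ler_pdivlMr ?mulr_gt0// mulrC ler_pdivrMr ?mulr_gt0//; last by lra.
by move: p_le; rewrite /omf {1}/t; lra.
Qed.

End Level.

(** * The exceptional set *)

(** The Fourier coefficients of [G (N * t)] when those of [G] are [g]. *)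
Definition dilate (V : nmodType) (N : nat) (g : int -> V) (k : int) : V :=
  if (N%:Z %| k)%Z then g (k %/ N%:Z)%Z else 0.

Lemma zs_dilate (V : nmodType) (N L : nat) (g : int -> V) : (0 < N)%N ->
  zs L (dilate N g) = zs (L %/ N) g.
Proof.
move=> N0; elim: L => [|L IH].
  by rewrite div0n !zs0E /dilate dvdz0 div0z.
rewrite zsS IH divnS// /dilate !dvdzE abszN !absz_nat.
have [/dvdnP[q qE]|] := boolP (N %| L.+1)%N; last by rewrite !addr0 add0n.
have E : (q = (L %/ N).+1)%N by have := divnS L N0; rewrite qE dvdn_mull// mulnK.
rewrite add1n zsS -E qE PoszM -mulNr !mulzK//; by rewrite eqz_nat -lt0n.
Qed.

Lemma truncn_mul_divn (R : realType) (x : R) (Q : nat) : 0 <= x -> (0 < Q)%N ->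
  (Num.trunc (x * Q%:R) %/ Q)%N = Num.trunc x.
Proof.
move=> x0 Q0; have Q0R : 0 < Q%:R :> R by rewrite ltr0n.
set q := Num.trunc (x * Q%:R); apply/esym/truncn_def.
have /andP[q1 q2] : q%:R <= x * Q%:R < q.+1%:R.
  by rewrite truncn_itv// mulr_ge0.
apply/andP; split.
  rewrite -(ler_pM2r Q0R); apply: le_trans q1.
  by rewrite -natrM ler_nat leq_trunc_div.
rewrite -(ltr_pM2r Q0R); apply: (lt_le_trans q2).
by rewrite -natrM ler_nat ltn_ceil.
Qed.

Lemma sum_divn_modn (R : comNzRingType) (N Q : nat) (g h : nat -> R) : (0 < Q)%N ->
  \sum_(0 <= n < N * Q) g (n %/ Q)%N * h (n %% Q)%N =
  (\sum_(0 <= a < N) g a) * \sum_(0 <= b < Q) h b.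
Proof.
move=> Q0; rewrite big_nat_mul mulr_suml; apply: eq_bigr => a _.
rewrite mulSnr -{1}[(a * Q)%N]add0n big_addn addKn mulr_sumr.
rewrite !big_nat; apply: eq_bigr => b /andP[_ bQ].
by rewrite divnDMl// (divn_small bQ) add0n addnC modnMDl modn_small.
Qed.

Lemma lebesgue_measure_bigsetU_le (R : realType) (I : Type) (s : seq I)
    (F : I -> set R) (c : R) :
  (forall i, measurable (F i)) -> (forall i, (lebesgue_measure (F i) <= c%:E)%E) ->
  (lebesgue_measure (\big[setU/set0]_(i <- s) F i) <= ((size s)%:R * c)%:E)%E.
Proof.
move=> mF hF; elim: s => [|i s IH]; first by rewrite big_nil measure0 mul0r.
rewrite big_cons; apply: (le_trans (measureU2 _ _ _)).
- exact: mF.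
- by apply: bigsetU_measurable => k _; exact: mF.
rewrite /= -natr1 mulrDl mul1r addrC EFinD; exact: leeD.
Qed.

Section Survivors.
Variables (R : realType) (N Q : nat -> nat) (U : nat -> pred nat) (delta : nat -> R).
Hypothesis N_gt0 : forall j, (0 < N j)%N.
Hypothesis NS : forall j, N j.+1 = (N j * Q j)%N.
Hypothesis delta_le1 : forall j, delta j <= 1.
Hypothesis U_count : forall j,
  \sum_(0 <= n < Q j) (~~ U j n)%:R <= (1 - delta j) * (Q j)%:R.
Hypothesis delta_div : forall B, exists J, B <= \sum_(0 <= j < J) delta j.

Let Q_gt0 j : (0 < Q j)%N.
Proof. by have := N_gt0 j.+1; rewrite NS muln_gt0 => /andP[]. Qed.

(** Cell [n] of level [i + 1] is piece [n %% Q i] of cell [n %/ Q i] of level [i]; it survives if no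
    digit met on the way up marks a zero arc. *)
Fixpoint survives j n :=
  if j is i.+1 then survives i (n %/ Q i)%N && ~~ U i (n %% Q i)%N else true.

Definition cell j (n : nat) : set R :=
  `[2 * pi * n%:R / (N j)%:R, 2 * pi * n.+1%:R / (N j)%:R].
Definition stage j : set R :=
  \big[setU/set0]_(n <- [seq n <- iota 0 (N j) | survives j n]) cell j n.
Definition survivors : set R := \bigcap_j stage j.

Let N_gt0R j : 0 < (N j)%:R :> R. Proof. by rewrite ltr0n. Qed.

Lemma survives_count j : (size [seq n <- iota 0 (N j) | survives j n])%:R <=
  (N j)%:R * \prod_(0 <= i < j) (1 - delta i).
Proof.
have -> : (size [seq n <- iota 0 (N j) | survives j n])%:R =
    \sum_(0 <= n < N j) (survives j n)%:R :> R.
  rewrite size_filter -sum1_count natr_sum /index_iota subn0 big_mkcond /=.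
  by apply: eq_bigr => n _; case: (survives j n).
elim: j => [|j IH].
  by rewrite [X in _ * X]big_geq// mulr1 /= sumr_const_nat subn0.
rewrite NS big_nat_recr//= natrM.
have -> : \sum_(0 <= n < N j * Q j)
    (survives j (n %/ Q j) && ~~ U j (n %% Q j)%N)%:R =
    \sum_(0 <= n < N j * Q j) (survives j (n %/ Q j))%:R * (~~ U j (n %% Q j)%N)%:R :> R.
  by apply: eq_bigr => n _; rewrite -natrM mulnb.
rewrite (sum_divn_modn _ (fun a => (survives j a)%:R) (fun b => (~~ U j b)%:R))//.
have -> : (N j)%:R * (Q j)%:R * (\prod_(0 <= i < j) (1 - delta i) * (1 - delta j)) =
   (N j)%:R * \prod_(0 <= i < j) (1 - delta i) * ((1 - delta j) * (Q j)%:R) by ring.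
by apply: ler_pM => //; apply: sumr_ge0.
Qed.

Lemma prod_delta_small (e : R) : 0 < e ->
  exists J, \prod_(0 <= i < J) (1 - delta i) <= e.
Proof.
move=> e0; have [J hJ] := delta_div (- ln e); exists J.
apply: (@le_trans _ _ (expR (- \sum_(0 <= j < J) delta j))).
  rewrite -sumrN; elim: J {hJ} => [|J IH]; first by rewrite !big_geq// expR0.
  rewrite !big_nat_recr//= expRD; apply: ler_pM => //.
  - by apply: prodr_ge0 => i _; rewrite subr_ge0.
  - by rewrite subr_ge0.
  - exact: expR_ge1Dx.
by rewrite -[leRHS]lnK// ler_expR; lra.
Qed.

Let cell_closed j n : closed (cell j n). Proof. exact: itv_closed. Qed.
Let cell_measurable j n : measurable (cell j n). Proof. exact: measurable_itv. Qed.

Lemma stageP j t : stage j t <->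
  exists n, [/\ (n < N j)%N, survives j n & cell j n t].
Proof.
rewrite /stage -bigcup_seq; split => [[n /=]|[n [nN sn ct]]].
  by rewrite mem_filter mem_iota add0n => /andP[sn nN] ct; exists n.
by exists n => //=; rewrite mem_filter mem_iota sn.
Qed.

Lemma compact_survivors : compact survivors.
Proof.
apply: (subclosed_compact _ (@segment_compact _ 0 (2 * pi))).
  apply: closed_bigI => j _; apply: closed_bigsetU => n _; exact: cell_closed.
move=> t /(_ 0%N I) /stageP[n [nN _]]; rewrite /cell /= !in_itv /= => /andP[t1 t2].
have p0 := pi_gt0 R; apply/andP; split.
  by apply: le_trans t1; rewrite divr_ge0// !mulr_ge0// ltW.
apply: (le_trans t2); rewrite ler_pdivrMr// ler_wpM2l ?ler_nat//.
by rewrite mulr_ge0// ltW.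
Qed.

Lemma survivors_null : lebesgue_measure survivors = 0%E.
Proof.
have p0 := pi_gt0 R.
have mst j : measurable (stage j) by apply: bigsetU_measurable.
have ms : measurable survivors by apply: bigcapT_measurable.
apply/eqP; rewrite eq_le measure_ge0 andbT; apply/lee_addgt0Pr => e e0; rewrite add0e.
have [|J hJ] := @prod_delta_small (e / (2 * pi)).
  by rewrite divr_gt0// mulr_gt0.
apply: (@le_trans _ _ (lebesgue_measure (stage J))).
  by apply: le_measure; rewrite ?inE; [exact: ms|exact: mst|exact: bigcap_inf].
have hc n : (lebesgue_measure (cell J n) <= (2 * pi / (N J)%:R)%:E)%E.
  rewrite lebesgue_measure_itv /=; case: ifP => _; last first.
    by rewrite lee_fin divr_ge0// mulr_ge0// ltW.
  rewrite EFinN -EFinD lee_fin -[n.+1%:R]natr1.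
  by rewrite le_eqVlt; apply/orP; left; apply/eqP; ring.
apply: (le_trans (lebesgue_measure_bigsetU_le _ (cell_measurable J) hc)).
rewrite lee_fin.
apply: (@le_trans _ _ ((N J)%:R * (e / (2 * pi)) * (2 * pi / (N J)%:R))).
  rewrite ler_wpM2r//; first by rewrite divr_ge0// mulr_ge0// ltW.
  by apply: (le_trans (survives_count J)); rewrite ler_pM2l.
have cancel (a b : R) : 0 < a -> 0 < b -> b * (e / a) * (a / b) = e.
  by move=> a0 b0; field; rewrite !gt_eqF.
by rewrite cancel// mulr_gt0.
Qed.

(** The integer parts [nn j] of [t * N j / (2 * pi)] are consistent across levels, and
    [nn j.+1 %% Q j] locates [N j * t] modulo [2 * pi] among the arcs of length [2 * pi / Q j]. If
    none of these digits lay in [U], the cells [nn j] would put [t] in every stage. *)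
Lemma not_survivor t : 0 <= t -> t < 2 * pi -> ~ survivors t ->
  exists j (a b : nat), U j b /\
    2 * pi * b%:R / (Q j)%:R <= (N j)%:R * t - a%:R * (2 * pi)
      <= 2 * pi * b.+1%:R / (Q j)%:R.
Proof.
move=> t0 t2 tK; have p0 : 0 < 2 * pi :> R by rewrite mulr_gt0// pi_gt0.
pose x j := t * (N j)%:R / (2 * pi).
have x0 j : 0 <= x j by apply: divr_ge0; [exact: mulr_ge0|exact: ltW].
pose nn j := Num.trunc (x j).
have nnE j : (nn j.+1 %/ Q j)%N = nn j.
  rewrite [RHS]/nn -(truncn_mul_divn (x0 j) (Q_gt0 j)); congr (Num.trunc _ %/ _)%N.
  by rewrite /x NS natrM; ring.
have nn_itv j : (nn j)%:R <= x j < (nn j).+1%:R by rewrite truncn_itv.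
have [[j Uj]|noU] := pselect (exists j, U j (nn j.+1 %% Q j)%N).
  exists j, (nn j), (nn j.+1 %% Q j)%N; split => //.
  have /andP[h1 h2] := nn_itv j.+1.
  have E : (nn j.+1)%:R = (nn j)%:R * (Q j)%:R + (nn j.+1 %% Q j)%:R :> R.
    by rewrite {1}(divn_eq (nn j.+1) (Q j)) nnE natrD natrM.
  rewrite -natr1 E in h2; rewrite E in h1.
  have Q0 : 0 < (Q j)%:R :> R by rewrite ltr0n.
  have xE : x j.+1 * (2 * pi) = (N j)%:R * (Q j)%:R * t.
    by rewrite /x NS natrM divfK ?gt_eqF//; ring.
  have {}h1 := ler_wpM2r (ltW p0) h1; have {}h2 := ler_wpM2r (ltW p0) (ltW h2).
  rewrite xE in h1 h2; rewrite ler_pdivrMr// ler_pdivlMr// -[_.+1%:R]natr1.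
  by apply/andP; split; lra.
case: tK => j _; apply/stageP; exists (nn j).
have /andP[h1 h2] := nn_itv j; split.
- rewrite -(ltr_nat R); apply: (le_lt_trans h1).
  by rewrite /x ltr_pdivrMr// mulrC ltr_pM2l.
- elim: j {h1 h2} => // j IH /=; rewrite nnE IH /=.
  by apply/negP => Uj; apply: noU; exists j.
- rewrite /cell /= in_itv /= ler_pdivrMr// ler_pdivlMr//.
  have xE : x j * (2 * pi) = t * (N j)%:R by rewrite divfK// gt_eqF.
  have {}h1 := ler_wpM2r (ltW p0) h1; have {}h2 := ler_wpM2r (ltW p0) (ltW h2).
  by rewrite xE in h1 h2; apply/andP; split; lra.
Qed.

End Survivors.

(** * The infinite product *)

Section Construction.
Variables (R : realType) (f : R -> R).
Hypothesis f_ge3 : forall t, 0 < t -> 3 <= f t.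
Hypothesis f_mono : forall x y, 0 < x -> x <= y -> f x <= f y.
Hypothesis f_slow : forall x y, 0 < x -> x <= y -> x * f y <= y * f x.
Hypothesis omf_div : forall B, exists n, B <= \sum_(1 <= k < n) (omf f k%:R)^-1.

Lemma construction : exists (K : set R) (c : int -> R[i]),
  [/\ compact K, lebesgue_measure K = 0%E, c 0 != 0,
      forall t : R, (forall k : int, ~ K (t + k%:~R * (2 * pi))) ->
        (fun n : nat => nc (sym_partial_sum c t n)) @ \oo --> (0 : R) &
      forall n : nat, (0 < n)%N -> nc (c (- n%:Z)) <= 2 / weight f n].
Proof.
have [M0 M0_big] : exists M0 : nat, 1000 * 1000 * f 1 <= ln M0%:R.
  have [M0 [M0_gt0 h _]] := exists_nat_above (expR_ge0 (1000 * 1000 * f 1)).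
  exists M0; rewrite -[leLHS]expRK ler_ln ?posrE ?expR_gt0 ?ltr0n//.
have f1 : 3 <= f 1 by apply: f_ge3.
have lnM0_gt0 : 0 < ln M0%:R :> R by lra.
have M0_gt0 := level_M_gt0 f_ge3 M0_big.
(* The exponent 9 makes [N j = M j ^ 16] satisfy [N j.+1 = N j ^ 9 = N j * Q j] with
   [Q j = N j ^ 8]. *)
pose M j := (M0 ^ 9 ^ j)%N.
have M_gt0 j : (0 < M j)%N by rewrite expn_gt0 M0_gt0.
have lnM j : ln (M j)%:R = (9 ^ j)%:R * ln M0%:R :> R.
  by rewrite [(M j)%:R]natrX lnXn ?ltr0n// mulr_natl.
have M_big j : 1000 * 1000 * f 1 <= ln (M j)%:R.
  rewrite lnM; apply: (le_trans M0_big); rewrite ler_peMl ?ler1n ?expn_gt0//.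
  exact: ltW.
have M0_16 : (16 <= M0)%N.
  rewrite -(ler_nat R) -[M0%:R]lnK ?posrE ?ltr0n//.
  by have := expR_ge1Dx (ln M0%:R : R); lra.
have M_16 j : (16 ^ j.+1 <= M j)%N.
  apply: (@leq_trans (M0 ^ j.+1)); first by rewrite leq_exp2r.
  have M1 : (1 < M0)%N by apply: leq_trans M0_16.
  by rewrite /M leq_exp2l//; apply: ltn_expl.
have /choice[X HX] : forall j, exists X : (int -> R[i]) * (int -> R[i]) * pred nat,
    let: (A, Rm, U) := X in
  [/\ (forall m, A m != 0 -> 0 <= m < ((M j ^ 16) ^ 8)%:Z), A 0 = 1,
      (forall m, m != 0 -> nc (A m) <= (M j)%:R^-1),
      (forall L, zs L (fun m => nc (Rm m) * weight f (M j ^ 16 * `|m|)%N) <= (M j)%:R^-1) &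
  \sum_(0 <= n < (M j ^ 16) ^ 8) (~~ U n)%:R <=
      (1 - (8 * (16 * 16) * (121 * 16))^-1 * (f (16 * ln (M j)%:R))^-1) * ((M j ^ 16) ^ 8)%:R /\
  forall n (x : R), U n ->
    2 * pi * n%:R / ((M j ^ 16) ^ 8)%:R <= x <= 2 * pi * n.+1%:R / ((M j ^ 16) ^ 8)%:R ->
    forall c : R, 0 < c -> exists L0, forall L, (L0 <= L)%N ->
      nc (zs L (fun m => (A m + Rm m) * expi (m%:~R * x))) <= c].
  move=> j; have [A [Rm [U h]]] := level f_ge3 f_mono f_slow (M_big j).
  by exists (A, Rm, U).
pose A j := (X j).1.1; pose Rm j := (X j).1.2; pose U j := (X j).2.
pose N j := (M j ^ 16)%N; pose Q j := (N j ^ 8)%N.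
have N_gt0 j : (0 < N j)%N by rewrite expn_gt0 M_gt0.
have NS j : N j.+1 = (N j * Q j)%N.
  by rewrite /Q /N -[RHS]expnS /M [(9 ^ j.+1)%N]expnSr expnM expnAC.
pose delta j : R := (8 * (16 * 16) * (121 * 16))^-1 * (f (16 * ln (M j)%:R))^-1.
have {}HX j : [/\ (forall m, A j m != 0 -> 0 <= m < (Q j)%:Z), A j 0 = 1,
      (forall m, m != 0 -> nc (A j m) <= (M j)%:R^-1),
      (forall L, zs L (fun m => nc (Rm j m) * weight f (N j * `|m|)%N) <= (M j)%:R^-1) &
  \sum_(0 <= n < Q j) (~~ U j n)%:R <= (1 - delta j) * (Q j)%:R /\
  forall n (x : R), U j n -> 2 * pi * n%:R / (Q j)%:R <= x <= 2 * pi * n.+1%:R / (Q j)%:R ->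
    forall c : R, 0 < c -> exists L0, forall L, (L0 <= L)%N ->
      nc (zs L (fun m => (A j m + Rm j m) * expi (m%:~R * x))) <= c].
  by have := HX j; rewrite /A /Rm /U; case: (X j) => [[]].
have fM_gt0 j : 3 <= f (16 * ln (M j)%:R).
  by apply: f_ge3; rewrite mulr_gt0//; have := M_big j; lra.
have delta_le1 j : delta j <= 1.
  have h : (f (16 * ln (M j)%:R))^-1 <= 1 by rewrite invf_le1//; have := fM_gt0 j; lra.
  have h0 : 0 <= (f (16 * ln (M j)%:R))^-1 by rewrite invr_ge0; have := fM_gt0 j; lra.
  by rewrite /delta; lra.
have delta_div B : exists J, B <= \sum_(0 <= j < J) delta j.
  have T0 : 0 < 16 * ln M0%:R :> R by rewrite mulr_gt0.
  have [J hJ] := condensation f_ge3 f_mono T0 omf_div (8 * (16 * 16) * (121 * 16) * B).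
  exists J; rewrite /delta -mulr_sumr ler_pdivlMl ?mulr_gt0//.
  apply: (le_trans hJ); rewrite le_eqVlt; apply/orP; left; apply/eqP.
  by apply: eq_bigr => j _; rewrite lnM mulrCA.
have U_count j : \sum_(0 <= n < Q j) (~~ U j n)%:R <= (1 - delta j) * (Q j)%:R.
  by case: (HX j) => _ _ _ _ [].
have Mj_inv j : (M j)%:R^-1 <= 2^-1 ^+ (j + 3) :> R.
  rewrite exprVn lef_pV2 ?posrE ?ltr0n ?exprn_gt0// -natrX ler_nat.
  apply: leq_trans (M_16 j); rewrite (_ : 16 = 2 ^ 4)%N// -expnM leq_exp2l//.
  by lia.
have dilsupp (V : nmodType) n (g : int -> V) k : dilate n g k != 0 -> (n%:Z %| k)%Z.
  by rewrite /dilate; case: ifP => //; rewrite eqxx.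
have [|||||||||||||c [c0 c_neg c_van]] := @assembly R (weight f) N
    (fun j => dilate (N j) (A j)) (fun j => dilate (N j) (Rm j)) (fun j => (M j)%:R^-1)
    (weight_ge1 f_ge3).
- exact: weight_mono.
- exact: weight_submul.
- exact: weight_sqr.
- exact: N_gt0.
- by move=> j; rewrite NS dvdn_mulr.
- move=> j k h; rewrite (dilsupp _ _ _ _ h) andbT.
  have Nk := dilsupp _ _ _ _ h; move: h; rewrite /dilate Nk.
  have [+ _ _ _ _] := HX j => /[apply] /andP[h1 h2].
  have N0 : 0 < (N j)%:Z by rewrite ltz_nat.
  rewrite -(divzK Nk) NS PoszM [(N j)%:Z * _]mulrC ltr_pM2r// h2 andbT.
  by rewrite mulr_ge0.
- by move=> j k; apply: dilsupp.
- by move=> j; rewrite /dilate dvdz0 div0z; case: (HX j).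
- move=> j k k0; rewrite /dilate; case: ifP => Nk; last by rewrite nc0 invr_ge0.
  have [_ _ h _ _] := HX j; apply: h; apply: contra k0 => /eqP h.
  by rewrite -(divzK Nk) h mul0r.
- by move=> j; rewrite invf_le1 ?ltr0n// ler1n.
- move=> j; rewrite lef_pV2 ?posrE ?ltr0n// ler_nat /M.
  have M1 : (1 < M0)%N by apply: leq_trans M0_16.
  by rewrite (leq_exp2l _ _ M1) leq_exp2l.
- move=> e e0; have [|J [J0 J1 _]] := @exists_nat_above R e^-1; first by rewrite invr_ge0 ltW.
  exists J; rewrite -[e]invrK lef_pV2 ?posrE ?invr_gt0 ?ltr0n//.
  apply: (le_trans J1); rewrite ler_nat; apply: leq_trans (M_16 J).
  by apply: ltnW; apply: ltnW; apply: ltn_expl.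
- move=> j L; apply: le_trans (Mj_inv j).
  have [_ _ _ h _] := HX j; apply: le_trans (h (L %/ N j)%N).
  rewrite -zs_dilate// le_eqVlt; apply/orP; left; apply/eqP; apply: zs_ext => k.
  rewrite /dilate; case: ifP => Nk; last by rewrite nc0 mul0r.
  by rewrite -{2}(divzK Nk) abszM mulnC.
exists (@survivors R N Q U), c; split => //.
- exact: compact_survivors.
- exact: (survivors_null N_gt0 NS delta_le1 U_count delta_div).
move=> t tK; have p0 : 0 < 2 * pi :> R by rewrite mulr_gt0// pi_gt0.
(* The survivors lie in [[0, 2 * pi]], so [t] is replaced by its representative in [[0, 2 * pi)]. *)
pose k0 := - Num.floor (t / (2 * pi)); pose s := t + k0%:~R * (2 * pi).
have /andP[s1 s2] : (Num.floor (t / (2 * pi)))%:~R <= t / (2 * pi) <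
   (Num.floor (t / (2 * pi)) + 1)%:~R by exact: floor_itv.
have tE : t / (2 * pi) * (2 * pi) = t by rewrite divfK// gt_eqF.
have s_ge0 : 0 <= s.
  have := ler_wpM2r (ltW p0) s1; rewrite tE /s /k0 rmorphN /= mulNr; lra.
have s_lt : s < 2 * pi.
  have := s2; rewrite -(ltr_pM2r p0) tE intrD /s /k0 rmorphN /= mulNr mulrDl mul1r; lra.
have [j [a [b [Ub sab]]]] := not_survivor N_gt0 NS s_ge0 s_lt (tK k0).
apply: (c_van t j) => e e0.
have [_ _ _ _ [_ van]] := HX j.
have [L0 hL0] := van _ _ Ub sab e e0.
exists (L0 * N j)%N => L hL.
have := hL0 (L %/ N j)%N; rewrite leq_divRL// => /(_ hL); congr (nc _ <= _).
rewrite -zs_dilate//; apply: zs_ext => k; rewrite /dilate.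
case: ifP => Nk; last by rewrite addr0 mul0r.
congr (_ * _); set m := (k %/ N j)%Z.
have -> : k%:~R * t = m%:~R * ((N j)%:R * s - a%:R * (2 * pi)) +
    (m * a%:Z - m * (N j)%:Z * k0)%:~R * (2 * pi).
  rewrite -{1}(divzK Nk) -/m !(rmorphB, rmorphM) /= /s; ring.
by rewrite expiD expi_2piM mulr1.
Qed.

End Construction.

Theorem theorem3 (R : realType) (omega : R -> R) :
  (forall t : R, 0 < t -> 0 < omega t) ->
  concave_on_pos (fun t => omega t / t) ->
  (fun n : nat => \sum_(1 <= k < n.+1) (omega k%:R)^-1) @ \oo --> +oo ->
  exists (K : set R) (c : int -> R[i]),
    [/\ compact K,
        (lebesgue_measure K = 0)%E,
        (exists n : int, c n != 0),
        (forall t : R, (forall k : int, ~ K (t + k%:~R * (2 * pi))) ->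
            (fun N : nat => Normc.normc (sym_partial_sum c t N)) @ \oo --> (0 : R))
      & (exists (M : R) (N0 : nat), forall n : nat, (N0 <= n)%N ->
            Normc.normc (c (- n%:Z)) <= M * expR (- omega (ln n%:R)))].
Proof.
move=> om_gt0 om_concave om_div.
pose g (t : R) := omega t / t; pose f t := g t + 3.
have g_gt0 t : 0 < t -> 0 < g t by move=> t0; rewrite divr_gt0// om_gt0.
have g_mono := concave_pos_nondecreasing g_gt0 om_concave.
have f_ge3 t : 0 < t -> 3 <= f t by move/g_gt0; rewrite /f; lra.
have f_mono x y : 0 < x -> x <= y -> f x <= f y.
  by move=> x0 xy; rewrite lerD2r; apply: g_mono.
have f_slow x y : 0 < x -> x <= y -> x * f y <= y * f x.
  move=> x0 xy; have := concave_pos_div g_gt0 om_concave x0 xy.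
  by rewrite -/(g x) -/(g y) /f; lra.
have omfE t : 0 < t -> omf f t = omega t + 3 * t.
  by move=> t0; rewrite /omf /f /g; field; rewrite gt_eqF.
have omf_div B : exists n, B <= \sum_(1 <= k < n) (omf f k%:R)^-1.
  (* Monotonicity of [g] gives [omega k >= g 1 * k], so passing from [omega k] to [omega k + 3 * k]
     costs at most the factor [C], and divergence is preserved. *)
  pose C := 1 + 3 / g 1.
  have g1 : 0 < g 1 by apply: g_gt0.
  have C0 : 0 < C by have : 0 < 3 / g 1 by [rewrite divr_gt0]; rewrite /C; lra.
  have /cvgryPge/(_ (C * B))[n _ hn] := om_div.
  exists n.+1; rewrite -(ler_pM2l C0); apply: (le_trans (hn n (leqnn n))).
  rewrite mulr_sumr; apply: ler_sum_nat => k /andP[k0 _].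
  have k0R : 0 < k%:R :> R by rewrite ltr0n.
  have k1R : 1 <= k%:R :> R by rewrite ler1n.
  have o0 := om_gt0 _ k0R.
  have omk : 0 < omf f k%:R by rewrite omfE//; lra.
  rewrite -[leLHS]div1r ler_pdivrMr// mulrAC ler_pdivlMr// mul1r omfE//.
  have h : g 1 * k%:R <= omega k%:R.
    by rewrite -ler_pdivlMr//; apply: (g_mono _ _ ltr01 k1R).
  suff : 3 * k%:R <= 3 / g 1 * omega k%:R by rewrite /C; lra.
  by rewrite -mulrA ler_pM2l// ler_pdivlMl.
have [K [c [K1 K2 c0 Kt cn]]] := construction f_ge3 f_mono f_slow omf_div.
exists K, c; split => //; first by exists 0.
(* Starting at [n = 2] makes [ln n] positive, the domain on which [omega] is controlled. *)
exists 2, 2%N => n n2; have n0 : (0 < n)%N by apply: leq_trans n2.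
apply: (le_trans (cn n n0)); rewrite ler_pM2l// -expRN ler_expR lerN2.
have ln0 : 0 < ln n%:R :> R by rewrite ln_gt0// ltr1n.
apply: (@le_trans _ _ (omf f (ln n%:R))); first by rewrite omfE//; lra.
apply: omf_mono => //; rewrite ler_ln ?posrE ?ltr0n//.
by rewrite ler_nat leq_addl.
Qed.
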